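(* Let $n\ge1$, let $V=\mathbb{C}^n$ be the standard $\mathrm{GL}(n,\mathbb{C})$-module and let $W=\Lambda(\Lambda^2V)$. Then $$H(W^{\mathrm{O}(n)},t)=1+\sum_{\substack{p=2\\ p\text{ even}}}^{n-1}t^{\frac{p(p+1)}{2}}\left(\sum_{\substack{a_1+\cdots+a_{p/2}\le n-p-1\\ a_1,\ldots,a_{p/2}\text{ even}}}t^{2a_1+4a_2+\cdots+p\,a_{p/2}}\right),$$ where the inner sum runs over tuples of non-negative even integers $a_1,\ldots,a_{p/2}$ with $a_1+\cdots+a_{p/2}\le n-p-1$.
   Context: $\Lambda^2V$ is the second exterior power of $V$. $\Lambda(\Lambda^2V)=\bigoplus_{i\ge0}\Lambda^i(\Lambda^2V)$ is the exterior algebra of $\Lambda^2V$, with the induced action of $\mathrm{GL}(n,\mathbb{C})$ and hence of the complex orthogonal group $\mathrm{O}(n)$. The Hilbert series is $H(\Lambda(\Lambda^2V)^{G},t)=\sum_{i\ge0}\dim\bigl(\Lambda^i(\Lambda^2V)^{G}\bigr)t^i$. Empty sums are $0$. *)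

(* Defs.v *)
From HB Require Import structures.
From mathcomp Require Import all_boot all_order all_algebra all_field.
From mathcomp Require Import boolp reals complex.

Set Implicit Arguments.
Unset Strict Implicit.
Unset Printing Implicit Defensive.

Import GRing.Theory.
Local Open Scope ring_scope.

(* The exterior algebra of a finite-dimensional space U is realized on the
   basis e_A = e_(a_1) ^ ... ^ e_(a_k), A = {a_1 < ... < a_k}, where (e_i) is
   the basis [vbasis {:U}] of U; the product of e_A and e_B carries the sign of
   the permutation sorting A followed by B.  The choice of basis is immaterial:
   [ext_inj_sq], [ext_lift_monoid], [ext_lift_inj] and [ext_lift_uniq] establish
   the universal property of the exterior algebra. *)

Lemma set_min_ind m (P : {set 'I_m} -> Prop) :
  P set0 ->
  (forall (i : 'I_m) (A : {set 'I_m}),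
     (forall j, j \in A -> (i < j)%N) -> P A -> P (i |: A)) ->
  forall A, P A.
Proof.
move=> P0 PS A; have [k] := ubnP #|A|; elim: k A => // k IH A leA.
have [->//|[x xA]] := set_0Vmem A.
case: (@arg_minnP _ x (mem A) (fun i => nat_of_ord i) xA) => i /[!inE] iA imin.
rewrite -(setD1K iA); apply: PS => [j|].
  by rewrite !inE => /andP[nij jA]; rewrite ltn_neqAle eq_sym nij imin.
by apply: IH; move: leA; rewrite [#|A|](cardsD1 i) iA.
Qed.

Definition inversions m (A B : {set 'I_m}) : nat :=
  (\sum_(a in A) \sum_(b in B) (b < a)%N)%N.

Definition exterior (F : fieldType) (U : vectType F) : Type :=
  {ffun {set 'I_(\dim {:U})} -> F^o}.

Section ExteriorAlgebra.
Variables (F : fieldType) (U : vectType F).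
Local Notation I := 'I_(\dim {:U}).
Local Notation E := (exterior U).

HB.instance Definition _ :=
  Vector.copy (exterior U) {ffun {set 'I_(\dim {:U})} -> F^o}.

Definition ext_basis (A : {set I}) : E := [ffun B => (B == A)%:R].

Definition ext_mulB (A B : {set I}) : E :=
  if [disjoint A & B] then (-1) ^+ inversions A B *: ext_basis (A :|: B)
  else 0.

Definition ext_mul (u v : E) : E :=
  \sum_A \sum_B (u A * v B) *: ext_mulB A B.

Definition ext_one : E := ext_basis set0.

Lemma ext_sum (u : E) : u = \sum_A (u A : F) *: ext_basis A.
Proof.
apply/ffunP => B; rewrite sum_ffunE (bigD1 B) //= !ffunE eqxx.
rewrite big1 ?addr0 => [|A nA]; first by rewrite /GRing.scale /= mulr1.
by rewrite !ffunE eq_sym (negPf nA) /GRing.scale /= mulr0.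
Qed.

Lemma ext_ind (P : E -> Prop) :
  P 0 -> (forall a u v, P u -> P v -> P (a *: u + v)) ->
  (forall A, P (ext_basis A)) -> forall u, P u.
Proof.
move=> P0 PD PB u; rewrite (ext_sum u); apply: (big_ind P) => //.
- by move=> x y Px Py; rewrite -[x]scale1r; apply: PD.
- by move=> A _; rewrite -[_ *: _]addr0; apply: PD.
Qed.

Lemma ext_mulPl a u v w :
  ext_mul (a *: u + v) w = a *: ext_mul u w + ext_mul v w.
Proof.
rewrite /ext_mul scaler_sumr -big_split; apply: eq_bigr => A _ /=.
rewrite scaler_sumr -big_split; apply: eq_bigr => B _ /=.
by rewrite !ffunE mulrDl scalerDl scalerA mulrA.
Qed.

Lemma ext_mulPr a u v w :
  ext_mul w (a *: u + v) = a *: ext_mul w u + ext_mul w v.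
Proof.
rewrite /ext_mul scaler_sumr -big_split; apply: eq_bigr => A _ /=.
rewrite scaler_sumr -big_split; apply: eq_bigr => B _ /=.
by rewrite !ffunE mulrDr scalerDl scalerA mulrCA.
Qed.

Lemma ext_mul0l w : ext_mul 0 w = 0.
Proof.
by rewrite -[X in ext_mul X](scale0r (0 : E)) -[_ *: _]addr0 ext_mulPl
  scale0r add0r /ext_mul big1 // => A _; rewrite big1 // => B _;
  rewrite ffunE mul0r scale0r.
Qed.

Lemma ext_mul0r w : ext_mul w 0 = 0.
Proof.
by rewrite /ext_mul big1 // => A _; rewrite big1 // => B _;
  rewrite ffunE mulr0 scale0r.
Qed.

Lemma ext_mulZl a u w : ext_mul (a *: u) w = a *: ext_mul u w.
Proof. by rewrite -[a *: u]addr0 ext_mulPl ext_mul0l addr0. Qed.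

Lemma ext_mulZr a u w : ext_mul w (a *: u) = a *: ext_mul w u.
Proof. by rewrite -[a *: u]addr0 ext_mulPr ext_mul0r addr0. Qed.

Lemma ext_mul_basis A B : ext_mul (ext_basis A) (ext_basis B) = ext_mulB A B.
Proof.
rewrite /ext_mul (bigD1 A) //= (bigD1 B) //= !ffunE !eqxx mulr1 scale1r.
rewrite big1 ?addr0 => [|C nC]; last first.
  by rewrite !ffunE (negPf nC) mulr0 scale0r.
rewrite big1 ?addr0 // => C nC; rewrite big1 // => D _.
by rewrite !ffunE (negPf nC) mul0r scale0r.
Qed.

Lemma inversionsUl m (A B C : {set 'I_m}) : [disjoint A & B] ->
  inversions (A :|: B) C = (inversions A C + inversions B C)%N.
Proof.
move=> dAB; rewrite /inversions.
by rewrite (eq_bigl _ _ (fun x => in_setU x A B)) bigU.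
Qed.

Lemma inversionsUr m (A B C : {set 'I_m}) : [disjoint A & B] ->
  inversions C (A :|: B) = (inversions C A + inversions C B)%N.
Proof.
move=> dAB; rewrite /inversions -big_split; apply: eq_bigr => c _ /=.
by rewrite (eq_bigl _ _ (fun x => in_setU x A B)) bigU.
Qed.

Lemma ext_mulA : associative ext_mul.
Proof.
move=> u v w; elim/ext_ind: u => [|a u u' IH IH'|A].
- by rewrite !ext_mul0l.
- by rewrite !ext_mulPl IH IH'.
elim/ext_ind: v => [|a u u' IH IH'|B].
- by rewrite !(ext_mul0l, ext_mul0r).
- by rewrite !(ext_mulPl, ext_mulPr) IH IH'.
elim/ext_ind: w => [|a u u' IH IH'|C].
- by rewrite !ext_mul0r.
- by rewrite !ext_mulPr IH IH'.
rewrite !ext_mul_basis /ext_mulB.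
have dU (X Y Z : {set I}) :
    [disjoint X :|: Y & Z] = [disjoint X & Z] && [disjoint Y & Z].
  by rewrite -!setI_eq0 setIUl setU_eq0.
case: ifP => dBC; case: ifP => dAB;
  rewrite ?ext_mul0l ?ext_mul0r ?ext_mulZl ?ext_mulZr ?ext_mul_basis
          /ext_mulB //.
- rewrite dU dBC andbT disjoint_sym dU ![[disjoint _ & A]]disjoint_sym dAB /=.
  case: ifP => dAC; last by rewrite !scaler0.
  rewrite !scalerA -!exprD setUA inversionsUl // inversionsUr //.
  by rewrite addnC addnA.
- by rewrite disjoint_sym dU [[disjoint B & A]]disjoint_sym dAB scaler0.
- by rewrite dU dBC andbF scaler0.
Qed.

Lemma ext_mul1l : left_id ext_one ext_mul.
Proof.
move=> w; elim/ext_ind: w => [|a u v IH IH'|A]; first by rewrite ext_mul0r.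
  by rewrite ext_mulPr IH IH'.
by rewrite ext_mul_basis /ext_mulB -setI_eq0 set0I eqxx set0U /inversions
           big_set0 scale1r.
Qed.

Lemma ext_mul1r : right_id ext_one ext_mul.
Proof.
move=> w; elim/ext_ind: w => [|a u v IH IH'|A]; first by rewrite ext_mul0l.
  by rewrite ext_mulPl IH IH'.
rewrite ext_mul_basis /ext_mulB -setI_eq0 setI0 eqxx setU0 /inversions.
by rewrite big1 ?scale1r // => a _; rewrite big_set0.
Qed.

Lemma ext_mulDl : left_distributive ext_mul +%R.
Proof. by move=> u v w; rewrite -[u]scale1r ext_mulPl !scale1r. Qed.

Lemma ext_mulDr : right_distributive ext_mul +%R.
Proof. by move=> u v w; rewrite -[v]scale1r ext_mulPr !scale1r. Qed.

Lemma ext_one_neq0 : ext_one != 0.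
Proof.
apply/eqP => /ffunP/(_ set0); rewrite !ffunE eqxx => /eqP.
by rewrite oner_eq0.
Qed.

HB.instance Definition _ := GRing.Zmodule_isNzRing.Build (exterior U)
  ext_mulA ext_mul1l ext_mul1r ext_mulDl ext_mulDr ext_one_neq0.
HB.instance Definition _ := GRing.Lmodule_isLalgebra.Build F (exterior U)
  (fun a u v => esym (ext_mulZl a u v)).
HB.instance Definition _ := GRing.Lalgebra_isAlgebra.Build F (exterior U)
  (fun a u v => esym (ext_mulZr a v u)).
HB.instance Definition _ := Algebra_isFalgebra.Build F (exterior U).

End ExteriorAlgebra.

Section UniversalProperty.
Variables (F : fieldType) (U : vectType F).
Local Notation I := 'I_(\dim {:U}).
Local Notation E := (exterior U).
Local Notation b := (vbasis {:U}).

Definition ext_inj (u : U) : E := \sum_i coord b i u *: ext_basis [set i].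

Fact ext_inj_linear : linear ext_inj.
Proof.
move=> a u v; rewrite /ext_inj scaler_sumr -big_split; apply: eq_bigr => i _ /=.
by rewrite linearP scalerDl scalerA.
Qed.
HB.instance Definition _ := GRing.isLinear.Build F U E _ ext_inj ext_inj_linear.

Definition ext_lift (A : algType F) (f : U -> A) (w : E) : A :=
  \sum_(S : {set I}) (w S : F) *: \prod_(i in S) f b`_i.

Fact ext_lift_linear (A : algType F) (f : U -> A) : linear (ext_lift f).
Proof.
move=> a u v; rewrite /ext_lift scaler_sumr -big_split.
by apply: eq_bigr => S _ /=; rewrite !ffunE scalerDl scalerA.
Qed.
HB.instance Definition _ (A : algType F) (f : U -> A) :=
  GRing.isLinear.Build F E A _ (ext_lift f) (ext_lift_linear f).

Lemma ext_lift_basis (A : algType F) (f : U -> A) S :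
  ext_lift f (ext_basis S) = \prod_(i in S) f b`_i.
Proof.
rewrite /ext_lift (bigD1 S) //= ffunE eqxx scale1r.
rewrite [X in _ + X]big1 ?addr0 // => T nT.
by rewrite ffunE (negPf nT) scale0r.
Qed.

Section Products.
Variables (A : algType F) (x : I -> A).
Hypothesis xx : forall i, x i * x i = 0.
Hypothesis xC : forall i j, x i * x j = - (x j * x i).

Lemma mul_prod_seq i (S : {set I}) (r : seq I) :
  sorted (fun j k : I => (j < k)%N) r -> i \in r ->
  x i * \prod_(j <- r | j \in S) x j =
  if i \in S then 0
  else (-1) ^+ (\sum_(j <- r | j \in S) (j < i)%N)%N *
       \prod_(j <- r | j \in i |: S) x j.
Proof.
elim: r => // j r IH /= jr; rewrite inE.
have lt_trans : transitive (fun j k : I => (j < k)%N).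
  by move=> u v w; apply: ltn_trans.
have jlt k : k \in r -> (j < k)%N.
  by move: k; apply/allP; apply: order_path_min jr.
rewrite !big_cons in_setU1; case: eqVneq => [ij _|nij /= ir].
  rewrite -ij /=; case: ifP => iS; first by rewrite mulrA xx mul0r.
  rewrite [X in _ ^+ X]big_seq_cond [X in _ ^+ X]big1 => [|k /andP[kr _]].
    rewrite mul1r; congr (_ * _); rewrite big_seq_cond [RHS]big_seq_cond.
    apply: eq_bigl => k; case kr: (k \in r) => //=; rewrite in_setU1.
    by have := jlt k kr; case: eqVneq => // ->; rewrite ij ltnn.
  by rewrite ij ltnNge ltnW ?jlt.
rewrite /= jlt // add1n.
have {}IH := IH (path_sorted jr) ir.
case: ifP => jS //; rewrite mulrA xC mulNr -mulrA IH.
case: ifP => iS; first by rewrite mulr0 oppr0.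
rewrite exprS mulN1r mulNr; congr (- _).
by rewrite !mulrA; congr (_ * _); apply: commr_sign.
Qed.

Lemma mul_prod_set i (S : {set I}) :
  x i * \prod_(j in S) x j =
  if i \in S then 0
  else (-1) ^+ (\sum_(j in S) (j < i)%N)%N * \prod_(j in i |: S) x j.
Proof.
apply: mul_prod_seq; last exact: mem_index_enum.
have := iota_ltn_sorted 0 (\dim {:U}).
rewrite -val_enum_ord sorted_map enumT.
by rewrite /index_enum unlock.
Qed.

Lemma prod_setM (S T : {set I}) :
  (\prod_(i in S) x i) * (\prod_(i in T) x i) =
  if [disjoint S & T] then (-1) ^+ inversions S T * \prod_(i in S :|: T) x i
  else 0.
Proof.
elim/set_min_ind: S => [|i S iS IH].
  by rewrite big_set0 mul1r -setI_eq0 set0I eqxx set0U /inversions big_set0 mul1r.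
have iNS : i \notin S by apply/negP => /iS; rewrite ltnn.
have prodiS : \prod_(j in i |: S) x j = x i * \prod_(j in S) x j.
  rewrite mul_prod_set (negPf iNS) [X in _ ^+ X]big1 ?mul1r // => j /iS ij.
  by rewrite ltnNge ltnW.
rewrite prodiS -mulrA IH -!setI_eq0 setIUl setU_eq0 !setI_eq0 disjoints1 -setUA.
case: ifP => dST; last by rewrite mulr0 andbF.
rewrite andbT mulrA (commr_sign (x i)) -mulrA mul_prod_set.
rewrite in_setU (negPf iNS) /=; case: ifP => iT /=; first by rewrite mulr0.
rewrite mulrA -exprD; congr (_ ^+ _ * _).
rewrite inversionsUl ?disjoints1 // addnC; congr addn.
rewrite /inversions big_set1 (eq_bigl _ _ (fun x => in_setU x S T)) bigU //=.
by rewrite big1 // => j /iS ij; rewrite ltnNge ltnW.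
Qed.

End Products.

Lemma alternating_anticomm (A : algType F) (f : U -> A) : linear f ->
  (forall u, f u * f u = 0) -> forall u v, f u * f v = - (f v * f u).
Proof.
move=> fL f0 u v; apply/eqP; rewrite -addr_eq0; apply/eqP.
have := f0 (1 *: u + v); rewrite fL scale1r mulrDl !mulrDr !f0 add0r addr0.
by [].
Qed.

Lemma sum_alternating (A : algType F) (m : nat) (c : 'I_m -> F) (x : 'I_m -> A) :
  (forall i, x i * x i = 0) -> (forall i j, x i * x j = - (x j * x i)) ->
  (\sum_i c i *: x i) * (\sum_i c i *: x i) = 0.
Proof.
move=> xx xC; elim: m c x xx xC => [|m IH] c x xx xC.
  by rewrite big_ord0 mul0r.
rewrite big_ord_recl mulrDl !mulrDr IH //= addr0 -scalerAl -scalerAr xx.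
rewrite !scaler0 add0r mulr_sumr mulr_suml -big_split big1 //= => i _.
by rewrite -!scalerAl -!scalerAr xC !scalerN scalerA mulrC -scalerA addNr.
Qed.

Lemma ext_basis1_sq i : ext_basis [set i] * ext_basis [set i] = 0 :> E.
Proof.
by rewrite [LHS]ext_mul_basis /ext_mulB disjoints1 inE eqxx.
Qed.

Lemma ext_basis1_anticomm i j : ext_basis [set i] * ext_basis [set j] =
  - (ext_basis [set j] * ext_basis [set i]) :> E.
Proof.
rewrite [LHS]ext_mul_basis [X in - X]ext_mul_basis /ext_mulB !disjoints1 !inE.
rewrite [j == i]eq_sym; case: eqVneq => [_|nij] /=; first by rewrite oppr0.
rewrite /inversions !big_set1 setUC -scaleNr; congr (_ *: _).
by have := nij; rewrite -val_eqE /=; case: ltngtP; rewrite ?expr0 ?expr1 ?opprK.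
Qed.

Lemma ext_inj_sq u : ext_inj u * ext_inj u = 0.
Proof.
by rewrite sum_alternating //; [apply: ext_basis1_sq|apply: ext_basis1_anticomm].
Qed.

Lemma prod_ext_basis1 (S : {set I}) :
  \prod_(i in S) (ext_basis [set i] : E) = ext_basis S.
Proof.
elim/set_min_ind: S => [|i S iS IH]; first by rewrite big_set0.
have iNS : i \notin S by apply/negP => /iS; rewrite ltnn.
have l0 : (\sum_(j in S) (j < i)%N)%N = 0%N.
  by apply: big1 => j /iS ij; rewrite ltnNge ltnW.
have := @mul_prod_set _ (fun i => ext_basis [set i] : E) ext_basis1_sq
  ext_basis1_anticomm i S.
rewrite (negPf iNS) l0 mul1r IH => <-.
by rewrite [LHS]ext_mul_basis /ext_mulB disjoints1 iNS /inversions big_set1 l0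
           scale1r.
Qed.

Lemma ext_inj_basis (i : I) : ext_inj b`_i = ext_basis [set i].
Proof.
rewrite /ext_inj (bigD1 i) //= coord_free ?(basis_free (vbasisP _)) // eqxx.
rewrite scale1r big1 ?addr0 // => j ji.
by rewrite coord_free ?(basis_free (vbasisP _)) // eq_sym (negPf ji) scale0r.
Qed.

Lemma ext_lift_inj (A : algType F) (f : {linear U -> A}) u :
  ext_lift f (ext_inj u) = f u.
Proof.
rewrite [in RHS](coord_vbasis (memvf u)) /ext_inj !linear_sum.
by apply: eq_bigr => i _; rewrite !linearZ /= ext_lift_basis big_set1.
Qed.

Lemma ext_lift_monoid (A : algType F) (f : {linear U -> A}) :
  (forall u, f u * f u = 0) -> monoid_morphism (ext_lift f).
Proof.
move=> f0; split=> [|u v]; first by rewrite [LHS]ext_lift_basis big_set0.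
have fC := alternating_anticomm (linearP f) f0.
elim/ext_ind: u => [|a u u' IH IH'|S]; first by rewrite mul0r linear0 mul0r.
  by rewrite mulrDl -scalerAl !(ext_lift_linear f) IH IH' mulrDl -scalerAl.
elim/ext_ind: v => [|a u u' IH IH'|T]; first by rewrite mulr0 linear0 mulr0.
  by rewrite mulrDr -scalerAr !(ext_lift_linear f) IH IH' mulrDr -scalerAr.
rewrite !ext_lift_basis (@prod_setM _ (fun i => f b`_i)) //.
rewrite [ext_basis S * _]ext_mul_basis /ext_mulB; case: ifP => _.
  by rewrite linearZ /= ext_lift_basis -signr_odd scaler_sign
             -[in RHS]signr_odd mulr_sign.
exact: linear0.
Qed.

Lemma ext_lift_uniq (A : algType F) (f : U -> A) (g : {lrmorphism E -> A}) :
  (forall u, g (ext_inj u) = f u) -> g =1 ext_lift f.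
Proof.
move=> gf w; elim/ext_ind: w => [|a u v IH IH'|S]; first by rewrite !linear0.
  by rewrite (ext_lift_linear f) linearP /= IH IH'.
rewrite ext_lift_basis -prod_ext_basis1 rmorph_prod; apply: eq_bigr => i _.
by rewrite -gf ext_inj_basis.
Qed.

(* The k-th exterior power: the span of all products of k elements of U. *)
Definition ext_pow (k : nat) : {vspace E} := (limg (linfun ext_inj) ^+ k)%VS.

Lemma ext_powE k :
  ext_pow k = <<[seq ext_basis A | A in [pred A : {set I} | #|A| == k]]>>%VS.
Proof.
apply/eqP; rewrite eqEsubv; apply/andP; split; last first.
  apply/span_subvP => _ /imageP[S /[!inE] /eqP <- ->].
  elim/set_min_ind: S => [|i S iS IH].
    by rewrite /ext_pow cards0 expv0 memv_line.
  have iNS : i \notin S by apply/negP => /iS; rewrite ltnn.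
  suff -> : ext_basis (i |: S) = ext_inj b`_i * ext_basis S.
    rewrite /ext_pow cardsU1 iNS expvSl memv_mul // -[ext_inj _]lfunE.
    by rewrite memv_img ?memvf.
  rewrite ext_inj_basis [RHS]ext_mul_basis /ext_mulB disjoints1 iNS.
  rewrite /inversions big_set1 [X in _ ^+ X]big1 ?scale1r // => j /iS ij.
  by rewrite ltnNge ltnW.
have basisP (S : {set I}) l : #|S| = l ->
    (ext_basis S : E) \in <<[seq ext_basis A | A in [pred A : {set I} | #|A| == l]]>>%VS.
  by move=> Sl; apply/memv_span/imageP; exists S; rewrite ?inE ?Sl.
elim: k => [|k IH]; first by rewrite /ext_pow expv0 -memvE basisP ?cards0.
rewrite /ext_pow expvSl; apply/prodvP => _ v /memv_imgP[u _ ->].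
rewrite lfunE /= => /(subvP IH)/coord_span ->.
rewrite mulr_sumr; apply: memv_suml => j _; rewrite -scalerAr memvZ //.
rewrite mulr_suml; apply: memv_suml => i _; rewrite -scalerAl memvZ //.
have /(mem_nth 0)/imageP[S /[!inE] /eqP Sk ->] : (j < size
    [seq (ext_basis A : E) | A in [pred A : {set I} | #|A| == k]])%N.
  by rewrite size_image.
rewrite [_ * _]ext_mul_basis /ext_mulB disjoints1.
case: ifP => iS; last exact: mem0v.
by rewrite memvZ // basisP // cardsU1 iS Sk.
Qed.

Lemma ext_pow_gt k : (\dim {:U} < k)%N -> ext_pow k = 0%VS.
Proof.
move=> kU; apply/eqP; rewrite ext_powE -subv0; apply/span_subvP => w.
case/imageP => S; rewrite inE => /eqP Sk.
by have := max_card S; rewrite Sk card_ord leqNgt kU.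
Qed.

End UniversalProperty.

Section Functoriality.
Variable F : fieldType.

(* The algebra morphism extending f. *)
Definition ext_map (U1 U2 : vectType F) (f : 'Hom(U1, U2)) :
    'Hom(exterior U1, exterior U2) :=
  linfun (ext_lift (@ext_inj F U2 \o f)).

Lemma ext_map_inj (U1 U2 : vectType F) (f : 'Hom(U1, U2)) u :
  ext_map f (ext_inj u) = ext_inj (f u).
Proof. by rewrite lfunE /= ext_lift_inj. Qed.

Lemma ext_map_monoid (U1 U2 : vectType F) (f : 'Hom(U1, U2)) :
  monoid_morphism (ext_map f).
Proof.
have [f1 fM] := ext_lift_monoid (f := @ext_inj F U2 \o f)
  (fun u => ext_inj_sq (f u)).
by split=> [|u v]; rewrite !lfunE; [exact: f1|exact: fM].
Qed.

Lemma ext_map_pow (U1 U2 : vectType F) (f : 'Hom(U1, U2)) k w :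
  w \in ext_pow U1 k -> ext_map f w \in ext_pow U2 k.
Proof.
have [f1 fM] := ext_map_monoid f.
suff s : (ext_pow U1 k <= ext_map f @^-1: ext_pow U2 k)%VS.
  by move=> /(subvP s); rewrite memv_preim.
elim: k => [|k IH].
  by rewrite /ext_pow !expv0 -memvE -memv_preim f1 memv_line.
rewrite {1}/ext_pow expvSl; apply/prodvP => _ v /memv_imgP[u _ ->] /(subvP IH).
rewrite [_ u]lfunE -!memv_preim fM /= ext_map_inj /ext_pow expvSl => fv.
by rewrite memv_mul // -[ext_inj _]lfunE memv_img ?memvf.
Qed.

Lemma ext_map_id (U : vectType F) : ext_map \1%VF = \1%VF :> 'End(exterior U).
Proof.
apply/lfunP => w; rewrite id_lfunE; elim/ext_ind: w => [|a u v IH IH'|S].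
- exact: linear0.
- by rewrite linearP /= IH IH'.
rewrite lfunE /= ext_lift_basis -[RHS]prod_ext_basis1.
by apply: eq_bigr => i _; rewrite /= id_lfunE ext_inj_basis.
Qed.

Lemma ext_map_comp (U1 U2 U3 : vectType F) (g : 'Hom(U2, U3))
    (f : 'Hom(U1, U2)) :
  ext_map (g \o f)%VF = (ext_map g \o ext_map f)%VF.
Proof.
have [g1 gM] := ext_map_monoid g.
apply/lfunP => w; rewrite comp_lfunE; elim/ext_ind: w => [|a u v IH IH'|S].
- by rewrite !linear0.
- by rewrite !linearP /= IH IH'.
rewrite lfunE /= ext_lift_basis [ext_map f _]lfunE /= ext_lift_basis.
rewrite (big_morph _ gM g1); apply: eq_bigr => i _ /=.
by rewrite comp_lfunE ext_map_inj.
Qed.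

(* The restriction of [ext_map f] to the k-th exterior powers. *)
Definition ext_pow_map (U1 U2 : vectType F) (k : nat) (f : 'Hom(U1, U2)) :
    'Hom(subvs_of (ext_pow U1 k), subvs_of (ext_pow U2 k)) :=
  (linfun (vsproj (ext_pow U2 k)) \o ext_map f \o linfun vsval)%VF.

Lemma ext_pow_mapE (U1 U2 : vectType F) k (f : 'Hom(U1, U2)) u :
  vsval (ext_pow_map k f u) = ext_map f (vsval u).
Proof.
rewrite !comp_lfunE [linfun (vsproj _) _]lfunE [linfun vsval _]lfunE /=.
by rewrite vsprojK // ext_map_pow ?subvsP.
Qed.

End Functoriality.

Section Invariants.
Variables (F : fieldType) (W : vectType F) (T : Type) (rho : T -> 'End(W)).

Lemma invariants_exist (G : T -> Prop) : exists X : {vspace W},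
  forall w, w \in X <-> (forall g, G g -> rho g w = w).
Proof.
pose inv w := forall g, G g -> rho g w = w.
pose P k := `[< exists2 X : {vspace W}, (forall w, inv w -> w \in X) &
                \dim X = k >].
have exP : exists k, P k.
  by exists (\dim {:W}); apply/asboolP; exists fullv => // w _; apply: memvf.
case: (ex_minnP exP) => k /asboolP[X invX Xk] kmin; exists X => w.
split=> [wX g Gg|]; last exact: invX.
have sX : (X :&: fixedSpace (rho g) <= X)%VS by apply: capvSl.
suff eX : (X :&: fixedSpace (rho g))%VS = X.
  by apply/fixedSpaceP; move: wX; rewrite -eX memv_cap => /andP[].
apply/eqP; rewrite eqEdim sX Xk; apply: kmin; apply/asboolP.
exists (X :&: fixedSpace (rho g))%VS => // v vinv.
by rewrite memv_cap invX //=; apply/fixedSpaceP/vinv.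
Qed.

Definition invariants (G : T -> Prop) : {vspace W} :=
  sval (cid (invariants_exist G)).

Lemma invariantsP (G : T -> Prop) w :
  w \in invariants G <-> (forall g, G g -> rho g w = w).
Proof. exact: (svalP (cid (invariants_exist G))). Qed.

End Invariants.

Section ExtExt2.
Variables (F : fieldType) (n : nat).

Definition orthogonal_mx (g : 'M[F]_n) : Prop := g^T *m g = 1%:M.

Definition std_act (g : 'M[F]_n) : 'End('cV[F]_n) := linfun (mulmx g).

Definition ext2 : vectType F := subvs_of (ext_pow 'cV[F]_n 2).

Definition ext_ext2 : vectType F := exterior ext2.

Definition ext_ext2_act (g : 'M[F]_n) : 'End(ext_ext2) :=
  ext_map (ext_pow_map 2 (std_act g)).

(* For G a subset of GL(n), the generating polynomial of the dimensions of the
   G-invariants of the homogeneous components of the exterior algebra of ext2;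
   the truncation loses nothing, see [ext_ext2_hilbertE]. *)
Definition ext_ext2_hilbert (G : 'M[F]_n -> Prop) : {poly int} :=
  \poly_(i < (\dim {:ext2}).+1)
    (\dim (ext_pow ext2 i :&: invariants ext_ext2_act G))%:Z.

Lemma ext_ext2_hilbertE (G : 'M[F]_n -> Prop) i :
  (ext_ext2_hilbert G)`_i =
  (\dim (ext_pow ext2 i :&: invariants ext_ext2_act G))%:Z.
Proof.
rewrite coef_poly; case: ltnP => // /ext_pow_gt ->.
by rewrite cap0v dimv0.
Qed.

End ExtExt2.

(* Main.v *)
Require Import Defs.
From mathcomp Require Import all_boot all_order all_algebra all_field.
From mathcomp Require Import boolp reals complex.
From HB Require Import structures.
From mathcomp Require Import ring zify.
Set Implicit Arguments.
Unset Strict Implicit.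
Unset Printing Implicit Defensive.
Import GRing.Theory Num.Theory.
Local Open Scope ring_scope.

(** Let e_ij = e_i ^ e_j for i < j. The exterior algebra W of the second exterior
    power of V has a basis e_A indexed by the graphs A on the n coordinates: the
    edges of A are the factors of e_A. Call A shifted when every neighbour of a
    vertex j is equal or joined to every vertex i < j. The theorem follows from two
    facts:
    - the O(n)-invariants of degree k in W have dimension the number of shifted
      graphs with k edges all of whose degrees are even ([dim_invariants]);
    - these graphs have the generating series
      \prod_(i < (n-1)/2) (1 + X^(4i+3)) ([shifted_even_series]), which the
      q-binomial theorem expands into the right-hand side ([hilbert_product]).

    Behind the first fact is the decomposition of W under GL(n): the vectors e_A
    with A shifted are its highest weight vectors, their weights are the degree
    sequences, and an irreducible polynomial representation of GL(n) has a nonzero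
    O(n)-invariant exactly when all parts of its highest weight are even. The proof
    below is a direct one.

    Upper bound. Differentiating along rotations, an invariant w satisfies
    E_ij w = E_ji w for the operators E_ij of gl(n). The Casimir operator
    \sum_(i, j) E_ij E_ji acts on W as a multiple of the degree
    ([glop_casimir]), because its quartic part cancels by anticommutation. On w
    this says that the coefficient of w at B, multiplied by the number of
    violations of shiftedness in B, is a sum of coefficients of E_ji E_ji w with
    i < j ([casimir_coef]). These only involve coefficients of w at graphs of
    smaller height, so a graph of least height in the support of w is shifted
    ([so_invariant_coef]). Hence w is determined by its coefficients at shifted
    graphs, and diagonal sign matrices make those vanish unless all degrees are
    even.

    Lower bound. For A shifted with even degrees, average X e_A over a matrix X
    with independent standard normal entries ([invariant_vector]). The Gaussian
    integral of a product of linear forms depends only on their scalar products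
    ([gauss_gram]), hence the average is O(n)-invariant. If X = L M with L lower
    and M upper triangular, the coefficient of X e_A at a shifted B is 0 for B
    different from A, and for B = A it is \prod_i (L_ii M_ii)^(deg i), which is
    the square of a product of powers of leading minors of X. By density this
    holds for all X ([act_coef_square]), so the average has coefficient 0 at
    B <> A and the integral of the square of a nonzero real polynomial at A.
    Expanding in Hermite polynomials shows that this integral is not 0
    ([gauss_sqr_neq0]). Only finitely many moments matter, so the Gaussian law is
    replaced by a finite cubature formula, which makes sense over any field of
    characteristic 0.

    Counting. In a shifted graph either the last vertex is isolated or the first
    one is joined to all others. Deleting that vertex changes no parity in the
    first case and all of them in the second, which gives a recursion for the
    generating series of shifted graphs with degrees of a given parity
    ([window_series_rec]). *)

(** * Anticommutation relations and the Casimir element *)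

Section AnticommutationRelations.
Variables (A : nzRingType) (n : nat) (C D : 'I_n -> 'I_n -> A).
Hypothesis CN : forall i j, C i j = - C j i.
Hypothesis DN : forall i j, D i j = - D j i.
Hypothesis DD : forall i j k l, D i j * D k l = - (D k l * D i j).
Hypothesis CC : forall i j k l, C i j * C k l = - (C k l * C i j).
Hypothesis DC : forall i j k l, D i j * C k l =
  ((i == k) && (j == l))%:R - ((i == l) && (j == k))%:R - C k l * D i j.

(** When C i j multiplies by e_i ^ e_j and D i j contracts with it, this is the
    derivation of the exterior algebra that maps e_j to e_i. *)
Definition glop i j : A := \sum_m C i m * D j m.

Lemma sum_delta (f : 'I_n -> A) k : \sum_m (m == k)%:R * f m = f k.
Proof.
rewrite (bigD1 k) //= eqxx mul1r big1 ?addr0 // => m mk.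
by rewrite (negPf mk) mul0r.
Qed.

Lemma deltaM (b c : bool) (x : A) : b%:R * (c%:R * x) = (b && c)%:R * x.
Proof. by case: b; case: c; rewrite /= ?mul1r ?mul0r ?mulr0. Qed.

(** Leibniz rule: the commutator of E_ij with the multiplication by e_k ^ e_l is
    the multiplication by the image of e_k ^ e_l. *)
Lemma glop_create i j k l : glop i j * C k l =
  (j == k)%:R * C i l + (j == l)%:R * C k i + C k l * glop i j.
Proof.
rewrite /glop mulr_suml mulr_sumr.
transitivity (\sum_m ((m == l)%:R * ((j == k)%:R * C i m) -
    (m == k)%:R * ((j == l)%:R * C i m) + C k l * (C i m * D j m))).
  apply: eq_bigr => m _; rewrite -mulrA DC !mulrBr [C i m * (_ * _)]mulrA CC mulNr.
  rewrite opprK -mulrA; congr (_ - _ + _).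
    by case: eqP; case: eqP; rewrite /= ?mul1r ?mul0r ?mulr1 ?mulr0.
  by case: eqP; case: eqP; rewrite /= ?mul1r ?mul0r ?mulr1 ?mulr0.
rewrite big_split big_split /= sumrN !sum_delta [C k i]CN mulrN.
by [].
Qed.

Lemma glop_annihilate i j k l : glop i j * D k l =
  - ((i == k)%:R * D j l + (i == l)%:R * D k j) + D k l * glop i j.
Proof.
rewrite /glop mulr_suml mulr_sumr.
transitivity (\sum_m (- ((m == l)%:R * ((i == k)%:R * D j m)) +
    (m == k)%:R * ((i == l)%:R * D j m) + D k l * (C i m * D j m))).
  apply: eq_bigr => m _; rewrite [D k l * (_ * _)]mulrA DC -mulrA DD mulrN.
  rewrite !mulrDl !mulNr -[C i m * _ * _]mulrA !deltaM.
  rewrite [k == i]eq_sym [l == i]eq_sym [k == m]eq_sym [l == m]eq_sym andbC.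
  set y := _%:R * _; set z := _%:R * _.
  by rewrite !addrA [- y + z]addrC addrNK subrr add0r.
rewrite big_split big_split /= sumrN !sum_delta opprD [D k j]DN mulrN opprK.
by [].
Qed.

(** The commutation relations of gl(n). *)
Lemma glop_comm i j k l : glop i j * glop k l =
  (j == k)%:R * glop i l - (i == l)%:R * glop k j + glop k l * glop i j.
Proof.
rewrite {2}/glop mulr_sumr.
transitivity (\sum_m ((j == k)%:R * (C i m * D l m) +
     (m == j)%:R * (C k i * D l m) - (i == l)%:R * (C k m * D j m)
     - (m == i)%:R * (C k m * D l j) + (C k m * D l m) * glop i j)).
  apply: eq_bigr => m _; rewrite mulrA glop_create !mulrDl -!mulrA.
  rewrite glop_annihilate mulrDr mulrN mulrDr opprD !addrA [j == m]eq_sym.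
  rewrite [i == m]eq_sym; congr (_ + _ - _ - _ + _).
    by case: eqP; rewrite ?mul1r ?mul0r ?mulr0.
  by case: eqP; rewrite ?mul1r ?mul0r ?mulr0.
rewrite !big_split /= !sumrN !sum_delta -!mulr_sumr -mulr_suml -!/(glop _ _).
congr (_ + _); rewrite addrAC; congr (_ - _).
by rewrite addrK.
Qed.

Hypothesis A2 : forall x : A, x + x = 0 -> x = 0.

(** Moving the annihilators to the right leaves a quadratic part, the number of
    factors, and a quartic part, which cancels by antisymmetry. *)
Lemma glop_casimir : \sum_i \sum_j glop i j * glop j i =
  (n.-1)%:R * \sum_i \sum_j C i j * D i j.
Proof.
pose X i j k l := C i k * C j l * (D j k * D i l).
(* Exchanging (i, j) with (k, l) reverses all index pairs and exchanges the two
   factors D, so X changes sign. *)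
have X0 : \sum_i \sum_j \sum_k \sum_l X i j k l = 0.
  apply: A2; rewrite pair_bigA /=.
  under eq_bigr do rewrite pair_bigA /=.
  rewrite {1}exchange_big -big_split big1 //= => p _.
  rewrite -big_split big1 //= => q _; rewrite /X.
  rewrite [C q.1 _]CN [C q.2 _]CN [D q.2 _]DN [D q.1 _]DN !(mulNr, mulrN, opprK).
  by rewrite DD mulrN subrr.
transitivity (\sum_i \sum_j \sum_k \sum_l
    (((l == k)%:R * (1 - (j == k)%:R) * (C i k * D i l)) - X i j k l)).
  apply: eq_bigr => i _; apply: eq_bigr => j _.
  rewrite /glop mulr_suml; apply: eq_bigr => k _; rewrite mulr_sumr.
  apply: eq_bigr => l _; rewrite /X [LHS]mulrA -[C i k * _ * _]mulrA DC eqxx /=.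
  rewrite mulrBr mulrBr !mulrBl -!mulrA; congr (_ - _).
  rewrite [j == l]eq_sym [k == j]eq_sym [k == l]eq_sym.
  case: (l =P k) => [->|lk]; rewrite !(mul1r, mul0r, mulr0).
    rewrite [k == j]eq_sym andbb mulrBl mul1r.
    by case: (j =P k) => _; rewrite !(mul1r, mul0r, mulr0).
  case: (l =P j) => [lj|_] /=; last by rewrite mul0r mulr0 subr0.
  case: (j =P k) => [kj|_] /=; last by rewrite mul0r mulr0 subr0.
  by case: lk; rewrite lj kj.
transitivity (\sum_i \sum_j \sum_k (1 - (j == k)%:R) * (C i k * D i k) -
  \sum_i \sum_j \sum_k \sum_l X i j k l).
  rewrite -sumrB; apply: eq_bigr => i _; rewrite -sumrB; apply: eq_bigr => j _.
  rewrite -sumrB; apply: eq_bigr => k _; rewrite sumrB; congr (_ - _).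
  by rewrite -[RHS](sum_delta (fun l => (1 - (j == k)%:R) * (C i k * D i l)));
    apply: eq_bigr => l _; rewrite -!mulrA.
rewrite X0 subr0 mulr_sumr; apply: eq_bigr => i _.
rewrite exchange_big mulr_sumr /=; apply: eq_bigr => k _.
rewrite -mulr_suml; congr (_ * _); rewrite (bigD1 k) //= eqxx subrr add0r.
rewrite (eq_bigr (fun=> 1)) => [|j /negPf->]; last by rewrite subr0.
by rewrite sumr_const cardC1 card_ord.
Qed.

End AnticommutationRelations.

(** * Creation and annihilation operators *)

Section FockSpace.
Variables (F : fieldType) (U : vectType F).
Local Notation I := 'I_(\dim {:U}).
Local Notation E := (exterior U).

Lemma ext_addE (u v : E) (B : {set I}) : (u + v) B = (u B : F) + (v B : F).
Proof. exact: ffunE. Qed.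

Lemma ext_oppE (u : E) (B : {set I}) : (- u) B = - (u B : F).
Proof. exact: ffunE. Qed.

Lemma ext_scaleE a (u : E) (B : {set I}) : (a *: u) B = a * (u B : F).
Proof. exact: ffunE. Qed.

Lemma ext_eqP (u v : E) : (forall B : {set I}, u B = v B :> F) -> u = v.
Proof. by move=> uv; apply/ffunP. Qed.

Definition ext_coefE := (ext_addE, ext_oppE, ext_scaleE).

(** The sign that moves e_q to its place in the increasing product e_B. *)
Definition fsign (q : I) (B : {set I}) : F := (-1) ^+ inversions [set q] B.

Definition create (q : I) (w : E) : E := ext_basis [set q] * w.

(** Contraction with the dual of the basis vector q, with the same signs as
    [create]: it is the adjoint of [create] for the basis of the e_B. *)
Definition annihilate (q : I) (w : E) : E :=
  [ffun B : {set I} => if q \in B then 0 else fsign q B * w (q |: B)].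

Fact create_linear q : linear (create q).
Proof. by move=> a u v; rewrite /create mulrDr scalerAr. Qed.
HB.instance Definition _ q := GRing.isLinear.Build F E E _ _ (create_linear q).

Fact annihilate_linear q : linear (annihilate q).
Proof.
move=> a u v; apply/ffunP => B; rewrite !ffunE; case: ifP => _.
  by rewrite [_ *: _]mulr0 addr0.
by rewrite mulrDr /GRing.scale /= mulrCA.
Qed.
HB.instance Definition _ q :=
  GRing.isLinear.Build F E E _ _ (annihilate_linear q).

Lemma fsign_sqr q B : fsign q B * fsign q B = 1.
Proof. by rewrite -expr2 sqrr_sign. Qed.

Lemma fsignE q B : fsign q B = (-1) ^+ (\sum_(b in B) (b < q)%N)%N.
Proof. by rewrite /fsign /inversions big_set1. Qed.

Lemma fsignU1 (p q : I) (B : {set I}) : p \notin B ->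
  fsign q (p |: B) = (-1) ^+ (p < q)%N * fsign q B.
Proof. by move=> pB; rewrite !fsignE big_setU1 //= exprD. Qed.

Lemma fsignD1 (p q : I) (B : {set I}) : p \in B ->
  fsign q (B :\ p) = (-1) ^+ (p < q)%N * fsign q B.
Proof.
by move=> pB; rewrite !fsignE (big_setD1 p pB) /= exprD mulrA -expr2 sqrr_sign mul1r.
Qed.

Lemma createE q (w : E) (B : {set I}) :
  create q w B = if q \in B then fsign q B * w (B :\ q) else 0 :> F.
Proof.
rewrite /create; elim/ext_ind: w => [|a u v IH IH'|A].
- by rewrite mulr0 !ffunE mulr0 if_same.
- rewrite mulrDr -scalerAr !ffunE IH IH'; case: ifP => _.
    by rewrite mulrDr /GRing.scale /= mulrCA.
  by rewrite [_ *: _]mulr0 addr0.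
rewrite [_ * _]ext_mul_basis /ext_mulB disjoints1 !ffunE.
case: ifP => qA; rewrite !ffunE; last first.
  case: ifP => // qB; case: eqP => [AE|_]; last by rewrite mulr0n mulr0.
  by move: qA; rewrite -AE !inE eqxx.
case: (B =P q |: A) => [->|nB].
  rewrite setU11 setU1K ?qA // eqxx [_ *: _]mulr1 mulr1.
  by rewrite -/(fsign q A) fsignU1 ?qA // ltnn mul1r.
rewrite [_ *: _]mulr0; case: ifP => // qB; case: eqP => [AE|_]; last first.
  by rewrite mulr0n mulr0.
by case: nB; rewrite -AE setD1K.
Qed.

Lemma create_anticomm p q w : create p (create q w) = - create q (create p w).
Proof. by rewrite /create mulrA ext_basis1_anticomm mulNr mulrA. Qed.

Lemma annihilate_anticomm p q w :
  annihilate p (annihilate q w) = - annihilate q (annihilate p w).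
Proof.
apply/ffunP => B; rewrite !ffunE !inE.
have [->|npq] := eqVneq p q.
  by case: ifP => //; rewrite ?mulr0 oppr0.
rewrite /=.
case: ifP => pB; case: ifP => qB; rewrite ?mulr0 ?oppr0 //.
rewrite !fsignU1 ?pB ?qB // setUCA.
move: (fsign p B) (fsign q B) (w _ : F) => a b c.
have := npq; rewrite -val_eqE /=.
by case: ltngtP => //= _ _; rewrite expr1 expr0; ring.
Qed.

Lemma annihilate_create p q w :
  annihilate p (create q w) = (p == q)%:R *: w - create q (annihilate p w).
Proof.
apply/ffunP => B; rewrite !ffunE !createE !ffunE !inE /GRing.scale /=.
have [->|npq] := eqVneq p q.
  rewrite mul1r; case: ifP => qB.
    rewrite setD1K // mulrA [fsign q (B :\ q)]fsignD1 // ltnn mul1r.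
    by rewrite fsign_sqr mul1r subrr.
  by rewrite setU1K ?qB // fsignU1 ?qB // ltnn mul1r mulrA fsign_sqr mul1r subr0.
rewrite /= mul0r add0r.
case: ifP => pB; case: ifP => qB; rewrite ?mulr0 ?oppr0 //.
rewrite fsignU1 ?pB // fsignD1 //.
have -> : (p |: B) :\ q = p |: B :\ q.
  by apply/setP => x; rewrite !inE; case: eqP => // ->; rewrite eq_sym (negPf npq).
move: (fsign p B) (fsign q B) (w _ : F) => a b c.
have := npq; rewrite -val_eqE /=.
by case: ltngtP => //= _ _; rewrite expr1 expr0; ring.
Qed.

End FockSpace.

(** * Shifted graphs *)

Section Graphs.
Variables (n : nat) (e : rel 'I_n).

Definition degree i : nat := (\sum_k e i k)%N.

(** A neighbour k of j becomes a neighbour of every smaller i; the vertex k itself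
    is excepted, as it cannot be joined to itself. *)
Definition shifted := forall i j k : 'I_n,
  (i < j)%N -> k != i -> e j k -> e i k.

Hypotheses (eC : symmetric e) (ee : irreflexive e).

(** The edges at j that are lacking at i; for i < j, the witnesses against
    shiftedness. *)
Definition compressible i j : nat := (\sum_(k | k != i) (e j k && ~~ e i k))%N.

Lemma compressible_shifted :
  (forall i j : 'I_n, (i < j)%N -> compressible i j = 0%N) -> shifted.
Proof.
move=> c0 i j k ij ki ejk; move/eqP: (c0 i j ij).
rewrite sum_nat_eq0 => /forallP/(_ k); rewrite ki ejk /=.
by case: (e i k).
Qed.

Variable R : comNzRingType.

Lemma sum_offdiag (X : 'I_n -> 'I_n -> R) :
  \sum_i \sum_j X i j =
  \sum_i X i i + \sum_(i < n) \sum_(j < n | (i < j)%N) (X i j + X j i).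
Proof.
transitivity (\sum_i X i i + (\sum_(i < n) \sum_(j < n | (i < j)%N) X i j +
    \sum_(i < n) \sum_(j < n | (j < i)%N) X i j)).
  rewrite -!big_split /=; apply: eq_bigr => i _.
  rewrite (bigD1 i) //= (bigID (fun j : 'I_n => (i < j)%N)) /=.
  congr (_ + (_ + _)); apply: eq_bigl => j; rewrite -val_eqE /=.
    by case: ltngtP.
  by case: ltngtP.
congr (_ + _); rewrite [X in _ + X](exchange_big_dep xpredT) //= -big_split /=.
by apply: eq_bigr => i _; rewrite -big_split.
Qed.

Lemma compressibleE i j : i != j ->
  (compressible i j)%:R =
  (degree j)%:R - (e i j)%:R - \sum_k (e j k)%:R * (e i k)%:R :> R.
Proof.
move=> nij; rewrite /compressible /degree !natr_sum.
rewrite [X in _ = X - _ - _](bigD1 i) //= [X in _ = _ - X](bigD1 i) //= ee.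
rewrite mulr0 add0r [e j i]eC [_ - (e i j)%:R]addrAC subrr add0r -sumrB.
apply: eq_bigr => k _; case: (e j k); case: (e i k) => //=; ring.
Qed.

(** The three terms on the right are the values on e_B of the Casimir operator of
    gl(n), of the sum of the E_ii^2 and of the sum of the E_ii - E_jj for i < j:
    this identity turns a relation between operators into a count of violations
    of shiftedness. *)
Lemma sum_compressible :
  (\sum_(i < n) \sum_(j < n | (i < j)%N) compressible i j).*2%:R =
  (n.-1)%:R * (\sum_i (degree i)%:R) - \sum_i (degree i)%:R ^+ 2
  - \sum_(i < n) \sum_(j < n | (i < j)%N) ((degree i)%:R - (degree j)%:R) :> R.
Proof.
have -> : (n.-1)%:R * (\sum_i (degree i)%:R) - \sum_i (degree i)%:R ^+ 2 =
   \sum_(i < n) \sum_(j < n | (i < j)%N)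
      ((compressible i j)%:R + (compressible j i)%:R) :> R.
  pose X i j : R := (i != j)%:R * (compressible i j)%:R.
  transitivity (\sum_i \sum_j X i j).
    transitivity (\sum_j ((n.-1)%:R * (degree j)%:R -
        \sum_k (e j k)%:R * (degree k)%:R : R)).
      rewrite sumrB -mulr_sumr; congr (_ - _); rewrite exchange_big /=.
      apply: eq_bigr => k _; rewrite -mulr_suml expr2; congr (_ * _).
      by rewrite natr_sum; apply: eq_bigr => j _; rewrite eC.
    rewrite [RHS]exchange_big /=; apply: eq_bigr => j _.
    rewrite [RHS](bigD1 j) //= /X eqxx mul0r add0r.
    transitivity (\sum_(i | i != j) ((degree j)%:R : R) -
      \sum_(i | i != j) ((e i j)%:R + \sum_k (e j k)%:R * (e i k)%:R) : R).
      rewrite sumr_const cardC1 card_ord mulr_natl; congr (_ - _).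
      rewrite big_split /= exchange_big /=.
      transitivity ((\sum_(i | i != j) (e i j)%:R) + \sum_k
          ((e j k)%:R * (degree k)%:R - (e j k)%:R : R)).
        rewrite sumrB [X in X + _](_ : _ = \sum_k (e j k)%:R).
          by rewrite addrCA subrr addr0.
        rewrite [RHS](bigD1 j) //= ee add0r.
        by apply: eq_bigr => i _; rewrite eC.
      congr (_ + _); apply: eq_bigr => k _; rewrite natr_sum (bigD1 j) //=.
      rewrite mulrDr -mulr_sumr eC -natrM mulnb andbb addrAC subrr add0r.
      by congr (_ * _); apply: eq_bigr => i _; rewrite eC.
    rewrite -sumrB; apply: eq_bigr => i ij.
    by rewrite ij mul1r compressibleE // opprD addrA.
  rewrite sum_offdiag big1 ?add0r => [|i _]; last by rewrite /X eqxx mul0r.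
  apply: eq_bigr => i _; apply: eq_bigr => j ij.
  by rewrite /X [j == i]eq_sym -val_eqE ltn_eqF //= !mul1r.
rewrite -mul2n natrM natr_sum mulr_sumr -sumrB; apply: eq_bigr => i _.
rewrite natr_sum mulr_sumr -sumrB; apply: eq_bigr => j ij.
have nij : i != j by rewrite -val_eqE ltn_eqF.
rewrite !compressibleE // 1?eq_sym // [e j i]eC.
under [X in _ = _ + (_ - X) - _]eq_bigr do rewrite mulrC.
ring.
Qed.

End Graphs.

Definition shiftedb n (e : rel 'I_n) : bool :=
  [forall i : 'I_n, forall j : 'I_n, forall k : 'I_n,
    [&& (i < j)%N, k != i & e j k] ==> e i k].

Lemma shiftedP n (e : rel 'I_n) : reflect (shifted e) (shiftedb e).
Proof.
apply: (iffP forallP) => [sh i j k ij ki jk|sh i].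
  by have /forallP/(_ j)/forallP/(_ k) := sh i; rewrite ij ki jk.
apply/forallP => j; apply/forallP => k; apply/implyP => /and3P[].
exact: sh.
Qed.

(** * Sets of edges as graphs *)

Section EdgeIndexing.
Variables (n N : nat) (ed : 'I_N -> 'I_n * 'I_n).

(** The basis of a space of bivectors is numbered arbitrarily; ed names the pair of
    coordinates of each basis vector. *)
Definition edge_indexing := [/\ injective ed,
  forall q, ((ed q).1 < (ed q).2)%N &
  forall a b : 'I_n, (a < b)%N -> exists q, ed q = (a, b)].

Definition adj (B : {set 'I_N}) (a b : 'I_n) : bool :=
  [exists q in B, (ed q == (a, b)) || (ed q == (b, a))].

Definition incident (q : 'I_N) (i : 'I_n) : bool :=
  ((ed q).1 == i) || ((ed q).2 == i).

(** The weight of e_B under the diagonal matrix with entries 0, 1, ..., n - 1. The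
    operator E_ij changes it by i - j. *)
Definition height (B : {set 'I_N}) : nat :=
  (\sum_(q in B) ((ed q).1 + (ed q).2))%N.

(** The coordinate of e_a ^ e_b at the basis vector q; antisymmetry in a and b
    replaces most case distinctions on their order. *)
Definition esgn (R : pzRingType) (q : 'I_N) (a b : 'I_n) : R :=
  (ed q == (a, b))%:R - (ed q == (b, a))%:R.

Definition even_degrees (B : {set 'I_N}) : bool :=
  [forall i, ~~ odd (degree (adj B) i)].

Definition shifted_even (B : {set 'I_N}) : bool :=
  shiftedb (adj B) && even_degrees B.

Hypothesis edP : edge_indexing.

Lemma adj_sym B : symmetric (adj B).
Proof. by move=> a b; apply: eq_existsb => q; rewrite orbC. Qed.

Lemma adj_irr B : irreflexive (adj B).
Proof.
case: edP => _ lt _ a; case: (boolP (adj B a a)) => // /exists_inP[q _].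
by rewrite orbb => /eqP qa; have := lt q; rewrite qa ltnn.
Qed.

Lemma adj_ed B q : adj B (ed q).1 (ed q).2 = (q \in B).
Proof.
case: edP => inj lt _; rewrite /adj; apply/exists_inP/idP => [[p pB /orP[]]|qB].
- by rewrite -surjective_pairing => /eqP/inj <-.
- move=> /eqP pq; have := lt p; rewrite pq /= => l.
  by have := ltn_trans l (lt q); rewrite ltnn.
- by exists q; rewrite // -surjective_pairing eqxx.
Qed.

Lemma esgnN R q a b : esgn R q a b = - esgn R q b a.
Proof. by rewrite /esgn opprB. Qed.

Lemma esgn_ed R p q : esgn R p (ed q).1 (ed q).2 = (p == q)%:R.
Proof.
case: edP => inj lt _; rewrite /esgn -surjective_pairing (inj_eq inj).
rewrite [ed p == _](_ : _ = false) ?subr0 //; apply/eqP => pq.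
by have := lt p; rewrite pq /= ltnNge ltnW ?lt.
Qed.

Lemma esgn_dual R a b c d : \sum_q esgn R q a b * esgn R q c d =
  ((a == c) && (b == d))%:R - ((a == d) && (b == c))%:R.
Proof.
wlog ab : a b c d / (a < b)%N => [hw|].
  case: (ltngtP a b) => [|ba|/val_inj ->]; first exact: hw.
    under eq_bigr do rewrite esgnN mulNr.
    by rewrite sumrN hw // opprB [(b == d) && _]andbC [(b == c) && _]andbC.
  rewrite big1 => [|q _]; last by rewrite /esgn subrr mul0r.
  by rewrite [(b == d) && _]andbC subrr.
case: edP => inj lt /(_ a b ab)[q0 q0E].
rewrite (bigD1 q0) //= big1 => [|q nq]; last first.
  by have := esgn_ed R q q0; rewrite q0E (negPf nq) /= => ->; rewrite mul0r.
have := esgn_ed R q0 q0; rewrite q0E eqxx /= => ->; rewrite mul1r addr0.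
by rewrite /esgn q0E !xpair_eqE.
Qed.

Lemma esgn_mul R p q i k : esgn R p i k * esgn R q i k =
  ((p == q) && ((ed q == (i, k)) || (ed q == (k, i))))%:R.
Proof.
case: edP => inj lt surj.
have main (a b : 'I_n) : (a < b)%N -> esgn R p a b * esgn R q a b =
    ((p == q) && ((ed q == (a, b)) || (ed q == (b, a))))%:R.
  move=> ab; have [q0 q0E] := surj a b ab.
  have := esgn_ed R ^~ q0; rewrite q0E /= => es; rewrite !es -natrM mulnb.
  rewrite -q0E (inj_eq inj) [ed q == _](_ : _ = false) ?orbF.
    by rewrite -[(p == q0)]eq_sym; case: (q =P q0) => [->|_];
      rewrite ?andbT ?andbF // eq_sym.
  by apply/eqP => qE; have := lt q; rewrite qE /= ltnNge ltnW.
case: (ltngtP i k) => [|ki|/val_inj ->]; first exact: main.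
  by rewrite esgnN [X in _ * X]esgnN mulrNN main // orbC.
rewrite orbb [ed q == _](_ : _ = false) ?andbF /esgn ?subrr ?mul0r //.
by apply/eqP => qE; have := lt q; rewrite qE ltnn.
Qed.

Lemma joins_inj p q i k : (ed p == (i, k)) || (ed p == (k, i)) ->
  (ed q == (i, k)) || (ed q == (k, i)) -> p = q.
Proof.
case: edP => inj lt _ /orP[]/eqP pE /orP[]/eqP qE; try by apply: inj; rewrite pE.
  by have := lt p; have := lt q; rewrite pE qE /= => l; rewrite ltnNge ltnW.
by have := lt p; have := lt q; rewrite pE qE /= => l; rewrite ltnNge ltnW.
Qed.

Lemma esgn_sqr R p q i : \sum_k esgn R p i k * esgn R q i k =
  ((p == q) && incident q i)%:R.
Proof.
under eq_bigr do rewrite esgn_mul; case: eqP => _ /=; last by rewrite big1.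
rewrite -natr_sum; congr (_%:R).
case: edP => inj lt _; rewrite /incident; case: (ed q) (lt q) => a b /= ab.
have nab : (a == b) = false by rewrite -val_eqE ltn_eqF.
case: (eqVneq a i) => [ai|nai].
  rewrite (bigD1 b) //= big1 => [|k kb]; first by rewrite -ai eqxx.
  by rewrite !xpair_eqE -ai [b == a]eq_sym nab andbF [b == k]eq_sym (negPf kb) andbF.
case: (eqVneq b i) => [bi|nbi].
  rewrite (bigD1 a) //= big1 => [|k ka]; first by rewrite -bi eqxx orbT.
  by rewrite !xpair_eqE -bi nab [a == k]eq_sym (negPf ka).
by rewrite big1 // => k _; rewrite !xpair_eqE (negPf nai) (negPf nbi) andbF.
Qed.

Lemma sum_incident q : (\sum_i incident q i = 2)%N.
Proof.
case: edP => inj lt _; have nab : (ed q).1 != (ed q).2 by rewrite -val_eqE ltn_eqF ?lt.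
rewrite (bigD1 (ed q).1) //= (bigD1 (ed q).2) 1?eq_sym //= /incident !eqxx orbT.
by rewrite big1 // => i /andP[i1 i2]; rewrite ![_ == i]eq_sym (negPf i1) (negPf i2).
Qed.

Lemma esgn_total (R : pzRingType) p q :
  \sum_i \sum_k esgn R p i k * esgn R q i k = (p == q)%:R *+ 2.
Proof.
under eq_bigr do rewrite esgn_sqr; case: eqP => _ /=; last by rewrite big1 ?mul0rn.
by rewrite -natr_sum sum_incident.
Qed.

Lemma degree_adj B i : degree (adj B) i = (\sum_(q in B) incident q i)%N.
Proof.
apply/eqP; rewrite -(eqr_nat rat) /degree !natr_sum; apply/eqP.
transitivity (\sum_k \sum_(q in B) esgn rat q i k * esgn rat q i k); last first.
  by rewrite exchange_big /=; apply: eq_bigr => q _; rewrite esgn_sqr eqxx.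
apply: eq_bigr => k _; rewrite /adj; case: exists_inP => [[q qB qe]|ne].
  rewrite (bigD1 q) //= esgn_mul eqxx qe big1 // => p /andP[pB pq].
  rewrite esgn_mul eqxx /=; case: (boolP (_ || _)) => // pe.
  by rewrite (joins_inj pe qe) eqxx in pq.
rewrite big1 // => q qB; rewrite esgn_mul eqxx /=.
by case: (boolP (_ || _)) => // qe; case: ne; exists q.
Qed.

Lemma sum_degree_adj B : (\sum_i degree (adj B) i = #|B|.*2)%N.
Proof.
under eq_bigr do rewrite degree_adj; rewrite exchange_big /=.
under eq_bigr do rewrite sum_incident.
by rewrite sum_nat_const muln2.
Qed.

(** With [closed_shifted], this makes shifted graphs the down-sets for the
    componentwise order on edges. The two endpoints are lowered one at a time. *)
Lemma shifted_closed (A : {set 'I_N}) p q : shifted (adj A) -> q \in A ->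
  ((ed p).1 <= (ed q).1)%N -> ((ed p).2 <= (ed q).2)%N -> p \in A.
Proof.
case: edP => _ lt _ shA; rewrite -!(adj_ed); have := lt p; have := lt q.
case: (ed p) => a b; case: (ed q) => c d /= cd ab qA ac bd.
have ad : adj A a d.
  move: ac; rewrite leq_eqVlt => /orP[/eqP/val_inj->//|ac].
  by apply: (shA _ _ _ ac) qA; rewrite -val_eqE /=; lia.
move: bd; rewrite leq_eqVlt => /orP[/eqP/val_inj->//|bd].
rewrite adj_sym; apply: (shA _ _ _ bd); last by rewrite adj_sym.
by rewrite -val_eqE /=; lia.
Qed.

End EdgeIndexing.

(** * The action of gl(n) on the exterior algebra of bivectors *)

Section GeneralLinearAction.
Variables (F : numFieldType) (U : vectType F) (n : nat).
Local Notation I := 'I_(\dim {:U}).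
Local Notation E := (exterior U).
Variable ed : I -> 'I_n * 'I_n.
Hypothesis edP : edge_indexing ed.
(* The ring of endomorphisms under composition. *)
Local Notation endE := (lfun_comp_nzRingType (FalgType_proper E)).

(** Multiplication by e_a ^ e_b. *)
Definition pair_create (a b : 'I_n) : 'End(E) :=
  \sum_q esgn ed F q a b *: linfun (create q).
(** Contraction with e_a ^ e_b. *)
Definition pair_annihilate (a b : 'I_n) : 'End(E) :=
  \sum_q esgn ed F q a b *: linfun (annihilate q).

Lemma pair_createE a b w :
  pair_create a b w = \sum_q esgn ed F q a b *: create q w.
Proof.
by rewrite sum_lfunE; apply: eq_bigr => q _; rewrite scale_lfunE lfunE.
Qed.

Lemma pair_annihilateE a b w :
  pair_annihilate a b w = \sum_q esgn ed F q a b *: annihilate q w.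
Proof.
by rewrite sum_lfunE; apply: eq_bigr => q _; rewrite scale_lfunE lfunE.
Qed.

Definition glE (a b : 'I_n) : 'End(E) :=
  @glop endE n pair_create pair_annihilate a b.

Lemma glEE a b w :
  glE a b w = \sum_m pair_create a m (pair_annihilate b m w).
Proof. by rewrite sum_lfunE; apply: eq_bigr => m _; rewrite comp_lfunE. Qed.

Lemma pair_createN a b : pair_create a b = - pair_create b a.
Proof. by rewrite -sumrN; apply: eq_bigr => q _; rewrite esgnN scaleNr. Qed.

Lemma pair_annihilateN a b : pair_annihilate a b = - pair_annihilate b a.
Proof. by rewrite -sumrN; apply: eq_bigr => q _; rewrite esgnN scaleNr. Qed.

Lemma comp_comb (f g : I -> {linear E -> E}) (s t : I -> F) w :
  \sum_p s p *: f p (\sum_q t q *: g q w) =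
  \sum_p \sum_q (s p * t q) *: f p (g q w).
Proof.
apply: eq_bigr => p _; rewrite linear_sum scaler_sumr; apply: eq_bigr => q _.
by rewrite linearZ /= scalerA.
Qed.

Lemma pair_create_anticomm a b c d :
  (pair_create a b \o pair_create c d)%VF = - (pair_create c d \o pair_create a b)%VF.
Proof.
apply/lfunP => w; rewrite opp_lfunE !comp_lfunE !pair_createE.
rewrite (comp_comb (fun q => create q : {linear E -> E})
  (fun q => create q : {linear E -> E})).
rewrite (comp_comb (fun q => create q : {linear E -> E})
  (fun q => create q : {linear E -> E})).
rewrite exchange_big -sumrN; apply: eq_bigr => p _; rewrite -sumrN.
by apply: eq_bigr => q _; rewrite /= create_anticomm scalerN mulrC.
Qed.

Lemma pair_annihilate_anticomm a b c d :
  (pair_annihilate a b \o pair_annihilate c d)%VF =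
  - (pair_annihilate c d \o pair_annihilate a b)%VF.
Proof.
apply/lfunP => w; rewrite opp_lfunE !comp_lfunE !pair_annihilateE.
rewrite (comp_comb (fun q => annihilate q : {linear E -> E})
  (fun q => annihilate q : {linear E -> E})).
rewrite (comp_comb (fun q => annihilate q : {linear E -> E})
  (fun q => annihilate q : {linear E -> E})).
rewrite exchange_big -sumrN; apply: eq_bigr => p _; rewrite -sumrN.
by apply: eq_bigr => q _; rewrite /= annihilate_anticomm scalerN mulrC.
Qed.

Lemma lfun_natmul (m : nat) w : (m%:R : endE) w = m%:R *: w.
Proof.
elim: m => [|m IH]; first by rewrite zero_lfunE scale0r.
by rewrite !mulrS add_lfunE IH id_lfunE scalerDl scale1r.
Qed.

Lemma pair_annihilate_create a b c d :
  (pair_annihilate a b : endE) * (pair_create c d : endE) =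
  ((a == c) && (b == d))%:R - ((a == d) && (b == c))%:R
  - (pair_create c d : endE) * (pair_annihilate a b : endE).
Proof.
apply/lfunP => w; rewrite add_lfunE add_lfunE !opp_lfunE !comp_lfunE !lfun_natmul.
rewrite !pair_annihilateE !pair_createE -scalerBl.
rewrite (comp_comb (fun q => annihilate q : {linear E -> E})
  (fun q => create q : {linear E -> E})).
rewrite (comp_comb (fun q => create q : {linear E -> E})
  (fun q => annihilate q : {linear E -> E})).
rewrite -(esgn_dual edP F) scaler_suml [X in _ - X]exchange_big -sumrB.
apply: eq_bigr => p _; rewrite [X in X - _](_ : _ = 
  \sum_q ((p == q)%:R * (esgn ed F p a b * esgn ed F q c d)) *: w).
  rewrite -sumrB; apply: eq_bigr => q _; rewrite /= annihilate_create scalerBr.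
  by rewrite scalerA [in RHS]mulrC [esgn _ _ q _ _ * _]mulrC.
rewrite (bigD1 p) //= eqxx mul1r big1 ?addr0 // => q.
by rewrite eq_sym => /negPf->; rewrite mul0r scale0r.
Qed.

Lemma endE_add (x y : endE) w : (x + y) w = x w + y w.
Proof. exact: add_lfunE. Qed.

Lemma endE_opp (x : endE) w : (- x) w = - x w.
Proof. exact: opp_lfunE. Qed.

Lemma endE_mul (x y : endE) w : (x * y) w = x (y w).
Proof. exact: comp_lfunE. Qed.

Lemma endE_sum (x : 'I_n -> endE) w : (\sum_i x i) w = \sum_i x i w.
Proof. exact: sum_lfunE. Qed.

Definition endE_simp := (endE_add, endE_opp, endE_mul, lfun_natmul).

Lemma endE_2torsion (x : endE) : x + x = 0 -> x = 0.
Proof.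
move=> xx; apply/lfunP => w; have /lfunP/(_ w) := xx.
rewrite endE_add zero_lfunE -{1 2}[x w]scale1r -scalerDl => /eqP.
by rewrite scaler_eq0 -mulr2n pnatr_eq0 /= => /eqP.
Qed.

Lemma glE_create i j k l w : glE i j (pair_create k l w) =
  (j == k)%:R *: pair_create i l w + (j == l)%:R *: pair_create k i w
  + pair_create k l (glE i j w).
Proof.
have /lfunP/(_ w) := @glop_create endE n pair_create pair_annihilate
  pair_createN pair_create_anticomm pair_annihilate_create i j k l.
by rewrite !endE_simp; apply.
Qed.

Lemma glE_comm i j k l w : glE i j (glE k l w) =
  (j == k)%:R *: glE i l w - (i == l)%:R *: glE k j w + glE k l (glE i j w).
Proof.
have /lfunP/(_ w) := @glop_comm endE n pair_create pair_annihilate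
  pair_createN pair_annihilateN pair_annihilate_anticomm pair_create_anticomm
  pair_annihilate_create i j k l.
by rewrite !endE_simp; apply.
Qed.

Lemma glE_casimir w : \sum_i \sum_j glE i j (glE j i w) =
  (n.-1)%:R *: \sum_i \sum_j pair_create i j (pair_annihilate i j w).
Proof.
have /lfunP/(_ w) := @glop_casimir endE n pair_create pair_annihilate
  pair_createN pair_annihilateN pair_annihilate_anticomm pair_annihilate_create
  endE_2torsion.
rewrite endE_mul lfun_natmul !endE_sum.
under [X in X = _ -> _]eq_bigr do
  (rewrite endE_sum; under eq_bigr do rewrite endE_mul).
under [X in _ = _ *: X -> _]eq_bigr do
  (rewrite endE_sum; under eq_bigr do rewrite endE_mul).
by apply.
Qed.

End GeneralLinearAction.

(** * Invariants of so(n) at graphs of least height *)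

Section Coefficients.
Variables (F : numFieldType) (U : vectType F) (n : nat).
Local Notation I := 'I_(\dim {:U}).
Local Notation E := (exterior U).
Variable ed : I -> 'I_n * 'I_n.
Hypothesis edP : edge_indexing ed.
Local Notation es := (esgn ed F).
Local Notation glE := (glE ed).

(** The number of violations of shiftedness. *)
Definition excess (B : {set I}) : nat :=
  (\sum_(i < n) \sum_(j < n | (i < j)%N) compressible (adj ed B) i j)%N.

Lemma create_annihilateE p (w : E) (B : {set I}) :
  create p (annihilate p w) B = (p \in B)%:R * w B :> F.
Proof.
rewrite createE; case: ifP => pB; last by rewrite mul0r.
rewrite ffunE !inE eqxx /= setD1K // mulrA fsignD1 // ltnn mul1r.
by rewrite fsign_sqr.
Qed.

Lemma pair_create_annihilateE a b c d w :
  pair_create ed a b (pair_annihilate ed c d w) =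
  \sum_p \sum_q (es p a b * es q c d) *: create p (annihilate q w).
Proof.
rewrite pair_createE pair_annihilateE.
exact: (comp_comb (fun q => create q : {linear E -> E})
  (fun q => annihilate q : {linear E -> E})).
Qed.

(** Every edge of B is counted once for each of its two orientations. *)
Lemma number_coef w (B : {set I}) :
  (\sum_i \sum_j pair_create ed i j (pair_annihilate ed i j w)) B =
  (#|B|.*2)%:R * w B :> F.
Proof.
transitivity ((\sum_p (2 : F) *: create p (annihilate p w)) B : F).
  congr (fun_of_fin _ B).
  under eq_bigr do under eq_bigr do rewrite pair_create_annihilateE.
  under eq_bigr do rewrite exchange_big /=.
  rewrite exchange_big /=; apply: eq_bigr => p _.
  under eq_bigr do rewrite exchange_big /=.
  rewrite exchange_big /=.
  rewrite (bigD1 p) //= [X in _ + X]big1 ?addr0 => [|q /negPf qp].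
    under eq_bigr do rewrite -scaler_suml.
    by rewrite -scaler_suml (esgn_total edP) eqxx.
  under eq_bigr do rewrite -scaler_suml.
  by rewrite -scaler_suml (esgn_total edP) eq_sym qp mul0rn scale0r.
rewrite sum_ffunE; under eq_bigr do rewrite ffunE create_annihilateE.
rewrite -scaler_sumr -mulr_suml [LHS]mulrA; congr (_ * _).
rewrite -muln2 natrM mulrC; congr (_ * _); rewrite -sum1_card natr_sum.
by rewrite [RHS]big_mkcond; apply: eq_bigr => q _; case: (q \in B).
Qed.

Lemma glE_diag_coef i w (B : {set I}) :
  glE i i w B = (degree (adj ed B) i)%:R * w B :> F.
Proof.
rewrite glEE; transitivity
  ((\sum_p (incident ed p i)%:R *: create p (annihilate p w)) B : F).
  congr (fun_of_fin _ B).
  under eq_bigr do rewrite pair_create_annihilateE.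
  rewrite exchange_big /=; apply: eq_bigr => p _.
  rewrite exchange_big /= (bigD1 p) //= [X in _ + X]big1 ?addr0 => [|q /negPf qp].
    by rewrite -scaler_suml (esgn_sqr edP) eqxx.
  by rewrite -scaler_suml (esgn_sqr edP) eq_sym qp scale0r.
rewrite sum_ffunE (degree_adj edP) natr_sum mulr_suml [RHS]big_mkcond /=.
apply: eq_bigr => q _; rewrite ffunE create_annihilateE.
by case: (q \in B); rewrite ?mul1r // mul0r [LHS]mulr0.
Qed.

Lemma sum_neq0 (J : finType) (f : J -> F) : \sum_j f j != 0 -> exists j, f j != 0.
Proof.
move=> nz; apply/existsP; apply: contraNT nz; rewrite negb_exists => /forallP f0.
by rewrite big1 // => j _; apply/eqP; rewrite -[_ == _]negbK.
Qed.

Lemma esgn_neq0 q a b : es q a b != 0 -> ((ed q).1 + (ed q).2 = a + b)%N.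
Proof.
rewrite /esgn; case: (ed q =P (a, b)) => [->|_] //.
case: (ed q =P (b, a)) => [->|_]; first by rewrite /= addnC.
by rewrite subrr eqxx.
Qed.

(** E_ij replaces one endpoint j of an edge by i. *)
Lemma glE_height i j (w : E) (B : {set I}) : (glE i j w B : F) != 0 ->
  exists2 B' : {set I}, (w B' : F) != 0 &
    (height ed B' + i = height ed B + j)%N.
Proof.
rewrite glEE sum_ffunE => /sum_neq0[m].
rewrite pair_create_annihilateE sum_ffunE => /sum_neq0[p].
rewrite sum_ffunE => /sum_neq0[q]; rewrite ffunE createE.
rewrite [_ *: _]/(_ * _) mulf_eq0 negb_or mulf_eq0 negb_or -andbA.
case/and3P => /esgn_neq0 pE /esgn_neq0 qE.
case: ifP => [pB|]; last by rewrite eqxx.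
rewrite mulf_eq0 negb_or => /andP[_]; rewrite ffunE.
case: ifP => [|qB]; first by rewrite eqxx.
rewrite mulf_eq0 negb_or => /andP[_ nz]; exists (q |: B :\ p) => //.
rewrite /height big_setU1 ?qB //= (big_setD1 p pB) /= pE qE; ring.
Qed.

(** For i < j, the commutation relations turn E_ij E_ji + E_ji E_ij into
    2 E_ji E_ij plus the diagonal operator E_ii - E_jj, and E_ij w = E_ji w
    replaces E_ji E_ij w by E_ji E_ji w. The Casimir operator and the diagonal
    operators multiply the coefficient at B by known numbers, which add up to the
    excess by [sum_compressible]. *)
Lemma casimir_coef (w : E) (B : {set I}) :
  (forall i j, glE i j w = glE j i w) ->
  (excess B).*2%:R * (w B : F) =
  \sum_(i < n) \sum_(j < n | (i < j)%N) (glE j i (glE j i w) B : F) *+ 2.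
Proof.
move=> sow; pose X i j : F := glE i j (glE j i w) B.
have cas : \sum_i \sum_j X i j = (n.-1)%:R * ((#|B|.*2)%:R * w B).
  rewrite -number_coef.
  transitivity ((\sum_i \sum_j glE i j (glE j i w)) B : F); last first.
    by rewrite (glE_casimir edP) ffunE.
  rewrite sum_ffunE; apply: eq_bigr => i _.
  by rewrite sum_ffunE.
have off i j : i != j -> X i j + X j i =
    ((degree (adj ed B) i)%:R - (degree (adj ed B) j)%:R) * w B
    + (glE j i (glE j i w) B : F) *+ 2.
  move=> nij.
  have -> : X i j = (glE i i w B : F) - glE j j w B + glE j i (glE i j w) B.
    by rewrite /X (glE_comm edP i j j i w) !eqxx !scale1r !ext_coefE.
  rewrite (glE_diag_coef i w B) (glE_diag_coef j w B) /X.
  by rewrite (sow i j) mulr2n addrA mulrBl.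
rewrite (sum_compressible (@adj_sym _ _ ed B) (adj_irr edP B)) -natr_sum.
rewrite (sum_degree_adj edP) !mulrBl -mulrA -cas sum_offdiag.
under [X in _ + X - _ - _]eq_bigr => i _.
  under eq_bigr => j ij do rewrite off -?val_eqE ?ltn_eqF //.
  rewrite big_split -mulr_suml /=; over.
rewrite big_split -mulr_suml /=.
rewrite [X in X + _ - _ - _](_ : _ = (\sum_i (degree (adj ed B) i)%:R ^+ 2) * w B).
  ring.
rewrite mulr_suml; apply: eq_bigr => i _.
by rewrite /X !glE_diag_coef mulrA expr2.
Qed.

(** Choose B of least height in the support of w. For i < j the coefficient at B
    of E_ji E_ji w only depends on coefficients of w at smaller heights, which
    vanish; so [casimir_coef] makes the excess of B vanish. *)
Lemma so_invariant_coef (w : E) : (forall i j, glE i j w = glE j i w) ->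
  w != 0 -> exists2 B : {set I}, (w B : F) != 0 & shifted (adj ed B).
Proof.
move=> sow nz.
have [B0 wB0] : exists B : {set I}, (w B : F) != 0.
  apply/existsP; apply: contraNT nz; rewrite negb_exists => /forallP w0.
  by apply/eqP/ffunP => B; rewrite ffunE; apply/eqP; rewrite -[_ == _]negbK.
pose P (B : {set I}) := (w B : F) != 0.
have [B wB Bmin] := @arg_minnP _ B0 P (height ed) wB0; exists B => //.
apply: compressible_shifted => i j ij.
have := casimir_coef B sow; rewrite big1 => [/eqP|a _].
  rewrite mulf_eq0 (negPf wB) orbF pnatr_eq0 double_eq0 /excess sum_nat_eq0.
  move=> /forallP/(_ i)/=; rewrite sum_nat_eq0 => /forallP/(_ j).
  by rewrite ij /= => /eqP.
apply: big1 => b ab; apply/eqP; rewrite mulrn_eq0 /=.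
case: eqP => // /eqP /glE_height[B1 /glE_height[B2 wB2 h2] h1].
by have := Bmin B2 wB2; lia.
Qed.

End Coefficients.

(** * First order expansions of polynomial maps *)

Section Jets.
Variables (F : numFieldType) (A : algType F).

(** f is a polynomial map with value a and derivative b at 0. Being algebraic, this
    notion of derivative is available over every field of characteristic 0. *)
Definition jet (f : F -> A) (a b : A) :=
  exists p : {poly A}, [/\ forall t, f t = p.[t%:A], p`_0 = a & p`_1 = b].

Lemma comm_poly_scalar (p : {poly A}) (t : F) : comm_poly p t%:A.
Proof. by rewrite /comm_poly -scalerAl mul1r -scalerAr mulr1. Qed.

Lemma jet_ext f g a b : f =1 g -> jet f a b -> jet g a b.
Proof. by move=> fg [p [fE pa pb]]; exists p; split=> // t; rewrite -fg. Qed.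

Lemma jet_const a : jet (fun=> a) a 0.
Proof. by exists a%:P; split=> [t||]; rewrite ?hornerC // coefC. Qed.

Lemma jetM f g a b a' b' : jet f a b -> jet g a' b' ->
  jet (fun t => f t * g t) (a * a') (a * b' + b * a').
Proof.
move=> [p [fE <- <-]] [q [gE <- <-]]; exists (p * q); split=> [t||].
- by rewrite fE gE hornerM_comm //; apply: comm_poly_scalar.
- by rewrite coefM big_ord_recl big_ord0 addr0.
- by rewrite coefM !big_ord_recl big_ord0 addr0.
Qed.

Lemma jet_comb (c : F) f g a b a' b' : jet f a b -> jet g a' b' ->
  jet (fun t => c *: f t + g t) (c *: a + a') (c *: b + b').
Proof.
move=> [p [fE <- <-]] [q [gE <- <-]]; exists (c%:A%:P * p + q); split=> [t||].
- by rewrite fE gE hornerD hornerCM -scalerAl mul1r.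
- by rewrite coefD coefCM -scalerAl mul1r.
- by rewrite coefD coefCM -scalerAl mul1r.
Qed.

Lemma jet_sum (J : finType) (f : J -> F -> A) a b :
  (forall j, jet (f j) (a j) (b j)) ->
  jet (fun t => \sum_j f j t) (\sum_j a j) (\sum_j b j).
Proof.
move=> fj; elim: (index_enum J) => [|j r IH].
  by apply: (@jet_ext (fun=> 0)) => [t|]; rewrite !big_nil //; apply: jet_const.
rewrite !big_cons -[a j]scale1r -[b j]scale1r.
apply: (@jet_ext (fun t => 1 *: f j t + \sum_(i <- r) f i t)) => [t|].
  by rewrite big_cons scale1r.
exact: jet_comb.
Qed.

Lemma jet_affine a b c : jet (fun t : F => a + t *: b + t ^+ 2 *: c) a b.
Proof.
exists (a%:P + b%:P * 'X + c%:P * 'X^2); split=> [t||].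
- rewrite !hornerD hornerMX !hornerC [(c%:P * _).[_]]hornerM_comm; last first.
    exact: comm_poly_scalar.
  rewrite hornerC hornerXn -!scalerAr mulr1; congr (_ + _).
  by rewrite exprZn expr1n -scalerAr mulr1.
- by rewrite !coefD coefC coefMX coefMXn /= !addr0.
- by rewrite !coefD coefC coefMX coefMXn /= add0r coefC addr0.
Qed.

Lemma poly_nat_roots0 (p : {poly F}) : (forall k : nat, p.[k%:R] = 0) -> p = 0.
Proof.
move=> p0; apply/eqP; pose rs : seq F := [seq k%:R | k <- iota 0 (size p)].
apply: contraT => nz; have := @max_poly_roots F p rs nz.
rewrite size_map size_iota ltnn => -> //.
  by apply/allP => _ /mapP[k _ ->]; rewrite rootE p0.
by rewrite map_inj_uniq ?iota_uniq // => i j /eqP; rewrite eqr_nat => /eqP.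
Qed.

(** Natural numbers already determine a polynomial. The linear form phi reduces
    polynomials with coefficients in A to polynomials over F. *)
Lemma jet_uniq (phi : {linear A -> F^o}) f g a b a' b' :
  jet f a b -> jet g a' b' -> (forall k : nat, f k%:R = g k%:R) ->
  phi b = phi b'.
Proof.
move=> [p [fE _ <-]] [q [gE _ <-]] fg.
pose r : {poly F} := \poly_(i < maxn (size p) (size q)) (phi (p`_i - q`_i)).
have r0 : r = 0.
  apply: poly_nat_roots0 => k.
  have : (p - q).[k%:R%:A] = 0 by rewrite hornerD hornerN -fE -gE fg subrr.
  rewrite (@horner_coef_wide _ (maxn (size p) (size q))); last first.
    by rewrite (leq_trans (size_polyD _ _)) // size_polyN.
  move=> /(congr1 phi); rewrite linear0 linear_sum => <-.
  rewrite horner_poly; apply: eq_bigr => i _.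
  by rewrite exprZn expr1n -scalerAr mulr1 linearZ /= mulrC coefB.
have : r`_1 = 0 by rewrite r0 coef0.
rewrite coef_poly; case: ltnP => [_|]; last first.
  by rewrite geq_max => /andP[p1 q1] _; rewrite !nth_default.
by rewrite linearB => /eqP; rewrite subr_eq0 => /eqP.
Qed.

End Jets.

(** * From O(n) to so(n) *)

Section OrthogonalInvariance.
Variables (F : numFieldType) (U : vectType F) (n : nat).
Local Notation I := 'I_(\dim {:U}).
Local Notation E := (exterior U).
Variable ed : I -> 'I_n * 'I_n.
Hypothesis edP : edge_indexing ed.
Local Notation glE := (glE ed).

(** The bivector e_a ^ e_b. *)
Definition wedge (a b : 'I_n) : E := \sum_q esgn ed F q a b *: ext_basis [set q].

Lemma wedge_ed q : wedge (ed q).1 (ed q).2 = ext_basis [set q].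
Proof.
rewrite /wedge (bigD1 q) //= (esgn_ed edP) eqxx scale1r big1 ?addr0 // => p.
by rewrite (esgn_ed edP) => /negPf->; rewrite scale0r.
Qed.

Lemma pair_create_wedge a b w : pair_create ed a b w = wedge a b * w.
Proof.
rewrite pair_createE mulr_suml; apply: eq_bigr => q _.
by rewrite /create scalerAl.
Qed.

(** An action by algebra endomorphisms that is the second exterior power of the
    standard one on generators. It is defined for all matrices, including singular
    ones, so that its coefficients are polynomials in the entries of M. *)
Definition exterior_gl_action (act : 'M[F]_n -> 'End(E)) :=
  [/\ forall M, monoid_morphism (act M),
      forall M q, act M (ext_basis [set q]) =
        \sum_a \sum_b (M a (ed q).1 * M b (ed q).2) *: wedge a b &
      forall M M', act (M *m M') = (act M \o act M')%VF].

(** The derivation that extends the action of K on bivectors. *)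
Definition der (K : 'M[F]_n) (w : E) : E := \sum_a \sum_c K a c *: glE a c w.

Lemma glE1 a b : glE a b 1 = 0.
Proof.
rewrite glEE big1 // => m _.
rewrite pair_annihilateE [X in pair_create _ _ _ X]big1 ?linear0 // => q _.
suff -> : annihilate q (1 : E) = 0 by rewrite scaler0.
apply/ffunP => B; rewrite !ffunE; case: ifP => // qB.
rewrite [_ == set0](_ : _ = false) ?mulr0 //.
by apply/negbTE/set0Pn; exists q; rewrite setU11.
Qed.

Lemma glE_wedge i j k l : glE i j (wedge k l) =
  (j == k)%:R *: wedge i l + (j == l)%:R *: wedge k i.
Proof.
have := glE_create edP i j k l 1; rewrite !pair_create_wedge glE1 !mulr1.
by rewrite mulr0 addr0.
Qed.

Lemma glE_wedgeM i j k l w :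
  glE i j (wedge k l * w) = glE i j (wedge k l) * w + wedge k l * glE i j w.
Proof.
have := glE_create edP i j k l w; rewrite !pair_create_wedge glE_wedge => ->.
by rewrite mulrDl !scalerAl.
Qed.

Lemma der_basisM K q w : der K (ext_basis [set q] * w) =
  der K (ext_basis [set q]) * w + ext_basis [set q] * der K w.
Proof.
rewrite /der mulr_suml mulr_sumr -big_split; apply: eq_bigr => a _ /=.
rewrite mulr_suml mulr_sumr -big_split; apply: eq_bigr => c _ /=.
by rewrite -wedge_ed glE_wedgeM scalerDr -scalerAl -scalerAr.
Qed.

Lemma der_wedge K k l : der K (wedge k l) =
  \sum_a \sum_b ((a == k)%:R * K b l + K a k * (b == l)%:R) *: wedge a b.
Proof.
transitivity (\sum_b K b l *: wedge k b + \sum_a K a k *: wedge a l); last first.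
  under [RHS]eq_bigr do under eq_bigr do rewrite scalerDl.
  under [RHS]eq_bigr do rewrite big_split.
  rewrite big_split; congr (_ + _).
    rewrite [RHS](bigD1 k) //= [X in _ + X]big1 => [|a /negPf->].
      by rewrite addr0; apply: eq_bigr => b _; rewrite eqxx mul1r.
    by rewrite big1 // => b _; rewrite mul0r scale0r.
  apply: eq_bigr => a _; rewrite [RHS](bigD1 l) //= [X in _ + X]big1 => [|b /negPf->].
    by rewrite eqxx mulr1 addr0.
  by rewrite mulr0 scale0r.
rewrite [RHS]addrC -big_split; apply: eq_bigr => a _ /=.
under eq_bigr do rewrite glE_wedge scalerDr.
rewrite big_split; congr (_ + _).
  rewrite (bigD1 k) //= big1 => [|c /negPf->]; first by rewrite eqxx scale1r addr0.
  by rewrite scale0r scaler0.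
rewrite (bigD1 l) //= big1 => [|c /negPf->]; first by rewrite eqxx scale1r addr0.
by rewrite scale0r scaler0.
Qed.

Variable act : 'M[F]_n -> 'End(E).
Hypothesis actP : exterior_gl_action act.

Lemma actM M u v : act M (u * v) = act M u * act M v.
Proof. by case: actP => mon _ _; case: (mon M). Qed.

Lemma act1 M : act M 1 = 1.
Proof. by case: actP => mon _ _; case: (mon M). Qed.

Lemma act_basis M (S : {set I}) :
  act M (ext_basis S) = \prod_(q in S) act M (ext_basis [set q]).
Proof.
by rewrite -prod_ext_basis1 (big_morph _ (actM M) (act1 M)).
Qed.

Lemma ext_basisU1 (q : I) (S : {set I}) : (forall p, p \in S -> (q < p)%N) ->
  ext_basis (q |: S) = ext_basis [set q] * ext_basis S :> E.
Proof.
move=> qS; have qNS : q \notin S by apply/negP => /qS; rewrite ltnn.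
rewrite [RHS]ext_mul_basis /ext_mulB disjoints1 qNS /inversions big_set1.
rewrite [X in _ ^+ X]big1 ?scale1r // => p /qS qp.
by rewrite ltnNge ltnW.
Qed.

(** Both the action and the derivation are determined by their effect on one
    bivector, through [actM] and [der_basisM]; [jetM] matches the two rules. *)
Lemma act_jet (M : F -> 'M[F]_n) (K S : 'M[F]_n) w :
  (forall t, M t = 1%:M + t *: K + t ^+ 2 *: S) ->
  jet (fun t => act (M t) w) w (der K w).
Proof.
move=> ME; elim/ext_ind: w => [|c u v ju jv|B].
- apply: (@jet_ext _ _ (fun=> 0)) => [t|]; first by rewrite linear0.
  rewrite [X in jet _ _ X](_ : _ = 0); first exact: jet_const.
  by rewrite /der big1 // => a _; rewrite big1 // => b _; rewrite linear0 scaler0.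
- apply: (@jet_ext _ _ (fun t => c *: act (M t) u + act (M t) v)) => [t|].
    by rewrite linearP.
  rewrite [X in jet _ _ X](_ : _ = c *: der K u + der K v); first exact: jet_comb.
  rewrite /der scaler_sumr -big_split; apply: eq_bigr => a _ /=.
  rewrite scaler_sumr -big_split; apply: eq_bigr => b _ /=.
  by rewrite linearP scalerDr !scalerA mulrC.
elim/set_min_ind: B => [|q B qB jB].
  apply: (@jet_ext _ _ (fun=> 1)) => [t|]; first by rewrite act1.
  rewrite [X in jet _ _ X](_ : _ = 0); first exact: jet_const.
  by rewrite /der big1 // => a _; rewrite big1 // => b _; rewrite glE1 scaler0.
rewrite ext_basisU1 // der_basisM addrC.
apply: (@jet_ext _ _ (fun t => act (M t) (ext_basis [set q]) * act (M t) (ext_basis B))).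
  by move=> t; rewrite actM.
apply: jetM => //; rewrite -wedge_ed der_wedge wedge_ed.
case: actP => _ gen _; set k := (ed q).1; set l := (ed q).2.
rewrite -wedge_ed.
rewrite [X in jet _ X _](_ : _ = \sum_a \sum_b ((a == k)%:R * (b == l)%:R) *: wedge a b);
  last first.
  rewrite (bigD1 k) //= [X in _ + X]big1 => [|a /negPf->]; last first.
    by rewrite big1 // => b _; rewrite mul0r scale0r.
  rewrite (bigD1 l) //= [X in _ + X + _]big1 => [|b /negPf->]; last first.
    by rewrite mulr0 scale0r.
  by rewrite !eqxx mulr1 scale1r !addr0.
apply: (@jet_ext _ _ (fun t => \sum_a \sum_b (M t a k * M t b l) *: wedge a b)).
  by move=> t; rewrite wedge_ed gen.
apply: jet_sum => a; apply: jet_sum => b.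
have jE c d : jet (fun t : F => (M t c d)%:A : E) (c == d)%:R%:A (K c d)%:A.
  apply: (jet_ext _ (jet_affine (c == d)%:R%:A (K c d)%:A (S c d)%:A)) => t.
  by rewrite ME !mxE !scalerA -!scalerDl.
have := jetM (jetM (jE a k) (jE b l)) (jet_const (wedge a b)).
rewrite !mulr0 add0r.
rewrite -!(scalerAl, scalerAr) !mul1r !scalerA.
rewrite -scalerDl -scalerAl mul1r.
by apply: jet_ext => t; rewrite -!(scalerAl, scalerAr) !mul1r scalerA.
Qed.

(** A product of k bivectors has degree 2k in the vectors of V. *)
Lemma act_scale c M (w : E) k :
  (forall B : {set I}, #|B| != k -> (w B : F) = 0) ->
  act (c *: M) w = c ^+ k.*2 *: act M w.
Proof.
have actw N : act N w = \sum_B (w B : F) *: act N (ext_basis B).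
  rewrite {1}(ext_sum w) linear_sum; apply: eq_bigr => B _.
  by rewrite linearZ.
move=> wk; rewrite !actw scaler_sumr; apply: eq_bigr => B _.
have [Bk|/wk->] := eqVneq #|B| k; last by rewrite !scale0r scaler0.
rewrite [in RHS]scalerA mulrC -scalerA; congr (_ *: _); rewrite -Bk {Bk wk}.
elim/set_min_ind: B => [|q B qB IH].
  by rewrite cards0 scale1r !act_basis !big_set0.
have qNB : q \notin B by apply/negP => /qB; rewrite ltnn.
rewrite ext_basisU1 // !actM IH cardsU1 qNB add1n doubleS !exprS mulrA.
have -> : act (c *: M) (ext_basis [set q]) = (c * c) *: act M (ext_basis [set q]).
  case: actP => _ gen _; rewrite !gen scaler_sumr; apply: eq_bigr => a _.
  rewrite scaler_sumr; apply: eq_bigr => b _; rewrite !mxE scalerA; congr (_ *: _).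
  ring.
by rewrite -scalerAr -scalerAl scalerA mulrC.
Qed.

(** In the rational parametrization of rotations by t, with cosine
    (1 - t^2) / (1 + t^2) and sine 2t / (1 + t^2), clearing the denominator leaves
    a quadratic curve of matrices through 1%:M that are orthogonal up to a scalar. *)
Lemma rotation_mx (i j : 'I_n) (t : F) : i != j ->
  let M := 1%:M + t *: (2 *: (delta_mx i j - delta_mx j i))
    + t ^+ 2 *: (1%:M - 2 *: (delta_mx i i + delta_mx j j)) in
  M^T *m M = ((1 + t ^+ 2) ^+ 2)%:M.
Proof.
move=> nij /=; set J := delta_mx i j - _; set P := delta_mx i i + _.
have nji : (j == i) = false by rewrite eq_sym (negPf nij).
have J_tr : J^T = - J by rewrite /J linearB /= !trmx_delta opprB.
have P_tr : P^T = P by rewrite /P linearD /= !trmx_delta.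
have JJ : J *m J = - P.
  rewrite /J mulmxBl !mulmxBr !mul_delta_mx_cond !eqxx nji (negPf nij).
  by rewrite !mulr0n !mulr1n sub0r subr0 opprD.
have JP : J *m P = J.
  rewrite /J /P mulmxBl !mulmxDr !mul_delta_mx_cond !eqxx nji (negPf nij).
  by rewrite !mulr0n !mulr1n add0r addr0.
have PJ : P *m J = J.
  rewrite /J /P mulmxDl !mulmxBr !mul_delta_mx_cond !eqxx nji (negPf nij).
  by rewrite !mulr0n !mulr1n sub0r subr0.
have PP : P *m P = P.
  rewrite /P mulmxDl !mulmxDr !mul_delta_mx_cond !eqxx nji (negPf nij).
  by rewrite !mulr0n !mulr1n add0r addr0.
have -> : 1%:M + t *: (2 *: J) + t ^+ 2 *: (1%:M - 2 *: P) =
    (1 + t ^+ 2)%:M + (2 * t) *: J + (- 2 * t ^+ 2) *: P.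
  by apply/matrixP => x y; rewrite !mxE; case: (x == y); rewrite ?mulr1n ?mulr0n; ring.
move: J P J_tr P_tr JJ JP PJ PP => J P J_tr P_tr JJ JP PJ PP.
rewrite !linearD /= !linearZ /= tr_scalar_mx J_tr P_tr scalerN.
rewrite !(mulmxDl, mulmxDr, mulNmx, mulmxN, mul_scalar_mx, mul_mx_scalar).
rewrite -!(scalemxAl, scalemxAr) JJ JP PJ PP.
apply/matrixP => x y; rewrite !mxE.
by case: (x == y); rewrite ?mulr1n ?mulr0n; ring.
Qed.

(** Along the curve M t of [rotation_mx], act (M t) w has derivative
    2 (E_ij - E_ji) w, while invariance makes it (1 + t^2)^(2k) w, which has
    derivative 0. *)
Lemma orthogonal_invariant_glE (w : E) k :
  (forall B : {set I}, #|B| != k -> (w B : F) = 0) ->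
  (forall g, orthogonal_mx g -> act g w = w) ->
  forall i j, glE i j w = glE j i w.
Proof.
move=> wk inv i j; have [->//|nij] := eqVneq i j.
pose K : 'M[F]_n := 2 *: (delta_mx i j - delta_mx j i).
pose S : 'M[F]_n := 1%:M - 2 *: (delta_mx i i + delta_mx j j).
pose M (t : F) := 1%:M + t *: K + t ^+ 2 *: S.
have MM t : (M t)^T *m M t = ((1 + t ^+ 2) ^+ 2)%:M by apply: rotation_mx.
(* The scalar 1 + t ^+ 2 is invertible at natural t, and [jet_uniq] asks for no
   other values. *)
have s0 (m : nat) : 1 + m%:R ^+ 2 != 0 :> F.
  by rewrite -natrX -(natrD _ 1) pnatr_eq0.
have actM_w (m : nat) : act (M m%:R) w = (1 + m%:R ^+ 2) ^+ k.*2 *: w.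
  set s := 1 + _; have sn0 : s != 0 := s0 m.
  rewrite -{2}(inv (s^-1 *: M m%:R)).
    by rewrite -act_scale // scalerA divff // scale1r.
  have trZ : (s^-1 *: M m%:R)^T = s^-1 *: (M m%:R)^T by rewrite linearZ.
  rewrite /orthogonal_mx trZ -scalemxAl -scalemxAr MM scalerA.
  rewrite scale_scalar_mx -/s; congr (_%:M); field.
  exact: sn0.
have jet1 := act_jet w (fun t => erefl (M t)).
have jet2 : jet (fun t : F => (1 + t ^+ 2) ^+ k.*2 *: w) w 0.
  elim: k.*2 => [|m IH].
    by apply: (jet_ext _ (jet_const w)) => t; rewrite scale1r.
  have := jetM (jet_affine (1 : E) 0 1) IH; rewrite mul1r mulr0 mul0r addr0.
  apply: jet_ext => t; rewrite scaler0 addr0 mulrDl mul1r -scalerAl mul1r.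
  by rewrite scalerA -scalerDl [in RHS]exprS mulrDl mul1r.
have derw : der K w = 2 *: (glE i j w - glE j i w).
  have glD a b : \sum_u \sum_v delta_mx a b u v *: glE u v w = glE a b w.
    rewrite (bigD1 a) //= [X in _ + X]big1 ?addr0 => [|u /negPf ua]; last first.
      by rewrite big1 // => v _; rewrite mxE ua scale0r.
    rewrite (bigD1 b) //= big1 ?addr0 => [|v /negPf vb].
      by rewrite mxE !eqxx scale1r.
    by rewrite mxE vb andbF scale0r.
  rewrite -(glD i j) -(glD j i) -sumrB scaler_sumr; apply: eq_bigr => u _.
  rewrite -sumrB scaler_sumr; apply: eq_bigr => v _.
  by rewrite -scalerBl scalerA !mxE.
apply: ext_eqP => B; pose phi (u : E) : F^o := u B.
have phi_lin : linear phi by move=> c u v; rewrite /phi !ext_coefE.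
pose phiL := HB.pack phi (GRing.isLinear.Build _ _ _ _ phi phi_lin) : {linear E -> F^o}.
have := jet_uniq phiL jet1 jet2 actM_w.
rewrite derw /phiL /= /phi !ext_coefE ffunE => /eqP.
by rewrite mulf_eq0 pnatr_eq0 /= subr_eq0 => /eqP.
Qed.

End OrthogonalInvariance.

(** * Triangular matrices and shifted graphs *)

Definition upper_mx (F : fieldType) n (M : 'M[F]_n) :=
  forall i j : 'I_n, (j < i)%N -> M i j = 0.

Section TriangularAction.
Variables (F : numFieldType) (U : vectType F) (n : nat).
Local Notation I := 'I_(\dim {:U}).
Local Notation E := (exterior U).
Variable ed : I -> 'I_n * 'I_n.
Hypothesis edP : edge_indexing ed.
Variable act : 'M[F]_n -> 'End(E).
Hypothesis actP : exterior_gl_action ed act.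

(** The entries of the second compound matrix of M. *)
Definition minor2 (M : 'M[F]_n) (p q : I) : F :=
  M (ed p).1 (ed q).1 * M (ed p).2 (ed q).2 -
  M (ed p).2 (ed q).1 * M (ed p).1 (ed q).2.

Lemma sum_pair_delta (f : 'I_n -> 'I_n -> F) x y :
  \sum_a \sum_b f a b * ((x, y) == (a, b))%:R = f x y.
Proof.
rewrite (bigD1 x) //= [X in _ + X]big1 ?addr0 => [|a /negPf ax]; last first.
  by rewrite big1 // => b _; rewrite xpair_eqE eq_sym ax mulr0.
rewrite (bigD1 y) //= big1 ?addr0 => [|b /negPf by_]; first by rewrite eqxx mulr1.
by rewrite xpair_eqE [y == b]eq_sym by_ andbF mulr0.
Qed.

Lemma act_gen M q : act M (ext_basis [set q]) =
  \sum_p minor2 M p q *: ext_basis [set p].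
Proof.
case: actP => _ -> _; rewrite /wedge.
under eq_bigr do under eq_bigr do rewrite scaler_sumr.
under eq_bigr do rewrite exchange_big /=.
rewrite exchange_big /=; apply: eq_bigr => p _.
under eq_bigr do under eq_bigr do rewrite scalerA.
under eq_bigr do rewrite -scaler_suml.
rewrite -scaler_suml; congr (_ *: _); rewrite /minor2.
rewrite -(sum_pair_delta (fun a b => M a (ed q).1 * M b (ed q).2)).
rewrite -[X in _ = _ - X](sum_pair_delta (fun b a => M a (ed q).1 * M b (ed q).2)).
rewrite [X in _ = _ - X]exchange_big -sumrB; apply: eq_bigr => a _.
rewrite -sumrB; apply: eq_bigr => b _; rewrite -!surjective_pairing -mulrBr.
by [].
Qed.

Lemma act_basisU1 M (q : I) (A : {set I}) : (forall p, p \in A -> (q < p)%N) ->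
  act M (ext_basis (q |: A)) =
  \sum_p minor2 M p q *: create p (act M (ext_basis A)).
Proof.
move=> qA; rewrite ext_basisU1 // (actM actP) act_gen mulr_suml.
by apply: eq_bigr => p _; rewrite -scalerAl.
Qed.

Lemma act_coefU1 M (q : I) (A B : {set I}) : (forall p, p \in A -> (q < p)%N) ->
  act M (ext_basis (q |: A)) B = \sum_(p in B)
    minor2 M p q * ((fsign p B : F) * act M (ext_basis A) (B :\ p)) :> F.
Proof.
move=> qA; rewrite act_basisU1 // sum_ffunE [RHS]big_mkcond /=.
apply: eq_bigr => p _; rewrite ext_scaleE createE; case: ifP => //.
by rewrite mulr0.
Qed.

Lemma ext_basis0 : ext_basis set0 = 1 :> E.
Proof. by []. Qed.

(** Expanding the product of the images of the edges of A, a term that contributes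
    to e_B selects one edge f q of B in the image of each edge q of A. *)
Lemma act_support M (A B : {set I}) : act M (ext_basis A) B != 0 :> F ->
  exists f : I -> I, [/\ {in A &, injective f}, f @: A = B &
    forall q, q \in A -> minor2 M (f q) q != 0].
Proof.
elim/set_min_ind: A B => [|q A qA IH] B.
  rewrite ext_basis0 (act1 actP) ffunE pnatr_eq0 eqb0 negbK => /eqP->.
  by exists id; split=> [?|| ?]; rewrite ?imset0 ?inE.
have qNA : q \notin A by apply/negP => /qA; rewrite ltnn.
rewrite act_coefU1 // big_mkcond => /sum_neq0[p].
case: ifP => [pB|]; last by rewrite eqxx.
rewrite mulf_eq0 negb_or => /andP[mpq]; rewrite mulf_eq0 negb_or => /andP[_].
case/IH => f [finj fA fm]; pose g x := if x == q then p else f x.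
have gA : {in A, g =1 f}.
  by move=> x xA; rewrite /g; case: eqP => // xq; rewrite -xq xA in qNA.
have gAim : g @: A = B :\ p by rewrite -fA; apply: eq_in_imset.
have gq : g q = p by rewrite /g eqxx.
exists g; split.
- move=> x y; rewrite !inE => /predU1P[->|xA] /predU1P[->|yA] //.
  + rewrite gq => pE; have : g y \in B :\ p by rewrite -gAim imset_f.
    by rewrite -pE !inE eqxx.
  + rewrite gq => pE; have : g x \in B :\ p by rewrite -gAim imset_f.
    by rewrite pE !inE eqxx.
  + by rewrite !gA //; apply: finj.
- by rewrite imsetU1 gAim gq setD1K.
- move=> x; rewrite !inE => /predU1P[->|xA]; first by rewrite gq.
  by rewrite gA //; apply: fm.
Qed.

Lemma act_card M (A B : {set I}) :
  act M (ext_basis A) B != 0 :> F -> #|A| = #|B|.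
Proof. by case/act_support => f [finj <- _]; rewrite card_in_imset. Qed.

(** The edges selected in the sense of [act_support] form A again, so they have
    the same total h as A; as h cannot increase, every edge selects itself. *)
Lemma act_diag_coef M (h : I -> nat) (A : {set I}) :
  (forall p q, minor2 M p q != 0 -> p != q -> (h p < h q)%N) ->
  act M (ext_basis A) A = \prod_(q in A) minor2 M q q :> F.
Proof.
move=> hM; have hM' p q : minor2 M p q != 0 -> (h p <= h q)%N.
  by have [->//|pq] := eqVneq p q; move=> m; apply/ltnW/hM.
elim/set_min_ind: A => [|q A qA IH].
  by rewrite ext_basis0 (act1 actP) ffunE eqxx big_set0.
have qNA : q \notin A by apply/negP => /qA; rewrite ltnn.
rewrite act_coefU1 // big_setU1 //= big1 => [|p pA]; last first.
  have pq : p != q by apply: contraNneq qNA => <-.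
  apply/eqP/negPn/negP; rewrite mulf_eq0 negb_or => /andP[mpq].
  rewrite mulf_eq0 negb_or => /andP[_ /act_support[f [finj fA fm]]].
  have : (\sum_(x in (q |: A) :\ p) h x <= \sum_(x in A) h x)%N.
    rewrite -fA big_imset //=; apply: leq_sum => x xA; exact/hM'/fm.
  have : (\sum_(x in q |: A) h x = h q + \sum_(x in A) h x)%N by rewrite big_setU1.
  rewrite (big_setD1 p) /=; last by rewrite setU1r.
  by have := hM p q mpq pq; rewrite /=; lia.
rewrite addr0 big_setU1 //= setU1K // IH; congr (_ * _).
rewrite fsignU1 // ltnn mul1r fsignE big1 ?mul1r // => b /qA qb.
by rewrite ltnNge ltnW.
Qed.

Lemma upper_minor2 M p q : upper_mx M -> minor2 M p q != 0 ->
  ((ed p).1 <= (ed q).1)%N /\ ((ed p).2 <= (ed q).2)%N.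
Proof.
case: edP => _ lt _; have := lt p; have := lt q.
rewrite /minor2; case: (ed p) => a b; case: (ed q) => c d /= cd ab UM.
have [ac|ca] := leqP a c; have [bd|db] := leqP b d => //.
- by rewrite (UM b d) // (UM b c) ?mulr0 ?mul0r ?subrr ?eqxx //; lia.
- by rewrite (UM a c) // (UM b c) ?mulr0 ?mul0r ?subrr ?eqxx //; lia.
- by rewrite (UM a c) // (UM b c) ?mulr0 ?mul0r ?subrr ?eqxx //; lia.
Qed.

Lemma lower_minor2 M p q : upper_mx M^T -> minor2 M p q != 0 ->
  ((ed q).1 <= (ed p).1)%N /\ ((ed q).2 <= (ed p).2)%N.
Proof.
move=> UM; have -> : minor2 M p q = minor2 M^T q p.
  by rewrite /minor2 !mxE; congr (_ - _); rewrite mulrC.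
exact: upper_minor2.
Qed.

Lemma upper_minor2_diag M q : upper_mx M ->
  minor2 M q q = M (ed q).1 (ed q).1 * M (ed q).2 (ed q).2.
Proof.
case: edP => _ lt _ UM; rewrite /minor2 (UM _ _ (lt q)) mul0r subr0.
by [].
Qed.

Lemma edge_sum_lt p q : ((ed p).1 <= (ed q).1)%N -> ((ed p).2 <= (ed q).2)%N ->
  p != q -> ((ed p).1 + (ed p).2 < (ed q).1 + (ed q).2)%N.
Proof.
case: edP => inj _ _ l1 l2; apply: contraNT; rewrite -leqNgt => l3.
apply/eqP/inj; rewrite [ed p]surjective_pairing [ed q]surjective_pairing.
by congr pair; apply: val_inj => /=; lia.
Qed.

Lemma ext_basis_coef (A B : {set I}) : ext_basis A B = (B == A)%:R :> F.
Proof. by rewrite ffunE. Qed.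

(** An upper triangular matrix maps every edge to a combination of edges below it.
    All of these lie in A, and distinct edges must select distinct ones, so only
    A itself is reached: e_A is a highest weight vector. *)
Lemma act_upper_shifted M (A : {set I}) : upper_mx M -> shifted (adj ed A) ->
  act M (ext_basis A) =
  (\prod_(q in A) (M (ed q).1 (ed q).1 * M (ed q).2 (ed q).2)) *: ext_basis A.
Proof.
move=> UM shA; apply: ext_eqP => B; rewrite ext_scaleE ext_basis_coef.
have [->|nBA] := eqVneq B A.
  rewrite mulr1 (@act_diag_coef M (fun q => (ed q).1 + (ed q).2)%N).
    by apply: eq_bigr => q _; apply: upper_minor2_diag.
  by move=> p q /(upper_minor2 UM)[l1 l2]; apply: edge_sum_lt.
rewrite mulr0; apply/eqP; apply: contraNT nBA => nz.
have cAB := act_card nz; case/act_support: nz => f [finj fA fm].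
rewrite eqEcard -cAB leqnn andbT -fA; apply/subsetP => _ /imsetP[q qA ->].
by have [l1 l2] := upper_minor2 UM (fm q qA); apply: shifted_closed l1 l2.
Qed.

(** Dually, a lower triangular matrix raises edges, so that e_A can only reach a
    down-set B if it equals A. *)
Lemma act_lower_coef M (A B : {set I}) : upper_mx M^T -> shifted (adj ed B) ->
  act M (ext_basis A) B = (A == B)%:R *
    \prod_(q in A) (M (ed q).1 (ed q).1 * M (ed q).2 (ed q).2) :> F.
Proof.
move=> UM shB; have [<-|nBA] := eqVneq A B.
  rewrite mul1r (@act_diag_coef M (fun q => n + n - ((ed q).1 + (ed q).2))%N).
    apply: eq_bigr => q _; have := upper_minor2_diag q UM; rewrite /minor2 !mxE.
    by rewrite [X in _ - X]mulrC.
  move=> p q /(lower_minor2 UM)[l1 l2]; rewrite eq_sym => /(edge_sum_lt l1 l2) l3.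
  have := ltn_ord (ed p).1; have := ltn_ord (ed p).2; lia.
rewrite mul0r; apply/eqP; apply: contraNT nBA => nz.
have cAB := act_card nz; case/act_support: nz => f [finj fA fm].
rewrite eqEcard cAB leqnn andbT; apply/subsetP => q qA.
have [l1 l2] := lower_minor2 UM (fm q qA); apply: shifted_closed l1 l2 => //.
by rewrite -fA imset_f.
Qed.

Lemma prod_edges (x : 'I_n -> F) (A : {set I}) :
  \prod_(q in A) (x (ed q).1 * x (ed q).2) = \prod_i x i ^+ degree (adj ed A) i.
Proof.
under [RHS]eq_bigr do rewrite (degree_adj edP) -prodrXr.
rewrite [RHS]exchange_big /=; apply: eq_bigr => q _.
case: edP => _ lt _; have nab : (ed q).2 != (ed q).1.
  by rewrite -val_eqE /= neq_ltn lt orbT.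
rewrite [RHS](bigD1 (ed q).1) //= [X in _ = _ * X](bigD1 (ed q).2) //=.
rewrite /incident !eqxx orbT !expr1 [X in _ = _ * (_ * X)]big1 ?mulr1 //.
move=> i /andP[i1 i2]; rewrite [_ == i]eq_sym (negPf i1) [_ == i]eq_sym.
by rewrite (negPf i2).
Qed.

Lemma act_LU_coef (L M : 'M[F]_n) (A B : {set I}) :
  upper_mx L^T -> upper_mx M -> shifted (adj ed A) -> shifted (adj ed B) ->
  act (L *m M) (ext_basis A) B =
  (A == B)%:R * \prod_i (L i i * M i i) ^+ degree (adj ed A) i :> F.
Proof.
move=> LL UM shA shB; case: (actP) => _ _ ->.
rewrite comp_lfunE act_upper_shifted // linearZ ext_scaleE act_lower_coef //.
rewrite mulrCA -prod_edges -big_split; congr (_ * _).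
by apply: eq_bigr => q _ /=; ring.
Qed.

End TriangularAction.

(** * Gaussian moments and Hermite polynomials *)

Section HermiteNumbers.

(** T a r is the coefficient of the r-th Hermite polynomial He_r in x^a; the
    recursion is x He_r = He_(r+1) + r He_(r-1). *)
Fixpoint hermite_coef (a r : nat) : nat :=
  if a is a'.+1 then
    ((if r is r'.+1 then hermite_coef a' r' else 0) +
     r.+1 * hermite_coef a' r.+1)%N
  else (r == 0%N).

Local Notation T := hermite_coef.

(** The moments of the standard normal law, as its Hermite polynomials of positive
    degree have mean 0. *)
Definition moment (a : nat) : nat := T a 0.

Lemma hermite_coef_gt a r : (a < r)%N -> T a r = 0%N.
Proof.
elim: a r => [|a IH] [|r] //= ar.
by rewrite !IH ?muln0 //; lia.
Qed.

(** He_r has derivative r He_(r-1), so this compares the coefficients of the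
    derivative of x^m. *)
Lemma hermite_coef_derive m r : (r.+1 * T m r.+1 = m * T m.-1 r)%N.
Proof.
elim: m r => [|m IH] r; first by rewrite muln0.
have step : T m.+1 r.+1 = (T m r + m * T m.-1 r.+1)%N by rewrite -IH.
rewrite {}step /= -/(T m.+1 _); case: m IH => [|m] IH.
  by rewrite !mul0n !addn0; case: r => [|r]; rewrite ?mul1n ?muln0.
case: r => [|r]; first by rewrite mul1n /= !add0n !mul1n -mulSn.
have IHr : (r.+1 * T m.+1 r.+1 = m.+1 * T m r)%N by rewrite IH.
rewrite [m.+1.-1]/= mulnDr [(r.+2 * T _ _)%N]mulSn IHr.
have -> : T m.+1 r.+1 = (T m r + r.+2 * T m r.+2)%N by [].
ring.
Qed.

Lemma moment_rec m : moment m.+2 = (m.+1 * moment m)%N.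
Proof. by rewrite -hermite_coef_derive. Qed.

(** Orthogonality of the Hermite polynomials, He_r having square norm r!, applied
    to x^a and x^b. Multiplication by x is self-adjoint for this scalar product,
    so that factors x can be moved from x^a to x^b. *)
Lemma moment_add N a b : (a + b < N)%N ->
  moment (a + b) = (\sum_(r < N) r`! * (T a r * T b r))%N.
Proof.
have shift c d : (c < N)%N -> (d < N)%N ->
   (\sum_(r < N) r`! * (T c.+1 r * T d r) =
    \sum_(r < N) r`! * (T c r * T d.+1 r))%N.
  case: N => [//|N] cN dN.
  pose X u v := (\sum_(r < N) r.+1`! * (T u r * T v r.+1))%N.
  suff main u v : (u < N.+1)%N ->
      (\sum_(r < N.+1) r`! * (T u.+1 r * T v r) = X u v + X v u)%N.
    rewrite main // addnC -main //; apply: eq_bigr => r _.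
    by rewrite [(T d.+1 _ * _)%N]mulnC.
  move=> uN.
  transitivity (\sum_(r < N.+1) r`! * ((if r : nat is r'.+1 then T u r' else 0) * T v r)
     + \sum_(r < N.+1) r.+1`! * (T u r.+1 * T v r))%N.
    rewrite -big_split; apply: eq_bigr => r _ /=; rewrite factS mulnDl mulnDr.
    congr addn; ring.
  congr addn.
    by rewrite big_ord_recl /= mul0n muln0 add0n.
  rewrite big_ord_recr /= hermite_coef_gt // mul0n muln0 addn0.
  by apply: eq_bigr => r _; rewrite [(T u _ * _)%N]mulnC.
elim: a b => [|a IH] b abN.
  case: N abN {shift} => // N _; rewrite big_ord_recl /= !mul1n big1 ?addn0 //.
  by move=> r _; rewrite mul0n muln0.
by rewrite addSnnS IH -?addSnnS // -shift //; lia.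
Qed.

Variable R : comNzRingType.

(** Two consecutive values are carried along, since the recurrence has order 2. *)
Fixpoint hermite_pair (x : R) (r : nat) : R * R :=
  if r is r'.+1 then
    let: (h0, h1) := hermite_pair x r' in (h1, x * h1 - r'.+1%:R * h0)
  else (1, x).

Definition hermite x r : R := (hermite_pair x r).1.

Lemma hermite_mul x r : x * hermite x r = hermite x r.+1 + r%:R * hermite x r.-1.
Proof.
case: r => [|r]; rewrite /hermite /=; first by rewrite mulr1 mul0r addr0.
by case: (hermite_pair x r) => h0 h1 /=; rewrite addrNK.
Qed.

Lemma expr_hermite x a N : (a < N)%N ->
  x ^+ a = \sum_(r < N) (T a r)%:R * hermite x r.
Proof.
elim: a => [|a IH] aN.
  case: N aN => // N _; rewrite big_ord_recl /= mul1r big1 ?addr0 //.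
  by move=> r _; rewrite mul0r.
rewrite exprS IH ?(ltnW aN) // mulr_sumr.
case: N aN {IH} => // N aN.
transitivity (\sum_(r < N.+1) (T a r)%:R * hermite x r.+1 +
  \sum_(r < N.+1) (r * T a r)%:R * hermite x r.-1).
  rewrite -big_split; apply: eq_bigr => r _ /=.
  by rewrite mulrCA hermite_mul mulrDr natrM mulrA [(T a r)%:R * r%:R]mulrC.
rewrite big_ord_recr /= hermite_coef_gt // mul0r addr0.
rewrite [X in _ + X]big_ord_recl /= mul0n mul0r add0r.
transitivity (\sum_(r < N.+1) (if r : nat is r'.+1 then T a r' else 0)%:R * hermite x r +
   \sum_(r < N.+1) (r.+1 * T a r.+1)%:R * hermite x r).
  congr (_ + _); first by rewrite [RHS]big_ord_recl /= mul0r add0r.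
  by rewrite [RHS]big_ord_recr /= hermite_coef_gt ?muln0 ?mul0r ?addr0 //; lia.
by rewrite -big_split; apply: eq_bigr => r _ /=; rewrite natrD mulrDl.
Qed.

End HermiteNumbers.

(** * Gaussian integrals of polynomials *)

Section GaussianCubature.
Variables (F : numFieldType) (J : finType).
Local Notation T := hermite_coef.

(** The weights at the nodes 0, ..., D solve a Vandermonde system; they need not be
    positive. *)
Lemma cubature_exists (D : nat) : exists om : 'I_D.+1 -> F,
  forall a, (a <= D)%N -> \sum_k om k * (k : nat)%:R ^+ a = (moment a)%:R.
Proof.
pose V := Vandermonde D.+1 (\row_(k < D.+1) (k : nat)%:R) : 'M[F]_D.+1.
have unitV : V \in unitmx.
  rewrite unitmxE det_Vandermonde unitfE; apply/prodf_neq0 => i _.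
  apply/prodf_neq0 => j ij; rewrite !mxE subr_eq0 eqr_nat.
  by rewrite eq_sym ltn_eqF.
pose c := invmx V *m (\col_(a < D.+1) (moment a)%:R).
exists (fun k => c k 0) => a aD.
have /matrixP/(_ (inord a) 0) : V *m c = \col_(b < D.+1) (moment b)%:R.
  by rewrite /c mulKVmx.
rewrite !mxE inordK // => <-; apply: eq_bigr => k _.
by rewrite !mxE inordK // mulrC.
Qed.

Variables (D : nat) (om : 'I_D.+1 -> F).
Hypothesis omE : forall a, (a <= D)%N ->
  \sum_k om k * (k : nat)%:R ^+ a = (moment a)%:R.

Definition node (X : {ffun J -> 'I_D.+1}) : J -> F := fun j => (X j : nat)%:R.

Definition weight (X : {ffun J -> 'I_D.+1}) : F := \prod_j om (X j).

(** The integral for the product of standard normal laws, exact on monomials of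
    degree at most D ([gauss_monomial]). *)
Definition gauss (f : (J -> F) -> F) : F := \sum_X weight X * f (node X).

(** Polynomials are handled as combinations of words in the variables: a product of
    linear forms expands into words without collecting equal factors. *)
Definition monomial (s : seq J) (x : J -> F) : F := \prod_(j <- s) x j.

Definition word_moment (s : seq J) : F := \prod_j (moment (count_mem j s))%:R.

Definition peval (l : seq (F * seq J)) (x : J -> F) : F :=
  \sum_(m <- l) m.1 * monomial m.2 x.

Lemma gauss_ext f g : f =1 g -> gauss f = gauss g.
Proof. by move=> fg; apply: eq_bigr => X _; rewrite fg. Qed.

Lemma gaussD f g : gauss (fun x => f x + g x) = gauss f + gauss g.
Proof. by rewrite -big_split; apply: eq_bigr => X _; rewrite mulrDr. Qed.

Lemma gaussZ c f : gauss (fun x => c * f x) = c * gauss f.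
Proof. by rewrite mulr_sumr; apply: eq_bigr => X _; rewrite mulrCA. Qed.

Lemma gauss_sum (K : Type) (r : seq K) (P : pred K) f :
  gauss (fun x => \sum_(k <- r | P k) f k x) = \sum_(k <- r | P k) gauss (f k).
Proof.
by rewrite exchange_big; apply: eq_bigr => X _; rewrite mulr_sumr.
Qed.

Lemma monomial_count s x : monomial s x = \prod_j x j ^+ count_mem j s.
Proof.
elim: s => [|i s IH]; first by rewrite /monomial big_nil big1.
rewrite /monomial big_cons -/(monomial s x) IH.
under [RHS]eq_bigr => j _ do rewrite /= exprD.
rewrite big_split /=; congr (_ * _).
rewrite (bigD1 i) //= eqxx expr1 big1 ?mulr1 // => j /negPf ji.
by rewrite eq_sym ji expr0.
Qed.

Lemma gauss_monomial s : (size s <= D)%N -> gauss (monomial s) = word_moment s.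
Proof.
move=> sD; rewrite /gauss /weight /word_moment.
transitivity (\sum_(X : {ffun J -> 'I_D.+1})
    \prod_j (om (X j) * (X j : nat)%:R ^+ count_mem j s)).
  by apply: eq_bigr => X _; rewrite monomial_count -big_split.
rewrite -(bigA_distr_bigA (fun j (k : 'I_D.+1) => om k * (k : nat)%:R ^+ count_mem j s)).
apply: eq_bigr => j _; apply: omE; apply: leq_trans sD.
exact: count_size.
Qed.

Definition linform (l : J -> F) (x : J -> F) : F := \sum_j l j * x j.
Definition dot (l m : J -> F) : F := \sum_j l j * m j.
Definition delta (j : J) : J -> F := fun i => (j == i)%:R.
Definition prodform (ls : seq (J -> F)) (x : J -> F) : F :=
  \prod_(l <- ls) linform l x.
(** The derivative of [prodform ls] in the direction l, expanded by the product
    rule. *)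
Fixpoint dirder (l : J -> F) (ls : seq (J -> F)) (x : J -> F) : F :=
  if ls is m :: ls' then dot l m * prodform ls' x + linform m x * dirder l ls' x
  else 0.

Lemma linform_delta j x : linform (delta j) x = x j.
Proof.
rewrite /linform (bigD1 j) //= /delta eqxx mul1r big1 ?addr0 // => i /negPf ij.
by rewrite eq_sym ij mul0r.
Qed.

Lemma dot_deltal j m : dot (delta j) m = m j.
Proof.
rewrite /dot (bigD1 j) //= /delta eqxx mul1r big1 ?addr0 // => i /negPf ij.
by rewrite eq_sym ij mul0r.
Qed.

Lemma prodform_delta s x : prodform (map delta s) x = monomial s x.
Proof. by rewrite /prodform big_map; apply: eq_bigr => j _; apply: linform_delta. Qed.

Lemma prodform_cons l ls x : prodform (l :: ls) x = linform l x * prodform ls x.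
Proof. exact: big_cons. Qed.

Lemma prodform_nil x : prodform [::] x = 1.
Proof. exact: big_nil. Qed.

Lemma prodform_cat ls1 ls2 x :
  prodform (ls1 ++ ls2) x = prodform ls1 x * prodform ls2 x.
Proof. exact: big_cat. Qed.

Lemma dirder_deltas j s x : dirder (delta j) (map delta s) x =
  (count_mem j s)%:R * monomial (rem j s) x.
Proof.
elim: s => [|i s IH] /=; first by rewrite mul0r.
rewrite IH dot_deltal linform_delta prodform_delta [delta i j]/(_%:R).
have [->|ij] := eqVneq i j; last first.
  by rewrite mul0r !add0r /monomial big_cons mulrCA.
rewrite mul1r add1n mulrS mulrDl mul1r; congr (_ + _); rewrite mulrCA.
have [js|jNs] := boolP (j \in s).
  by rewrite /monomial (perm_big _ (perm_to_rem js)) big_cons.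
by rewrite (count_memPn jNs) !mul0r.
Qed.

(** Integration by parts for a monomial: the derivative of x^m is m x^(m-1), and the
    moments satisfy the recursion [moment_rec]. *)
Lemma word_moment_cons j s : word_moment (j :: s) =
  (count_mem j s)%:R * word_moment (rem j s).
Proof.
rewrite /word_moment (bigD1 j) //= [in RHS](bigD1 j) //= eqxx add1n.
have [js|jNs] := boolP (j \in s); last first.
  by rewrite (count_memPn jNs) !mul0r.
have cs : (count_mem j s = (count_mem j (rem j s)).+1)%N.
  by have /permP->/= := perm_to_rem js; rewrite eqxx.
rewrite cs moment_rec natrM -mulrA; congr (_ * (_ * _)).
apply: eq_bigr => i /negPf ij; rewrite eq_sym ij add0n.
by have /permP->/= := perm_to_rem js; rewrite eq_sym ij.
Qed.

Lemma dirder_linear_slot l A m B x : dirder l (A ++ m :: B) x =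
  \sum_i m i * dirder l (A ++ delta i :: B) x.
Proof.
elim: A => [|a A IH] /=.
  under eq_bigr do rewrite mulrDr.
  rewrite big_split /=; congr (_ + _).
    rewrite /dot mulr_suml; apply: eq_bigr => i _.
    rewrite mulrA; congr (_ * _); rewrite mulrC; congr (_ * _).
    rewrite (bigD1 i) //= /delta eqxx mulr1 big1 ?addr0 // => k /negPf ki.
    by rewrite eq_sym ki mulr0.
  by rewrite /linform mulr_suml; apply: eq_bigr => i _; rewrite -/(linform _ _)
    linform_delta mulrA.
under eq_bigr do rewrite mulrDr.
rewrite big_split /= IH; congr (_ + _).
  rewrite prodform_cat prodform_cons /linform mulr_suml !mulr_sumr.
  apply: eq_bigr => i _; rewrite prodform_cat prodform_cons linform_delta.
  ring.
by rewrite mulr_sumr; apply: eq_bigr => i _; rewrite mulrCA.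
Qed.

Lemma dirder_linear l ls x :
  dirder l ls x = \sum_j l j * dirder (delta j) ls x.
Proof.
elim: ls => [|m ls IH] /=; first by rewrite big1 // => j _; rewrite mulr0.
under eq_bigr do rewrite mulrDr.
rewrite big_split /= IH mulr_sumr; congr (_ + _).
  by rewrite /dot mulr_suml; apply: eq_bigr => j _; rewrite -/(dot _ _) dot_deltal mulrA.
by apply: eq_bigr => j _; rewrite mulrCA.
Qed.

(** Both sides are linear in l and in each form of ls, hence it is enough to treat
    coordinate functions, which is [word_moment_cons]. *)
Lemma gauss_by_parts l ls : (size ls < D)%N ->
  gauss (fun x => linform l x * prodform ls x) = gauss (dirder l ls).
Proof.
move=> lsD.
(* The forms are replaced by coordinates one after the other; s lists those
   already replaced. *)
suff main j s ls' : (size s + size ls' < D)%N ->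
    gauss (fun x => x j * prodform (map delta s ++ ls') x) =
    gauss (dirder (delta j) (map delta s ++ ls')).
  rewrite (gauss_ext (g := fun x => \sum_j l j * (x j * prodform ls x))); last first.
    by move=> x; rewrite /linform mulr_suml; apply: eq_bigr => j _; rewrite mulrA.
  rewrite (gauss_ext (dirder_linear l ls)) !gauss_sum; apply: eq_bigr => j _.
  by rewrite !gaussZ (main j [::] ls).
elim: ls' s => [|m ls' IH] s sD.
  rewrite cats0 (gauss_ext (dirder_deltas j s)) gaussZ.
  rewrite (gauss_ext (g := monomial (j :: s))) => [|x]; last first.
    by rewrite prodform_delta /monomial big_cons.
  have rD : (size (rem j s) <= size s)%N by apply: size_subseq (rem_subseq _ _).
  move: sD; rewrite addn0 => sD.
  by rewrite !gauss_monomial ?word_moment_cons // (leq_trans rD) // ltnW.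
rewrite (gauss_ext (dirder_linear_slot _ _ m _)).
rewrite (gauss_ext (g := fun x => \sum_i m i *
  (x j * prodform (map delta s ++ delta i :: ls') x))); last first.
  move=> x; rewrite prodform_cat prodform_cons /linform mulr_suml !mulr_sumr.
  apply: eq_bigr => i _; rewrite prodform_cat prodform_cons linform_delta.
  ring.
rewrite !gauss_sum; apply: eq_bigr => i _; rewrite !gaussZ; congr (_ * _).
rewrite -cat_rcons -map_rcons IH // size_rcons; move: sD => /=; lia.
Qed.

(** Integration by parts trades two of the forms for their scalar product, so by
    induction the integral is a polynomial in the scalar products (Wick's
    formula). *)
Lemma gauss_gram (K : Type) (g h : K -> J -> F) s :
  (forall a b, dot (g a) (g b) = dot (h a) (h b)) -> (size s <= D)%N ->
  gauss (prodform (map g s)) = gauss (prodform (map h s)).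
Proof.
move=> gh; have [m] := ubnP (size s); elim: m s => // m IH [|a s] /= sm sD.
  by rewrite /=.
rewrite (gauss_ext (prodform_cons (g a) _)) (gauss_ext (prodform_cons (h a) _)).
rewrite !gauss_by_parts ?size_map //.
(* The derivative is expanded factor by factor; s0 lists the forms it has passed,
   and t those it has still to reach. *)
suff main s0 t : (size s0 + size t <= size s)%N ->
    gauss (fun x => prodform (map g s0) x * dirder (g a) (map g t) x) =
    gauss (fun x => prodform (map h s0) x * dirder (h a) (map h t) x).
  have := main [::] s (leqnn _).
  have one f : gauss (fun x => prodform [::] x * f x) = gauss f.
    by apply: gauss_ext => x; rewrite /prodform big_nil mul1r.
  by rewrite /= !one.
elim: t s0 => [|b t IHt] s0 st.
  by apply: gauss_ext => x; rewrite /= !mulr0.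
have split_gauss (f : K -> J -> F) :
    gauss (fun x => prodform (map f s0) x * dirder (f a) (map f (b :: t)) x) =
    dot (f a) (f b) * gauss (prodform (map f (s0 ++ t))) +
    gauss (fun x => prodform (map f (rcons s0 b)) x * dirder (f a) (map f t) x).
  rewrite -gaussZ -gaussD; apply: gauss_ext => x /=.
  rewrite map_cat prodform_cat map_rcons -cats1 prodform_cat prodform_cons.
  rewrite prodform_nil; ring.
rewrite !split_gauss gh IH ?IHt // ?size_rcons ?size_cat //=.
all: by move: st sm sD => /=; lia.
Qed.

Definition hermite_coord (l : seq (F * seq J)) (r : {ffun J -> 'I_D.+1}) : F :=
  \sum_(m <- l) m.1 * \prod_j (T (count_mem j m.2) (r j))%:R.

Lemma word_moment_cat s t : (size s + size t <= D)%N ->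
  word_moment (s ++ t) = \sum_(r : {ffun J -> 'I_D.+1})
    (\prod_j ((r j)`!)%:R) * ((\prod_j (T (count_mem j s) (r j))%:R) *
                            (\prod_j (T (count_mem j t) (r j))%:R)).
Proof.
move=> stD; transitivity (\prod_j \sum_(r < D.+1)
    ((r`!)%:R * ((T (count_mem j s) r)%:R * (T (count_mem j t) r)%:R)) : F).
  apply: eq_bigr => j _; rewrite count_cat (@moment_add D.+1); last first.
    by rewrite ltnS (leq_trans _ stD) // leq_add ?count_size.
  by rewrite natr_sum; apply: eq_bigr => r _; rewrite !natrM.
rewrite bigA_distr_bigA; apply: eq_bigr => r _.
by rewrite !big_split.
Qed.

(** Parseval's formula for the orthogonal basis of products of Hermite
    polynomials. *)
Lemma gauss_sqr l : all (fun m => size m.2 * 2 <= D)%N l ->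
  gauss (fun x => peval l x * peval l x) =
  \sum_(r : {ffun J -> 'I_D.+1}) (\prod_j ((r j)`!)%:R) * hermite_coord l r ^+ 2.
Proof.
move=> lD; transitivity (\sum_(m <- l) \sum_(k <- l)
    (m.1 * k.1) * word_moment (m.2 ++ k.2)).
  rewrite (gauss_ext (g := fun x => \sum_(m <- l) \sum_(k <- l)
      (m.1 * k.1) * monomial (m.2 ++ k.2) x)) => [|x]; last first.
    rewrite /peval mulr_suml; apply: eq_bigr => m _; rewrite mulr_sumr.
    by apply: eq_bigr => k _; rewrite /monomial big_cat mulrACA.
  rewrite gauss_sum [LHS]big_seq [RHS]big_seq; apply: eq_bigr => m ml.
  rewrite gauss_sum [LHS]big_seq [RHS]big_seq; apply: eq_bigr => k kl.
  rewrite gaussZ gauss_monomial // size_cat.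
  by have := allP lD m ml; have := allP lD k kl; rewrite /=; lia.
transitivity (\sum_(m <- l) \sum_(k <- l) \sum_(r : {ffun J -> 'I_D.+1})
    (\prod_j ((r j)`!)%:R) * ((m.1 * \prod_j (T (count_mem j m.2) (r j))%:R) *
                            (k.1 * \prod_j (T (count_mem j k.2) (r j))%:R))).
  rewrite [LHS]big_seq [RHS]big_seq; apply: eq_bigr => m ml.
  rewrite [LHS]big_seq [RHS]big_seq; apply: eq_bigr => k kl.
  rewrite word_moment_cat; last first.
    by have := allP lD m ml; have := allP lD k kl; rewrite /=; lia.
  rewrite mulr_sumr; apply: eq_bigr => r _; ring.
under eq_bigr do rewrite exchange_big /=.
rewrite exchange_big; apply: eq_bigr => r _ /=.
rewrite expr2 /hermite_coord mulr_suml mulr_sumr; apply: eq_bigr => m _.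
by rewrite !mulr_sumr.
Qed.

Lemma peval_hermite l x : all (fun m => size m.2 <= D)%N l ->
  peval l x = \sum_(r : {ffun J -> 'I_D.+1})
    (\prod_j hermite (x j) (r j)) * hermite_coord l r.
Proof.
move=> lD; transitivity (\sum_(m <- l) \sum_(r : {ffun J -> 'I_D.+1})
    (\prod_j hermite (x j) (r j)) *
    (m.1 * \prod_j (T (count_mem j m.2) (r j))%:R)).
  rewrite /peval [LHS]big_seq [RHS]big_seq; apply: eq_bigr => m ml.
  transitivity (m.1 * \prod_j \sum_(r < D.+1)
      ((T (count_mem j m.2) r)%:R * hermite (x j) r)).
    rewrite monomial_count; congr (_ * _); apply: eq_bigr => j _.
    apply: expr_hermite; rewrite ltnS (leq_trans (count_size _ _)) //.
    by have := allP lD m ml.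
  rewrite bigA_distr_bigA mulr_sumr; apply: eq_bigr => r _.
  rewrite big_split /=; ring.
by rewrite exchange_big; apply: eq_bigr => r _; rewrite -mulr_sumr.
Qed.

(** The Hermite coordinates are real, so if the sum of their weighted squares
    vanishes, they all do, and so does the polynomial. *)
Lemma gauss_sqr_neq0 l : all (fun m => m.1 \is Num.real) l ->
  all (fun m => size m.2 * 2 <= D)%N l ->
  (exists x, peval l x != 0) -> gauss (fun x => peval l x * peval l x) != 0.
Proof.
move=> lR lD [x]; apply: contraNneq; rewrite gauss_sqr // => /eqP.
rewrite psumr_eq0 => [/allP r0|r _]; last first.
  apply: mulr_ge0; first by apply: prodr_ge0 => j _; apply: ler0n.
  rewrite real_exprn_even_ge0 // /hermite_coord big_seq rpred_sum // => m ml.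
  rewrite rpredM //; first exact: (allP lR m ml).
  by apply: rpred_prod => j _; apply: realn.
rewrite (peval_hermite x); last first.
  by apply: sub_all lD => m; rewrite /=; lia.
apply/eqP/big1 => r _; have := r0 r (mem_index_enum r).
rewrite /= mulf_eq0 expf_eq0 /= => /orP[|/eqP->]; last by rewrite mulr0.
by rewrite prodf_seq_eq0 => /hasP[j _]; rewrite pnatr_eq0 -leqn0 leqNgt fact_gt0.
Qed.

End GaussianCubature.

(** * Polynomial functions and LU decomposition *)

Section PolynomialFunctions.
Variables (F : numFieldType) (J : finType).

(** S restricts the coefficients; the two cases of interest are all of F and the
    real elements. *)
Definition polyfun (S : pred F) (f : (J -> F) -> F) :=
  exists2 l, all (fun m => S m.1) l & f =1 peval l.

Variable S : pred F.
Hypotheses (S1 : S 1) (SM : forall a b, S a -> S b -> S (a * b)).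

Lemma polyfun_ext f g : f =1 g -> polyfun S f -> polyfun S g.
Proof. by move=> fg [l Sl fE]; exists l => // x; rewrite -fg. Qed.

Lemma polyfun_const c : S c -> polyfun S (fun=> c).
Proof.
move=> Sc; exists [:: (c, [::])]; rewrite /= ?Sc // => x.
by rewrite /peval big_seq1 /monomial big_nil mulr1.
Qed.

Lemma polyfun_var j : polyfun S (fun x => x j).
Proof.
exists [:: (1, [:: j])]; rewrite /= ?S1 // => x.
by rewrite /peval big_seq1 /monomial big_seq1 mul1r.
Qed.

Lemma polyfunD f g : polyfun S f -> polyfun S g -> polyfun S (fun x => f x + g x).
Proof.
move=> [l Sl fE] [k Sk gE]; exists (l ++ k); first by rewrite all_cat Sl.
by move=> x; rewrite /peval big_cat fE gE.
Qed.

Lemma polyfunM f g : polyfun S f -> polyfun S g -> polyfun S (fun x => f x * g x).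
Proof.
move=> [l Sl fE] [k Sk gE].
exists [seq (m.1 * u.1, m.2 ++ u.2) | m <- l, u <- k].
  apply/allP => _ /allpairsP[[m u] [/= ml uk ->]] /=.
  by apply: SM; [apply: (allP Sl) | apply: (allP Sk)].
move=> x; rewrite fE gE /peval big_allpairs_dep mulr_suml; apply: eq_bigr => m _.
rewrite mulr_sumr; apply: eq_bigr => u _.
by rewrite /monomial big_cat mulrACA.
Qed.

Lemma polyfun_sum (K : Type) (r : seq K) (P : pred K) f : S 0 ->
  (forall k, polyfun S (f k)) -> polyfun S (fun x => \sum_(k <- r | P k) f k x).
Proof.
move=> S0 pf; elim: r => [|k r IH].
  apply: (@polyfun_ext (fun=> 0)) (polyfun_const S0) => x.
  by rewrite big_nil.
case Pk: (P k).
  apply: (@polyfun_ext (fun x => f k x + \sum_(k <- r | P k) f k x)) => [x|].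
    by rewrite big_cons Pk.
  exact: polyfunD.
by apply: polyfun_ext IH => x; rewrite big_cons Pk.
Qed.

Lemma polyfun_prod (K : Type) (r : seq K) (P : pred K) f :
  (forall k, polyfun S (f k)) -> polyfun S (fun x => \prod_(k <- r | P k) f k x).
Proof.
move=> pf; elim: r => [|k r IH].
  apply: (@polyfun_ext (fun=> 1)) (polyfun_const S1) => x.
  by rewrite big_nil.
case Pk: (P k).
  apply: (@polyfun_ext (fun x => f k x * \prod_(k <- r | P k) f k x)) => [x|].
    by rewrite big_cons Pk.
  exact: polyfunM.
by apply: polyfun_ext IH => x; rewrite big_cons Pk.
Qed.

Lemma polyfun_exp f m : polyfun S f -> polyfun S (fun x => f x ^+ m).
Proof.
move=> pf; elim: m => [|m IH].
  by apply: polyfun_ext (polyfun_const S1) => x; rewrite expr0.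
apply: (@polyfun_ext (fun x => f x * f x ^+ m)) => [x|]; first by rewrite exprS.
exact: polyfunM.
Qed.

Lemma polyfun_det (n : nat) (M : (J -> F) -> 'M[F]_n) : S 0 -> S (-1) ->
  (forall i j, polyfun S (fun x => M x i j)) -> polyfun S (fun x => \det (M x)).
Proof.
move=> S0 SN1 pM; rewrite /determinant; apply: polyfun_sum => // s.
apply: polyfunM; last by apply: polyfun_prod => i; apply: pM.
apply: polyfun_exp; exact: polyfun_const.
Qed.

End PolynomialFunctions.

Section Density.
Variables (F : numFieldType) (J : finType).
Local Notation pol := (polyfun (J := J) (predT : pred F)).

Lemma polyfun_eq f x y : pol f -> x =1 y -> f x = f y.
Proof.
move=> [l _ fE] xy; rewrite !fE; apply: eq_bigr => m _; congr (_ * _).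
by apply: eq_bigr => j _; apply: xy.
Qed.

Lemma polyfun_line f (x0 x : J -> F) : pol f ->
  exists P : {poly F}, forall t, f (fun j => x0 j + t * (x j - x0 j)) = P.[t].
Proof.
move=> [l _ fE].
exists (\sum_(m <- l) m.1 *: \prod_(j <- m.2) ((x0 j)%:P + (x j - x0 j)%:P * 'X)).
move=> t; rewrite fE horner_sum; apply: eq_bigr => m _; rewrite hornerZ.
congr (_ * _); rewrite horner_prod; apply: eq_bigr => j _.
by rewrite hornerD hornerM !hornerC hornerX mulrC.
Qed.

(** On the line through x0 and x the functions become polynomials in one variable,
    where a product vanishes only if a factor does. *)
Lemma polyfun_density f g q (x0 : J -> F) : pol f -> pol g -> pol q ->
  q x0 != 0 -> (forall x, q x != 0 -> f x = g x) -> f =1 g.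
Proof.
move=> pf pg pq q0 fg x.
have [Pf fE] := polyfun_line x0 x pf; have [Pg gE] := polyfun_line x0 x pg.
have [Pq qE] := polyfun_line x0 x pq.
have : (Pf - Pg) * Pq = 0.
  apply: poly_nat_roots0 => k; rewrite hornerM hornerD hornerN -fE -gE -qE.
  set y := fun _ => _; have [->|/fg->] := eqVneq (q y) 0; first by rewrite mulr0.
  by rewrite subrr mul0r.
have /negPf Pq0 : Pq != 0.
  apply: contraNneq q0 => Pq0; have := qE 0; rewrite Pq0 horner0 => <-.
  by apply/eqP/(polyfun_eq pq) => j; rewrite mul0r addr0.
move=> /eqP; rewrite mulf_eq0 Pq0 orbF subr_eq0 => /eqP PP.
have line1 : (fun j => x0 j + 1 * (x j - x0 j)) =1 x by move=> j; ring.
by rewrite -(polyfun_eq pf line1) -(polyfun_eq pg line1) fE gE PP.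
Qed.

End Density.

Section LeadingMinors.
Variables (F : fieldType).

(** The leading r by r block, completed by an identity block: keeping the size n
    spares casts, and the determinant is the r-th leading minor. *)
Definition leading_mx n (r : nat) (X : 'M[F]_n) : 'M[F]_n :=
  \matrix_(i, j) if (i < r)%N && (j < r)%N then X i j else (i == j)%:R.

Definition leading_minor n r (X : 'M[F]_n) : F := \det (leading_mx r X).

(** Eliminating the first column passes to the Schur complement. *)
Lemma leading_minor_block n r (a : F) (b : 'rV[F]_n) (c : 'cV[F]_n) (d : 'M[F]_n) :
  a != 0 -> leading_minor r.+1 (block_mx a%:M b c d : 'M_(1 + n)) =
  a * leading_minor r (d - a^-1 *: (c *m b)).
Proof.
move=> a0; pose b' : 'rV[F]_n := \row_j if (j < r)%N then b 0 j else 0.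
pose c' : 'cV[F]_n := \col_i if (i < r)%N then c i 0 else 0.
set S := d - _.
have -> : leading_minor r.+1 (block_mx a%:M b c d : 'M_(1 + n)) =
    \det (block_mx 1%:M 0 (a^-1 *: c') 1%:M *m
          block_mx a%:M b' 0 (leading_mx r S) : 'M_(1 + n)).
  congr (\det _); rewrite mulmx_block !mul0mx !mul1mx !addr0.
  rewrite -!scalemxAl mul_mx_scalar scalerA mulVf // scale1r.
  apply/matrixP => i j; rewrite /leading_mx [LHS]mxE.
  case: (split_ordP i) => k ->; case: (split_ordP j) => l ->.
  - by rewrite !block_mxEul !ord1 /= !mxE.
  - by rewrite !block_mxEur !ord1 /= !mxE ltnS; case: ifP => //= _; rewrite -val_eqE.
  - by rewrite !block_mxEdl !ord1 /= !mxE ltnS andbT; case: ifP => //= _; rewrite -val_eqE.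
  rewrite !block_mxEdr /= /S !mxE !big_ord1 !mxE !ltnS.
  case: (k < r)%N; case: (l < r)%N; rewrite /= ?mul0r ?mulr0 ?mulr0 ?add0r.
  - by rewrite addrC subrK.
  1-3: by rewrite eq_rshift.
by rewrite det_mulmx det_lblock det_ublock !det1 !mul1r det_scalar1.
Qed.

Lemma leading_minor1 n r : leading_minor r (1%:M : 'M[F]_n) = 1.
Proof.
rewrite /leading_minor (_ : leading_mx r 1%:M = 1%:M) ?det1 //.
by apply/matrixP => i j; rewrite !mxE if_same.
Qed.

(** For a lower triangular L and an upper triangular M, the leading block of the
    product only involves the leading blocks of the factors. *)
Lemma leading_mxM n r (L M : 'M[F]_n) :
  upper_mx L^T -> upper_mx M ->
  leading_mx r (L *m M) = leading_mx r L *m leading_mx r M.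
Proof.
move=> LL UM; have LL' (i j : 'I_n) : (i < j)%N -> L i j = 0 by move/LL; rewrite mxE.
apply/matrixP => i j; rewrite !mxE; case: ifP => [/andP[ir jr]|nij].
  apply: eq_bigr => k _; rewrite !mxE ir jr andbT /=.
  case: ltnP => // kr; rewrite LL' ?mul0r; last exact: leq_trans kr.
  by rewrite [i == k](_ : _ = false) ?mul0r // -val_eqE /= ltn_eqF // (leq_trans ir).
have [ir|ir] := ltnP i r; last first.
  rewrite (bigD1 i) //= !mxE ltnNge ir /= eqxx mul1r big1 ?addr0 //.
  by move=> k /negPf ki; rewrite !mxE ltnNge ir /= eq_sym ki mul0r.
move: nij; rewrite ir /= => jr.
rewrite (bigD1 j) //= !mxE jr ir !andbF /= eqxx mulr1 big1 ?addr0 //.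
by move=> k /negPf kj; rewrite !mxE jr ir !andbF /= kj mulr0.
Qed.

Lemma leading_minor_LU n r (L M : 'M[F]_n) :
  upper_mx L^T -> upper_mx M ->
  leading_minor r (L *m M) = \prod_(i < n | (i < r)%N) (L i i * M i i).
Proof.
move=> LL UM; rewrite /leading_minor leading_mxM // det_mulmx big_split /=.
congr (_ * _); rewrite -?[\det (leading_mx r M)]det_tr det_trig.
- rewrite [RHS]big_mkcond; apply: eq_bigr => i _; rewrite mxE andbb eqxx.
  by case: ifP.
- apply/is_trig_mxP => i j ij; rewrite mxE; case: ifP => _.
    by have := LL j i ij; rewrite mxE.
  by rewrite -val_eqE /= ltn_eqF.
- rewrite [RHS]big_mkcond; apply: eq_bigr => i _; rewrite !mxE andbb eqxx.
  by case: ifP.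
- apply/is_trig_mxP => i j ij; rewrite !mxE; case: ifP => _.
    exact: UM.
  by rewrite -val_eqE /= gtn_eqF.
Qed.

(** Induction on n through the Schur complement of the first entry, whose leading
    minors are those of X divided by that entry. *)
Lemma LU_decomposition n (X : 'M[F]_n) :
  (forall r, (r <= n)%N -> leading_minor r X != 0) ->
  exists L M : 'M[F]_n,
    [/\ upper_mx L^T, upper_mx M & X = L *m M].
Proof.
elim: n X => [|n IH] X minors.
  by exists 0, 0; split=> [[]|[]|] //; apply/matrixP => -[].
pose a := X ord0 ord0.
pose Y : 'M[F]_(1 + n) := X.
have XE : Y = block_mx a%:M (ursubmx Y) (dlsubmx Y) (drsubmx Y).
  rewrite -[LHS]submxK; congr block_mx; apply/matrixP => i j.
  by rewrite !ord1 !mxE eqxx /a; congr (Y _ _); apply: val_inj.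
set b := ursubmx Y in XE; set c := dlsubmx Y in XE; set d := drsubmx Y in XE.
have minorE r : a != 0 -> leading_minor r.+1 X =
    a * leading_minor r (d - a^-1 *: (c *m b)).
  by move=> a0; rewrite -leading_minor_block // -XE.
have a0 : a != 0.
  have := minors 1%N isT; apply: contraNneq => a0.
  rewrite /leading_minor (expand_det_row _ ord0) big1 // => j _.
  rewrite mxE /=; case: (eqVneq ord0 j) => [<-|nj]; first by rewrite -/a a0 mul0r.
  by rewrite -(negbK (j < 1)%N) -leqNgt lt0n eq_sym nj mul0r.
have [r rn|L [M [LL UM SE]]] := IH (d - a^-1 *: (c *m b)).
  by have := minors r.+1 rn; rewrite minorE // mulf_eq0 (negPf a0).
exists (block_mx 1%:M 0 (a^-1 *: c) L : 'M_(1 + n)).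
exists (block_mx a%:M b 0 M : 'M_(1 + n)); split.
- move=> i j; rewrite mxE.
  case: (split_ordP (i : 'I_(1 + n))) => k ->; case: (split_ordP (j : 'I_(1 + n))) => l ->.
  + by rewrite !ord1.
  + by rewrite !ord1 ltn0.
  + by move=> _; apply: etrans (block_mxEur _ _ _ _ _ _) _; rewrite mxE.
  + move=> lk; apply: etrans (block_mxEdr _ _ _ _ _ _) _.
    by have := LL k l lk; rewrite mxE.
- move=> i j.
  case: (split_ordP (i : 'I_(1 + n))) => k ->; case: (split_ordP (j : 'I_(1 + n))) => l ->.
  + by rewrite !ord1.
  + by rewrite !ord1 ltn0.
  + by move=> _; apply: etrans (block_mxEdl _ _ _ _ _ _) _; rewrite mxE.
  + by move=> lk; apply: etrans (block_mxEdr _ _ _ _ _ _) _; apply: UM lk.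
have prod := mulmx_block (1%:M : 'M_1) 0 (a^-1 *: c) L a%:M b 0 M.
rewrite -[LHS]/Y XE; apply: etrans (esym prod).
rewrite !mul0mx !mul1mx !addr0 mul_mx_scalar.
rewrite scalerA divff // scale1r -SE -scalemxAl; congr block_mx.
  by rewrite mulmx0 addr0.
by rewrite addrC subrK.
Qed.

End LeadingMinors.

(** * Invariants as Gaussian averages *)

Section InvariantVector.
Variables (F : numFieldType) (U : vectType F) (n : nat).
Local Notation I := 'I_(\dim {:U}).
Local Notation E := (exterior U).
Variable ed : I -> 'I_n * 'I_n.
Hypothesis edP : edge_indexing ed.
Variable act : 'M[F]_n -> 'End(E).
Hypothesis actP : exterior_gl_action ed act.
Local Notation J := ('I_n * 'I_n)%type.
Local Notation realF := (fun a : F => a \is Num.real).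

Definition entries_mx (x : J -> F) : 'M[F]_n := \matrix_(i, j) x (i, j).

Lemma act_polyfun (A B : {set I}) :
  polyfun (predT : pred F) (fun x : J -> F => act (entries_mx x) (ext_basis A) B).
Proof.
elim/set_min_ind: A B => [|q A qA IH] B.
  apply: (@polyfun_ext _ _ _ (fun=> (B == set0)%:R)) => [x|]; last exact: polyfun_const.
  by rewrite ext_basis0 (act1 actP) ffunE.
apply: (@polyfun_ext _ _ _ (fun x => \sum_(p in B) minor2 ed (entries_mx x) p q *
    ((fsign p B : F) * act (entries_mx x) (ext_basis A) (B :\ p)))) => [x|].
  by rewrite (act_coefU1 actP).
apply: polyfun_sum => // p; apply: polyfunM => //; last first.
  by apply: polyfunM (IH _) => //; apply: polyfun_const.
have pv i j : polyfun predT (fun x : J -> F => entries_mx x i j).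
  apply: (@polyfun_ext _ _ _ (fun x => x (i, j))) => [x|]; first by rewrite mxE.
  exact: polyfun_var.
apply: (@polyfun_ext _ _ _ (fun x =>
  entries_mx x (ed p).1 (ed q).1 * entries_mx x (ed p).2 (ed q).2 +
  (-1) * (entries_mx x (ed p).2 (ed q).1 * entries_mx x (ed p).1 (ed q).2))) => [x|].
  by rewrite /minor2 mulN1r.
apply: polyfunD; first exact: polyfunM.
by apply: polyfunM; [| apply: polyfun_const | apply: polyfunM].
Qed.

Lemma leading_minor_polyfun r :
  polyfun realF (fun x : J -> F => leading_minor r (entries_mx x)).
Proof.
apply: polyfun_det => [||||i j].
- exact: real1.
- by move=> a b; apply: realM.
- exact: real0.
- by rewrite realN real1.
case ij: ((i < r)%N && (j < r)%N).
  apply: (@polyfun_ext _ _ _ (fun x => x (i, j))) => [x|]; first by rewrite !mxE ij.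
  by apply: polyfun_var; apply: real1.
apply: (@polyfun_ext _ _ _ (fun=> (i == j)%:R)) => [x|]; first by rewrite mxE ij.
by apply: polyfun_const; apply: realn.
Qed.

(** The degree sequence of A extended by 0, which makes the last exponent of
    [sqrt_weight] an instance of the general one. *)
Definition sorted_degree (A : {set I}) (r : nat) : nat :=
  if insub r is Some i then degree (adj ed A) i else 0%N.

(** The square root of the weight \prod_i (L_ii M_ii)^(deg i) of an LU product. By
    Abel summation the weight is the product over r of the r-th leading minor to
    the power deg r - deg (r + 1), and these exponents are even. *)
Definition sqrt_weight (A : {set I}) (x : J -> F) : F :=
  \prod_(r < n) leading_minor r.+1 (entries_mx x) ^+
     ((sorted_degree A r - sorted_degree A r.+1)./2).

Lemma sorted_degreeE A (i : 'I_n) : sorted_degree A i = degree (adj ed A) i.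
Proof. by rewrite /sorted_degree valK. Qed.

Lemma sorted_degree_ge A r : (n <= r)%N -> sorted_degree A r = 0%N.
Proof. by move=> nr; rewrite /sorted_degree insubN // -leqNgt. Qed.

Lemma shifted_degree (A : {set I}) (i j : 'I_n) : shifted (adj ed A) ->
  (i < j)%N -> (degree (adj ed A) j <= degree (adj ed A) i)%N.
Proof.
move=> sh ij; have nij : i != j by rewrite -val_eqE ltn_eqF.
rewrite /degree (bigD1 i) //= [X in (_ <= X)%N](bigD1 j) //=.
rewrite [adj ed A j i]adj_sym leq_add2l.
rewrite (bigD1 j) 1?eq_sym //= [X in (_ <= X)%N](bigD1 i) //=.
rewrite !(adj_irr edP) !add0n.
rewrite (eq_bigl (fun k => (k != j) && (k != i))) => [|k]; last by rewrite andbC.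
apply: leq_sum => k /andP[kj ki]; have := sh i j k ij ki.
by case: (adj ed A j k) => // ->.
Qed.

Lemma sorted_degreeS A r : shifted (adj ed A) ->
  (sorted_degree A r.+1 <= sorted_degree A r)%N.
Proof.
move=> sh; have [rn|nr] := ltnP r.+1 n; last by rewrite sorted_degree_ge.
have rn' := ltnW rn; rewrite -[r.+1]/(nat_of_ord (Ordinal rn)).
rewrite -[r in X in (_ <= X)%N]/(nat_of_ord (Ordinal rn')) !sorted_degreeE.
exact: shifted_degree.
Qed.

Lemma sorted_degree_even A r : even_degrees ed A -> ~~ odd (sorted_degree A r).
Proof.
by rewrite /sorted_degree => /forallP ev; case: insubP => // i _ _; apply: ev.
Qed.

Lemma sorted_degree_telescope A i : shifted (adj ed A) -> (i <= n)%N ->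
  (\sum_(i <= r < n) (sorted_degree A r - sorted_degree A r.+1) = sorted_degree A i)%N.
Proof.
move=> sh; have [m] := ubnP (n - i); elim: m i => // m IH i im.
rewrite leq_eqVlt => /predU1P[->|lin].
  by rewrite big_geq // sorted_degree_ge.
rewrite big_ltn // IH //; last by lia.
by rewrite subnK // sorted_degreeS.
Qed.

Lemma sqrt_weight_LU (A : {set I}) (L M : 'M[F]_n) (x : J -> F) :
  shifted (adj ed A) -> even_degrees ed A ->
  upper_mx L^T -> upper_mx M -> entries_mx x = L *m M ->
  sqrt_weight A x ^+ 2 = \prod_i (L i i * M i i) ^+ degree (adj ed A) i.
Proof.
move=> sh ev LL UM xE; rewrite /sqrt_weight -prodrXl.
transitivity (\prod_(r < n) \prod_(i < n | (i <= r)%N)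
    (L i i * M i i) ^+ (sorted_degree A r - sorted_degree A r.+1)).
  apply: eq_bigr => r _; rewrite -exprM xE leading_minor_LU // -prodrXl.
  rewrite muln2 halfK oddB ?sorted_degreeS //.
  by rewrite !(negPf (sorted_degree_even _ ev)) subn0.
rewrite (exchange_big_dep xpredT) //=; apply: eq_bigr => i _.
rewrite prodrXr; congr (_ ^+ _); rewrite -sorted_degreeE.
rewrite -(sorted_degree_telescope sh (ltnW (ltn_ord i))).
by rewrite big_geq_mkord.
Qed.

Lemma entries_mxE (X : 'M[F]_n) : entries_mx (fun j => X j.1 j.2) = X.
Proof. by apply/matrixP => i j; rewrite mxE. Qed.

Lemma polyfun_sub (S : pred F) (K : finType) (f : (K -> F) -> F) :
  polyfun S f -> polyfun predT f.
Proof. by case=> l _ fE; exists l => //; apply/allP. Qed.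

(** The two sides are polynomial in the entries and agree on the matrices that have
    an LU decomposition, by [act_LU_coef] and [sqrt_weight_LU]. *)
Lemma act_coef_square (A B : {set I}) (x : J -> F) :
  shifted (adj ed A) -> even_degrees ed A -> shifted (adj ed B) ->
  act (entries_mx x) (ext_basis A) B = (A == B)%:R * sqrt_weight A x ^+ 2 :> F.
Proof.
move=> shA ev shB; pose q (y : J -> F) := \prod_(r < n.+1) leading_minor r (entries_mx y).
have pm r : polyfun predT (fun y : J -> F => leading_minor r (entries_mx y)).
  exact: polyfun_sub (leading_minor_polyfun r).
have one_minor r : leading_minor r (entries_mx (fun j => (1%:M : 'M[F]_n) j.1 j.2)) = 1.
  by rewrite entries_mxE leading_minor1.
(* Where q is nonzero, all leading minors are, and an LU decomposition exists. *)
apply: (@polyfun_density _ _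
  (fun y => act (entries_mx y) (ext_basis A) B)
  (fun y => (A == B)%:R * sqrt_weight A y ^+ 2)
  q (fun j => (1%:M : 'M[F]_n) j.1 j.2)).
- exact: act_polyfun.
- apply: polyfunM => //; first exact: polyfun_const.
  by apply: polyfun_exp => //; apply: polyfun_prod => // r; apply: polyfun_exp.
- exact: polyfun_prod.
- by rewrite /q big1 ?oner_neq0 // => r _; rewrite one_minor.
move=> y /prodf_neq0 qy.
have [r rn|L [M [LL UM yE]]] := @LU_decomposition _ _ (entries_mx y).
  by have := qy (Ordinal (rn : (r < n.+1)%N)) isT.
by rewrite (sqrt_weight_LU shA ev LL UM yE) yE (act_LU_coef edP actP).
Qed.

(** The linear form on matrices x that gives the entry j of k x. *)
Definition row_form (k : 'M[F]_n) (j : J) : J -> F :=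
  fun i => k j.1 i.1 * (j.2 == i.2)%:R.

Lemma linform_row (k : 'M[F]_n) (j : J) (x : J -> F) :
  linform (row_form k j) x = (k *m entries_mx x) j.1 j.2.
Proof.
rewrite mxE /linform (eq_bigr (fun i : J => k j.1 i.1 * (j.2 == i.2)%:R * x (i.1, i.2))).
  rewrite -(pair_bigA _ (fun a b => k j.1 a * (j.2 == b)%:R * x (a, b))) /=.
  apply: eq_bigr => a _; rewrite mxE (bigD1 j.2) //= eqxx mulr1 big1 ?addr0 //.
  by move=> b /negPf bj; rewrite eq_sym bj mulr0 mul0r.
by move=> [a b] _.
Qed.

(** An orthogonal k permutes orthonormal systems of linear forms on matrices. *)
Lemma dot_row (k : 'M[F]_n) : orthogonal_mx k ->
  forall i j : J, dot (row_form k i) (row_form k j) = dot (delta F i) (delta F j).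
Proof.
move=> /mulmx1C ko [a b] [c d]; rewrite dot_deltal /delta /dot.
rewrite -(pair_bigA _ (fun u v => row_form k (a, b) (u, v) * row_form k (c, d) (u, v))) /=.
rewrite /row_form /=.
transitivity ((k *m k^T) c a * (d == b)%:R).
  rewrite mxE mulr_suml; apply: eq_bigr => u _.
  rewrite (bigD1 b) //= eqxx mulr1 big1 ?addr0 => [|v /negPf vb].
    by rewrite mxE; ring.
  by rewrite eq_sym vb mulr0 mul0r.
by rewrite ko mxE xpair_eqE -natrM mulnb.
Qed.

(** Rotation invariance of the Gaussian law, by [gauss_gram] and [dot_row]. *)
Lemma gauss_orthogonal D (om : 'I_D.+1 -> F) (k : 'M[F]_n) l :
  (forall a, (a <= D)%N -> \sum_i om i * (i : nat)%:R ^+ a = (moment a)%:R) ->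
  orthogonal_mx k -> all (fun m => size m.2 <= D)%N l ->
  gauss om (fun x : J -> F => peval l (fun j => (k *m entries_mx x) j.1 j.2)) =
  gauss om (peval l).
Proof.
move=> omE ko lD; rewrite !gauss_sum [LHS]big_seq [RHS]big_seq.
apply: eq_bigr => m ml; rewrite !gaussZ; congr (_ * _).
have mD : (size m.2 <= D)%N := allP lD m ml.
transitivity (gauss om (prodform (map (row_form k) m.2))).
  apply: gauss_ext => x; rewrite /prodform big_map /monomial.
  by apply: eq_bigr => j _; rewrite linform_row.
rewrite (gauss_gram omE (dot_row ko) mD).
by apply: gauss_ext => x; rewrite prodform_delta.
Qed.

(** w is the average of act X e_A over Gaussian matrices X. Rotation invariance of
    the Gaussian law makes it invariant; by [act_coef_square] its coefficients at
    shifted graphs are integrals of 0 or of the square of a nonzero polynomial. *)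
Theorem invariant_vector (A : {set I}) : shifted (adj ed A) -> even_degrees ed A ->
  exists w : E, [/\ forall g, orthogonal_mx g -> act g w = w,
    forall B : {set I}, #|B| != #|A| -> (w B : F) = 0 &
    forall B : {set I}, shifted (adj ed B) -> ((w B : F) != 0) = (B == A)].
Proof.
move=> shA ev.
have /fin_all_exists2[l _ lE] : forall B : {set I}, exists2 l, True &
    (fun x : J -> F => act (entries_mx x) (ext_basis A) B) =1 peval l.
  by move=> B; case: (act_polyfun A B) => l _ lE; exists l.
have [h hR hE] : polyfun realF (sqrt_weight A).
  apply: polyfun_prod => [||r]; [exact: real1|by move=> a b; apply: realM|].
  apply: polyfun_exp; [exact: real1|by move=> a b; apply: realM|].
  exact: leading_minor_polyfun.
(* D bounds the degrees of all polynomials to be integrated, which are the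
   coefficients l B and the square of h. *)
pose D := (\sum_(m <- h) size m.2 * 2 + \sum_(B : {set I}) \sum_(m <- l B) size m.2)%N.
have hD : all (fun m => size m.2 * 2 <= D)%N h.
  by apply/allP => m mh; rewrite /D (big_rem m) //= -addnA leq_addr.
have lD B : all (fun m => size m.2 <= D)%N (l B).
  apply/allP => m ml; rewrite /D (bigD1 B) //= [X in (_ + (X + _))%N](big_rem m) //=.
  by rewrite addnCA -!addnA leq_addr.
have [om omE] := cubature_exists F D.
pose w : E := \sum_(X : {ffun J -> 'I_D.+1})
  weight om X *: act (entries_mx (node F X)) (ext_basis A).
have wE B : w B = gauss om (peval (l B)) :> F.
  rewrite /w sum_ffunE; apply: eq_bigr => X _.
  by rewrite ext_scaleE -lE.
exists w; split.
- move=> g go; apply: ext_eqP => B; rewrite [RHS]wE -(gauss_orthogonal omE go (lD B)).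
  rewrite /w linear_sum sum_ffunE; apply: eq_bigr => X _.
  rewrite linearZ ext_scaleE -lE; congr (_ * _).
  case: (actP) => _ _ actM'; rewrite -[LHS]/((act g (act _ _)) B) -comp_lfunE -actM'.
  by rewrite entries_mxE.
- move=> B BA; rewrite /w sum_ffunE big1 // => X _; rewrite ext_scaleE.
  have [->|nz] := eqVneq (act (entries_mx (node F X)) (ext_basis A) B : F) 0.
    by rewrite mulr0.
  by rewrite (act_card actP nz) eqxx in BA.
move=> B shB; rewrite wE; have [->|nBA] := eqVneq B A; last first.
  rewrite (gauss_ext _ (g := fun=> 0)) => [|x].
    by rewrite /gauss big1 ?eqxx // => X _; rewrite mulr0.
  by rewrite -lE act_coef_square // eq_sym (negPf nBA) mul0r.
rewrite (gauss_ext _ (g := fun x => peval h x * peval h x)) => [|x]; last first.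
  by rewrite -lE act_coef_square // eqxx mul1r -hE expr2.
apply: (gauss_sqr_neq0 omE hR hD).
exists (fun j => (1%:M : 'M[F]_n) j.1 j.2); rewrite -hE /sqrt_weight.
apply/prodf_neq0 => r _; apply: expf_neq0.
by rewrite entries_mxE leading_minor1 oner_neq0.
Qed.

End InvariantVector.

(** * The dimension of the invariants *)

Section InvariantDimension.
Variables (F : numFieldType) (U : vectType F) (n : nat).
Local Notation I := 'I_(\dim {:U}).
Local Notation E := (exterior U).
Variable ed : I -> 'I_n * 'I_n.
Hypothesis edP : edge_indexing ed.
Variable act : 'M[F]_n -> 'End(E).
Hypothesis actP : exterior_gl_action ed act.

(** Changing the sign of the coordinate i multiplies e_B by (-1)^(deg i). *)
Lemma invariant_even (w : E) (B : {set I}) :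
  (forall g, orthogonal_mx g -> act g w = w) -> shifted (adj ed B) ->
  (w B : F) != 0 -> even_degrees ed B.
Proof.
move=> inv shB wB; apply/forallP => i.
pose g : 'M[F]_n := diag_mx (\row_j (-1) ^+ (j == i)).
have gd : upper_mx g^T.
  move=> a b ba; rewrite !mxE [b == a](_ : _ = false) ?mulr0n //.
  by rewrite -val_eqE /= ltn_eqF.
have go : orthogonal_mx g.
  rewrite /orthogonal_mx tr_diag_mx mulmx_diag; apply/matrixP => a b.
  by rewrite !mxE -expr2 sqrr_sign.
have /(congr1 (fun u : E => u B : F)) := inv g go.
rewrite {1}(ext_sum w) linear_sum sum_ffunE (bigD1 B) //= big1 ?addr0; last first.
  move=> A /negPf AB; rewrite linearZ ext_scaleE (act_lower_coef edP actP) //.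
  by rewrite AB mul0r mulr0.
rewrite linearZ ext_scaleE (act_lower_coef edP actP) // eqxx mul1r.
rewrite (prod_edges edP (fun a => g a a)) (bigD1 i) //= big1 => [|a /negPf ai].
  rewrite mulr1 !mxE !eqxx mulr1n expr1 => /eqP; apply: contraTN => odd_i.
  rewrite -signr_odd odd_i expr1 mulrN1 -subr_eq0 -opprD oppr_eq0.
  by rewrite -mulr2n mulrn_eq0.
by rewrite !mxE eqxx ai expr0 mulr1n expr1n.
Qed.

Lemma invariant_unique (w : E) k :
  (forall B : {set I}, #|B| != k -> (w B : F) = 0) ->
  (forall g, orthogonal_mx g -> act g w = w) ->
  (forall A : {set I}, shifted_even ed A && (#|A| == k) -> (w A : F) = 0) -> w = 0.
Proof.
move=> wk inv w0; apply/eqP/negPn/negP => nz.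
have [B wB shB] := so_invariant_coef edP (orthogonal_invariant_glE edP actP wk inv) nz.
have := wB; rewrite w0 ?eqxx //; apply/andP; split; last first.
  by apply: contraNT wB => /wk->.
by rewrite /shifted_even (invariant_even inv shB wB) andbT; apply/shiftedP.
Qed.

(** The invariants of [invariant_vector] are, up to nonzero factors, dual to the
    coefficients at shifted graphs with even degrees, and by [invariant_unique]
    these coefficients determine an invariant. *)
Lemma dim_invariants (X : {vspace E}) k :
  (forall w, w \in X <-> (forall B : {set I}, #|B| != k -> (w B : F) = 0) /\
                        (forall g, orthogonal_mx g -> act g w = w)) ->
  \dim X = #|[set A : {set I} | shifted_even ed A && (#|A| == k)]|.
Proof.
move=> XP; set S := [set A | _].
have /fin_all_exists[v vP] (A : {set I}) : exists w : E, A \in S ->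
    w \in X /\ forall B, B \in S -> ((w B : F) != 0) = (B == A).
  case: (boolP (A \in S)) => [|_]; last by exists 0.
  rewrite inE => /andP[/andP[/shiftedP shA evA] /eqP Ak].
  have [w [winv wk wB]] := invariant_vector edP actP shA evA.
  exists w => _; split; first by apply/XP; split=> // B; rewrite -Ak; apply: wk.
  by move=> B; rewrite inE => /andP[/andP[/shiftedP shB _] _]; apply: wB.
pose s := [tuple v (enum_val i) | i < #|S|].
have sE (i : 'I_#|S|) : s`_i = tnth s i by rewrite (tnth_nth 0).
have coef (c : 'I_#|S| -> F) (j : 'I_#|S|) :
    (\sum_i c i *: s`_i) (enum_val j) = c j * v (enum_val j) (enum_val j) :> F.
  rewrite sum_ffunE (bigD1 j) //= big1 ?addr0 => [|i ij].
    by rewrite ext_scaleE sE tnth_mktuple.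
  rewrite ext_scaleE sE tnth_mktuple.
  have [_ /(_ _ (enum_valP j))] := vP _ (enum_valP i).
  rewrite (inj_eq enum_val_inj) [j == i]eq_sym (negPf ij) => /negbFE/eqP->.
  by rewrite mulr0.
have vj (j : 'I_#|S|) : (v (enum_val j) (enum_val j) : F) != 0.
  by have [_ /(_ _ (enum_valP j))] := vP _ (enum_valP j); rewrite eqxx.
have free_s : free s.
  apply/freeP => c c0 j; have := coef c j; rewrite c0 ffunE => /esym/eqP.
  by rewrite mulf_eq0 (negPf (vj j)) orbF => /eqP.
suff -> : X = <<s>>%VS.
  by move: free_s; rewrite /free => /eqP->; rewrite size_tuple.
apply/eqP; rewrite eqEsubv; apply/andP; split; last first.
  apply/span_subvP => _ /tnthP[i ->]; rewrite tnth_mktuple.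
  by have [] := vP _ (enum_valP i).
apply/subvP => w wX.
pose c (i : 'I_#|S|) : F := w (enum_val i) / v (enum_val i) (enum_val i).
have sX : \sum_i c i *: s`_i \in X.
  rewrite rpred_sum // => i _; rewrite rpredZ // sE tnth_mktuple.
  by have [] := vP _ (enum_valP i).
have : w - \sum_i c i *: s`_i \in X by rewrite rpredB.
move/XP => [uk uinv].
suff /eqP : w - \sum_i c i *: s`_i = 0.
  rewrite subr_eq0 => /eqP->; rewrite rpred_sum // => i _.
  by rewrite rpredZ // memv_span // sE mem_tnth.
apply: (invariant_unique uk uinv) => A AS.
have AS' : A \in S by rewrite inE.
rewrite ext_addE ext_oppE -(enum_rankK_in AS' AS') coef /c mulfVK ?subrr //.
Qed.

End InvariantDimension.

(** * The standard basis of bivectors *)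

Section ExteriorPowers.
Variables (F : fieldType) (V : vectType F).
Local Notation I := 'I_(\dim {:V}).
Local Notation E := (exterior V).

Lemma ext_powP k (w : E) : w \in ext_pow V k <->
  (forall B : {set I}, #|B| != k -> (w B : F) = 0).
Proof.
rewrite ext_powE; split=> [/coord_span-> B Bk|wk].
  rewrite sum_ffunE big1 // => i _; rewrite ffunE.
  have /(mem_nth 0)/imageP[S /[!inE] /eqP Sk ->] : (i < size
    [seq (ext_basis A : E) | A in [pred A : {set I} | #|A| == k]])%N.
    by rewrite size_image.
  rewrite ffunE (_ : B == S = false) ?[_ *: _]mulr0 //.
  by apply: contraNF Bk => /eqP->; rewrite Sk.
rewrite (ext_sum w) rpred_sum // => A _.
have [Ak|/wk->] := eqVneq #|A| k; last by rewrite scale0r mem0v.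
by rewrite rpredZ // memv_span //; apply/imageP; exists A; rewrite ?inE ?Ak.
Qed.

Lemma free_ext_basis (Z : seq {set I}) :
  uniq Z -> free [seq (ext_basis A : E) | A <- Z].
Proof.
move=> uZ; apply/(@freeP _ _ _ (in_tuple _)) => c c0 i.
have iZ : (i < size Z)%N by rewrite (leq_trans (ltn_ord i)) // size_map.
have := congr1 (fun u : E => u (nth set0 Z i) : F) c0.
rewrite sum_ffunE (bigD1 i) //= big1 => [|j ji].
  rewrite (nth_map set0) // addr0 !ffunE eqxx => <-.
  by rewrite [_ *: _]mulr1.
have jZ : (j < size Z)%N by rewrite (leq_trans (ltn_ord j)) // size_map.
rewrite (nth_map set0) // !ffunE nth_uniq // eq_sym.
by rewrite (_ : _ == _ = false) ?[_ *: _]mulr0 //; apply: negbTE.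
Qed.

Lemma dim_ext_pow k : \dim (ext_pow V k) = 'C(\dim {:V}, k).
Proof.
rewrite ext_powE; set s := image _ _.
have -> : 'C(\dim {:V}, k) = size s.
  by rewrite size_image -[in LHS](card_ord (\dim {:V})) -card_draws cardsE.
apply/eqP; rewrite -[_ == _]/(free s); apply: free_ext_basis.
exact: enum_uniq.
Qed.

End ExteriorPowers.

Section EdgeEnumeration.
Variable n : nat.

Definition edge_set : {set 'I_n * 'I_n} := [set p : 'I_n * 'I_n | (p.1 < p.2)%N].

Lemma card_edge_set : #|edge_set| = 'C(n, 2).
Proof.
rewrite -bin2_sum big_mkord -sum1_card.
rewrite (eq_bigl (fun p : 'I_n * 'I_n => true && (p.1 < p.2)%N)) => [|p];
  last by rewrite inE.
rewrite -(pair_big_dep xpredT (fun i j : 'I_n => (i < j)%N) (fun _ _ => 1%N)) /=.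
rewrite (exchange_big_dep xpredT) //=; apply: eq_bigr => j _.
rewrite sum1_card -[RHS](card_ord j).
have winj : injective (widen_ord (ltnW (ltn_ord j))).
  by move=> x y /(congr1 val) /= /val_inj.
rewrite -(card_image winj).
apply: eq_card => i; apply/idP/imageP => [ij|[k _ ->]].
  by exists (Ordinal (ij : (i < j)%N)) => //; apply: val_inj.
by rewrite unfold_in; exact: (ltn_ord k).
Qed.

Lemma edge_enumeration N : N = 'C(n, 2) ->
  exists ed : 'I_N -> 'I_n * 'I_n, edge_indexing ed.
Proof.
move=> NE; have eN : N = #|edge_set| by rewrite card_edge_set.
exists (fun q => enum_val (cast_ord eN q)); split.
- by move=> p q /enum_val_inj/cast_ord_inj.
- by move=> q; have := enum_valP (cast_ord eN q); rewrite inE.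
move=> a b ab; have abE : (a, b) \in edge_set by rewrite inE.
exists (cast_ord (esym eN) (enum_rank_in abE (a, b))).
by rewrite cast_ordKV enum_rankK_in.
Qed.

End EdgeEnumeration.

Section ChangeOfBasis.
Variables (F : numFieldType) (n : nat).
Local Notation V := 'cV[F]_n.
Local Notation W := (ext2 F n).
Local Notation N := (\dim {:W}).

Definition std_basis (i : 'I_n) : V := delta_mx i 0.

(** The bivector e_i ^ e_j of the standard basis of V. *)
Definition wedge2 (i j : 'I_n) : W :=
  vsproj (ext_pow V 2) (ext_inj (std_basis i) * ext_inj (std_basis j)).

Lemma wedge2E i j :
  vsval (wedge2 i j) = ext_inj (std_basis i) * ext_inj (std_basis j).
Proof.
rewrite vsprojK // /ext_pow expvSl expv1 memv_mul //.
  by rewrite -[ext_inj _]lfunE memv_img ?memvf.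
by rewrite -[ext_inj _]lfunE memv_img ?memvf.
Qed.

Lemma wedge2N i j : wedge2 i j = - wedge2 j i.
Proof.
apply: subvs_inj; rewrite linearN /= !wedge2E.
apply: (alternating_anticomm (linearP (@ext_inj F V)) (@ext_inj_sq F V)).
Qed.

Lemma wedge2_diag i : wedge2 i i = 0.
Proof. by apply: subvs_inj; rewrite wedge2E ext_inj_sq linear0. Qed.

Lemma dim_ext2 : N = 'C(n, 2).
Proof.
rewrite dimvf -[RHS](congr1 (fun m => 'C(m, 2)) (_ : \dim {:V} = n)).
  exact: dim_ext_pow.
by rewrite dimvf /dim /= muln1.
Qed.

Lemma std_basis_sum (v : V) : v = \sum_i v i 0 *: std_basis i.
Proof.
apply/matrixP => i j; rewrite summxE (bigD1 i) //= big1 => [|k ki].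
  by rewrite !mxE !ord1 eqxx mulr1 addr0.
by rewrite !mxE eq_sym (negPf ki) mulr0.
Qed.

Variable ed : 'I_N -> 'I_n * 'I_n.
Hypothesis edP : edge_indexing ed.

Lemma wedge2_esgn a b :
  wedge2 a b = \sum_q esgn ed F q a b *: wedge2 (ed q).1 (ed q).2.
Proof.
have main (c d : 'I_n) : (c < d)%N ->
    wedge2 c d = \sum_q esgn ed F q c d *: wedge2 (ed q).1 (ed q).2.
  case: (edP) => _ _ surj /surj[q0 q0E].
  rewrite (bigD1 q0) //= big1 => [|q qq0].
    by have := esgn_ed edP F q0 q0; rewrite q0E eqxx /= => ->; rewrite scale1r addr0.
  have := esgn_ed edP F q q0; rewrite q0E (negPf qq0) /= => ->.
  by rewrite scale0r.
case: (ltngtP a b) => [|ba|/val_inj->]; first exact: main.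
  rewrite wedge2N main // -sumrN; apply: eq_bigr => q _.
  by rewrite [in RHS]esgnN scaleNr.
by rewrite wedge2_diag big1 // => q _; rewrite /esgn subrr scale0r.
Qed.

Definition wedge2_tuple : N.-tuple W := [tuple wedge2 (ed q).1 (ed q).2 | q < N].

Lemma wedge2_basis : basis_of {:W} wedge2_tuple.
Proof.
rewrite basisEdim size_tuple leqnn andbT; apply/subvP => u _.
have wS a b : wedge2 a b \in <<wedge2_tuple>>%VS.
  rewrite wedge2_esgn rpred_sum // => q _; rewrite rpredZ // memv_span //.
  by apply/tnthP; exists q; rewrite tnth_mktuple.
have sub : (ext_pow V 2 <= linfun (@vsval _ _ (ext_pow V 2)) @: <<wedge2_tuple>>)%VS.
  rewrite {1}/ext_pow expvSl expv1.
  apply/prodvP => _ _ /memv_imgP[x _ ->] /memv_imgP[y _ ->].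
  rewrite !lfunE /= (std_basis_sum x) (std_basis_sum y) !linear_sum mulr_suml.
  rewrite rpred_sum // => i _; rewrite mulr_sumr rpred_sum // => j _.
  rewrite !linearZ /= -scalerAl -scalerAr !rpredZ //.
  by rewrite -wedge2E -[vsval _]lfunE memv_img.
have /memv_imgP[z zS] := subvP sub _ (subvsP u).
by rewrite lfunE /= => /subvs_inj->.
Qed.

(** [vbasis] is an arbitrary basis of the space of bivectors. This change of basis
    sends it to the bivectors [wedge2], in which the action of matrices is
    explicit; [from_std] is its inverse. *)
Definition to_std (x : W) : W :=
  \sum_q coord (vbasis {:W}) q x *: wedge2 (ed q).1 (ed q).2.

Definition from_std (x : W) : W := \sum_q coord wedge2_tuple q x *: (vbasis {:W})`_q.

Fact to_std_linear : linear to_std.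
Proof.
move=> a u v; rewrite /to_std scaler_sumr -big_split; apply: eq_bigr => q _ /=.
by rewrite linearP scalerDl scalerA.
Qed.
HB.instance Definition _ := GRing.isLinear.Build F W W _ to_std to_std_linear.

Fact from_std_linear : linear from_std.
Proof.
move=> a u v; rewrite /from_std scaler_sumr -big_split; apply: eq_bigr => q _ /=.
by rewrite linearP scalerDl scalerA.
Qed.
HB.instance Definition _ := GRing.isLinear.Build F W W _ from_std from_std_linear.

Lemma wedge2_tupleE (q : 'I_N) : wedge2_tuple`_q = wedge2 (ed q).1 (ed q).2.
Proof. by rewrite -tnth_nth tnth_mktuple. Qed.

Lemma from_std_wedge2 q : from_std (wedge2 (ed q).1 (ed q).2) = (vbasis {:W})`_q.
Proof.
rewrite /from_std (bigD1 q) //= -wedge2_tupleE.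
rewrite coord_free ?(basis_free wedge2_basis) // eqxx scale1r big1 ?addr0 // => p pq.
by rewrite coord_free ?(basis_free wedge2_basis) // eq_sym (negPf pq) scale0r.
Qed.

Lemma to_std_vbasis (q : 'I_N) : to_std (vbasis {:W})`_q = wedge2 (ed q).1 (ed q).2.
Proof.
rewrite /to_std (bigD1 q) //=.
rewrite coord_free ?(basis_free (vbasisP _)) // eqxx scale1r big1 ?addr0 // => p pq.
by rewrite coord_free ?(basis_free (vbasisP _)) // eq_sym (negPf pq) scale0r.
Qed.

Lemma to_stdK x : from_std (to_std x) = x.
Proof.
rewrite {1}/to_std linear_sum [RHS](coord_vbasis (memvf x)); apply: eq_bigr => q _.
by rewrite linearZ /= from_std_wedge2.
Qed.

Lemma from_stdK x : to_std (from_std x) = x.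
Proof.
rewrite {1}/from_std linear_sum [RHS](coord_basis wedge2_basis (memvf x)).
by apply: eq_bigr => q _; rewrite linearZ /= to_std_vbasis wedge2_tupleE.
Qed.

(** The action in the coordinates of the standard bivectors. *)
Definition std_action (M : 'M[F]_n) : 'End(exterior W) :=
  (ext_map (linfun from_std) \o ext_ext2_act M \o ext_map (linfun to_std))%VF.

Lemma std_to_from :
  (ext_map (linfun to_std) \o ext_map (linfun from_std))%VF = \1%VF :> 'End(exterior W).
Proof.
rewrite -ext_map_comp -ext_map_id; congr ext_map; apply/lfunP => x.
by rewrite comp_lfunE !lfunE /= from_stdK.
Qed.

Lemma std_from_to :
  (ext_map (linfun from_std) \o ext_map (linfun to_std))%VF = \1%VF :> 'End(exterior W).
Proof.
rewrite -ext_map_comp -ext_map_id; congr ext_map; apply/lfunP => x.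
by rewrite comp_lfunE !lfunE /= to_stdK.
Qed.

Lemma ext_pow_map_wedge2 (M : 'M[F]_n) i j :
  ext_pow_map 2 (std_act M) (wedge2 i j) =
  \sum_a \sum_b (M a i * M b j) *: wedge2 a b.
Proof.
apply: subvs_inj; rewrite ext_pow_mapE wedge2E.
case: (ext_map_monoid (std_act M)) => _ ->; rewrite !ext_map_inj.
have actE k : std_act M (std_basis k) = \sum_a M a k *: std_basis a.
  rewrite lfunE /= [LHS]std_basis_sum; apply: eq_bigr => a _; congr (_ *: _).
  rewrite mxE (bigD1 k) //= big1 => [|b bk]; first by rewrite !mxE !eqxx mulr1 addr0.
  by rewrite !mxE (negPf bk) mulr0.
rewrite !actE !linear_sum mulr_suml; apply: eq_bigr => a _.
rewrite linear_sum mulr_sumr; apply: eq_bigr => b _.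
by rewrite !linearZ /= -scalerAl -scalerAr scalerA wedge2E.
Qed.

Lemma ext_pow_map_comp (M M' : 'M[F]_n) :
  ext_pow_map 2 (std_act (M *m M')) =
  (ext_pow_map 2 (std_act M) \o ext_pow_map 2 (std_act M'))%VF :> 'End(W).
Proof.
apply/lfunP => x; apply: subvs_inj.
rewrite (comp_lfunE (ext_pow_map 2 (std_act M)) (ext_pow_map 2 (std_act M')) x).
rewrite !ext_pow_mapE -comp_lfunE -ext_map_comp; congr (ext_map _ _); apply/lfunP => v.
by rewrite comp_lfunE !lfunE /= mulmxA.
Qed.

Lemma conj_lfun_comp (E : vectType F) (f g a b : 'End(E)) :
  (g \o f)%VF = \1%VF ->
  (f \o (a \o b) \o g)%VF = ((f \o a \o g) \o (f \o b \o g))%VF.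
Proof.
move=> gf; apply/lfunP => x; rewrite !comp_lfunE.
by have /lfunP/(_ (b (g x))) := gf; rewrite comp_lfunE id_lfunE => ->.
Qed.

Lemma std_actionP : exterior_gl_action ed std_action.
Proof.
split=> [M|M q|M M'].
- rewrite /std_action /ext_ext2_act -!ext_map_comp; exact: ext_map_monoid.
- rewrite /std_action /ext_ext2_act -!ext_map_comp -ext_inj_basis ext_map_inj.
  rewrite (comp_lfunE _ (linfun to_std)) (comp_lfunE _ (ext_pow_map 2 _)).
  rewrite [linfun to_std _]lfunE [linfun from_std _]lfunE /= to_std_vbasis.
  pose phi : {linear W -> exterior W} := @ext_inj F W \o from_std.
  rewrite ext_pow_map_wedge2 -[LHS]/(phi _) linear_sum; apply: eq_bigr => a _.
  rewrite linear_sum; apply: eq_bigr => b _; rewrite linearZ; congr (_ *: _).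
  rewrite wedge2_esgn linear_sum; apply: eq_bigr => p _; rewrite linearZ /=.
  by rewrite from_std_wedge2 ext_inj_basis.
rewrite /std_action /ext_ext2_act ext_pow_map_comp ext_map_comp.
exact: conj_lfun_comp std_to_from.
Qed.

Lemma dim_ext_ext2_invariants k :
  \dim (ext_pow W k :&: invariants (@ext_ext2_act F n) (@orthogonal_mx F n)) =
  #|[set A : {set 'I_N} | shifted_even ed A && (#|A| == k)]|.
Proof.
set X := (_ :&: _)%VS; pose f : 'End(exterior W) := ext_map (linfun from_std).
pose g : 'End(exterior W) := ext_map (linfun to_std).
have fg w : f (g w) = w.
  by have /lfunP/(_ w) := std_from_to; rewrite comp_lfunE id_lfunE.
have gf w : g (f w) = w.
  by have /lfunP/(_ w) := std_to_from; rewrite comp_lfunE id_lfunE.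
(* f transports the action on bivectors to [std_action]. *)
have -> : \dim X = \dim (f @: X).
  rewrite limg_dim_eq //; apply/eqP; rewrite -subv0; apply/subvP => w.
  rewrite memv_cap memv_ker => /andP[_ /eqP fw].
  by rewrite -(gf w) fw linear0 mem0v.
apply: (dim_invariants edP std_actionP) => w.
have -> : w \in (f @: X)%VS = (g w \in X).
  apply/idP/idP => [/memv_imgP[u uX ->]|gX]; first by rewrite gf.
  by rewrite -(fg w) memv_img.
rewrite memv_cap -ext_powP; split=> [/andP[gk /invariantsP ginv]|[wk winv]].
  split; first by rewrite -(fg w) ext_map_pow.
  by move=> h ho; rewrite /std_action !comp_lfunE -/g -/f ginv // fg.
apply/andP; split; first exact: ext_map_pow.
apply/invariantsP => h ho; rewrite -{2}(winv h ho) /std_action !comp_lfunE.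
exact/esym/gf.
Qed.

End ChangeOfBasis.

(** * Recursion for shifted graphs with degrees of given parity *)

Section ThresholdGraphs.
Variables (n N : nat) (ed : 'I_N -> 'I_n * 'I_n).
Hypothesis edP : edge_indexing ed.
Implicit Types (A B : {set 'I_N}) (p q : 'I_N) (lo hi : nat).

Definition in_window lo hi q : bool := (lo <= (ed q).1)%N && ((ed q).2 < hi)%N.

Definition edge_le p q : bool :=
  ((ed p).1 <= (ed q).1)%N && ((ed p).2 <= (ed q).2)%N.

Definition edge_degree A (i : 'I_n) : nat := (\sum_(q in A) incident ed q i)%N.

(** Shifted graphs on the vertices lo, ..., hi - 1 all of whose degrees have the
    parity e: the family that is stable under the deletion of the first or of the
    last vertex. *)
Definition window_graph (e : bool) lo hi A : bool :=
  [&& [forall q in A, in_window lo hi q],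
      [forall q in A, forall p, in_window lo hi p && edge_le p q ==> (p \in A)] &
      [forall i : 'I_n, (lo <= i < hi)%N ==> (odd (edge_degree A i) == e)]].

Lemma window_graphP e lo hi A : reflect
  [/\ forall q, q \in A -> in_window lo hi q,
      forall q p, q \in A -> in_window lo hi p -> edge_le p q -> p \in A &
      forall i : 'I_n, (lo <= i < hi)%N -> odd (edge_degree A i) = e]
  (window_graph e lo hi A).
Proof.
apply: (iffP and3P) => [[/forall_inP w /forall_inP cl /forallP d]|[w cl d]]; split=> //.
- move=> q p qA pw pq; have /forallP/(_ p) := cl q qA.
  by rewrite pw pq.
- by move=> i iw; have := d i; rewrite iw => /eqP.
- exact/forall_inP.
- apply/forall_inP => q qA; apply/forallP => p; apply/implyP => /andP[pw pq].
  exact: cl pq.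
- by apply/forallP => i; apply/implyP => iw; rewrite d.
Qed.

Definition star lo hi : {set 'I_N} :=
  [set q | (nat_of_ord (ed q).1 == lo) && ((ed q).2 < hi)%N].

Definition window_series e lo hi : {poly int} :=
  \sum_(A | window_graph e lo hi A) 'X^#|A|.

Lemma edge_degreeU A B i : [disjoint A & B] ->
  edge_degree (A :|: B) i = (edge_degree A i + edge_degree B i)%N.
Proof.
move=> dAB; rewrite /edge_degree (eq_bigl _ _ (fun x => in_setU x A B)).
by rewrite bigU.
Qed.

Lemma edge_degree_window lo hi A (i : 'I_n) :
  (forall q, q \in A -> in_window lo hi q) -> ~~ (lo <= i < hi)%N ->
  edge_degree A i = 0%N.
Proof.
case: edP => _ lt _ wA iw; apply: big1 => q /wA /andP[q1 q2].
apply/eqP; rewrite eqb0; apply: contra iw => /orP[]/eqP<-; have := lt q; lia.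
Qed.

Lemma sum_interval a b : (a <= b <= n)%N ->
  (\sum_(i < n) ((a <= i) && (i < b)) = b - a)%N.
Proof.
move=> /andP[ab bn]; rewrite -(big_mkord xpredT (fun i => (a <= i) && (i < b) : nat)%N).
rewrite (big_cat_nat (n := b)) //= [X in (_ + X)%N]big_nat_cond
  [X in (_ + X)%N]big1 ?addn0; last first.
  by move=> i /andP[/andP[bi _] _]; rewrite [(i < b)%N]ltnNge bi andbF.
rewrite (big_cat_nat (n := a)) //= [X in (X + _)%N]big_nat_cond
  [X in (X + _)%N]big1 ?add0n; last first.
  by move=> i /andP[/andP[_ ia] _]; rewrite leqNgt ia.
rewrite big_nat_cond (eq_bigr (fun=> 1%N)) => [|i /andP[/andP[-> ->]]//].
by rewrite -big_nat_cond sum_nat_const_nat muln1.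
Qed.

Lemma star_window lo hi q : q \in star lo hi -> in_window lo hi q.
Proof. by rewrite inE /in_window => /andP[/eqP-> ->]; rewrite leqnn. Qed.

Lemma star_degree lo hi (i : 'I_n) : (lo < i < hi)%N -> edge_degree (star lo hi) i = 1%N.
Proof.
move=> /andP[li ih]; case: edP => inj lt surj.
have ln : (lo < n)%N by apply: ltn_trans li (ltn_ord i).
have [q0 q0E] := surj (Ordinal ln) i li.
rewrite /edge_degree (bigD1 q0) /=; last by rewrite inE q0E /= eqxx ih.
rewrite big1 => [|q /andP[]]; first by rewrite /incident q0E eqxx orbT.
rewrite inE => /andP[/eqP q1 q2] qq0; apply/eqP; rewrite eqb0.
apply: contra qq0 => /orP[]/eqP qi; first by move: li; rewrite -q1 qi ltnn.
by apply/eqP/inj; rewrite q0E [ed q]surjective_pairing qi; congr pair; apply: val_inj.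
Qed.

Lemma star_center lo hi (i : 'I_n) : i = lo :> nat ->
  edge_degree (star lo hi) i = #|star lo hi|.
Proof.
move=> il; rewrite /edge_degree -sum1_card; apply: eq_bigr => q.
by rewrite inE /incident => /andP[/eqP q1 _]; rewrite -val_eqE /= q1 il eqxx.
Qed.

Lemma card_star lo hi : (lo < hi <= n)%N -> #|star lo hi| = (hi - lo).-1.
Proof.
move=> /andP[lh hn]; have ln : (lo < n)%N by apply: leq_trans lh hn.
have : (\sum_i edge_degree (star lo hi) i = #|star lo hi| * 2)%N.
  rewrite /edge_degree exchange_big /=.
  under eq_bigr do rewrite (sum_incident edP).
  by rewrite sum_nat_const.
rewrite (bigD1 (Ordinal ln)) //= star_center //.
rewrite (eq_bigr (fun i : 'I_n => ((lo.+1 <= i) && (i < hi))%N : nat)) => [|i ilo].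
  have := @sum_interval lo.+1 hi; rewrite lh hn => /(_ isT).
  rewrite (bigD1 (Ordinal ln)) //= ltnn /= add0n => ->.
  lia.
have [iw|iw] := boolP (lo < i < hi)%N; first exact: star_degree.
rewrite (edge_degree_window (@star_window lo hi)) //.
apply: contra iw => /andP[li ->]; rewrite andbT ltn_neqAle li andbT eq_sym.
by move: ilo; rewrite -val_eqE.
Qed.

(** The edge q0 joins the first vertex to the last one, hence lies below every edge
    at the last vertex: without q0 that vertex is isolated. *)
Lemma window_isolate e lo h A q0 : (lo < h)%N ->
  (nat_of_ord (ed q0).1 = lo) -> (nat_of_ord (ed q0).2 = h) ->
  window_graph e lo h.+1 A && (q0 \notin A) = ~~ e && window_graph e lo h A.
Proof.
move=> lh q01 q02; apply/andP/andP => [[/window_graphP[w cl d] q0A]|].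
  have w' q : q \in A -> in_window lo h q.
    move=> qA; have /andP[q1 q2] := w q qA; rewrite /in_window q1 /= ltn_neqAle.
    rewrite -ltnS q2 andbT; apply: contra q0A => /eqP q2h.
    apply: (cl q) => //; first by rewrite /in_window q01 q02 leqnn ltnSn.
    by rewrite /edge_le q01 q02 q1 q2h leqnn.
  have hn : (h < n)%N by rewrite -q02 ltn_ord.
  split.
    have := d (Ordinal hn); rewrite (edge_degree_window w') /= ?ltnn ?andbF //.
    by rewrite ltnSn ltnW // => <-.
  apply/window_graphP; split=> // [q p qA /andP[p1 p2] pq|i /andP[li ih]].
    by apply: (cl q) => //; rewrite /in_window p1 ltnW.
  by apply: d; rewrite li ltnW.
case=> e0 /window_graphP[w cl d]; split; last first.
  by apply/negP => /w; rewrite /in_window q01 q02 ltnn andbF.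
apply/window_graphP; split=> [q /w/andP[q1 q2]|q p qA /andP[p1 p2] pq|i /andP[li ih]].
- by rewrite /in_window q1 ltnW.
- apply: (cl q) => //; rewrite /in_window p1 /=; have /andP[_ q2] := w q qA.
  by case/andP: pq => _ /leq_ltn_trans; apply.
have [ih'|hi] := ltnP i h; first by apply: d; rewrite li.
by rewrite (edge_degree_window w) ?(negPf e0) // li /= -leqNgt.
Qed.

(** The edge q0 lies above every edge at the first vertex, hence its presence joins
    the first vertex to all others. Deleting the star of that vertex changes the
    parity of all other degrees, and the degree of the first vertex is h - lo. *)
Lemma window_dominate e lo h A' q0 : (lo < h < n)%N ->
  (nat_of_ord (ed q0).1 = lo) -> (nat_of_ord (ed q0).2 = h) ->
  [&& window_graph e lo h.+1 (star lo h.+1 :|: A'), q0 \in star lo h.+1 :|: A' &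
      (star lo h.+1 :|: A') :\: star lo h.+1 == A'] =
  (odd (h - lo) == e) && window_graph (~~ e) lo.+1 h.+1 A'.
Proof.
move=> /andP[lh hn] q01 q02; set S := star lo h.+1.
have cS : #|S| = (h - lo)%N by rewrite card_star ?ltnS ?(ltnW lh) //; lia.
have q0S : q0 \in S by rewrite inE q01 q02 eqxx ltnSn.
have ln : (lo < n)%N by apply: ltn_trans lh hn.
have dis : (S :|: A') :\: S == A' -> [disjoint S & A'].
  move=> /eqP<-; rewrite -setI_eq0; apply/eqP/setP => q; rewrite !inE.
  by case: (_ == _) => //=; case: (_ < _)%N; rewrite ?andbF.
apply/and3P/andP => [[/window_graphP[w cl d] _ eA']|[e1 /window_graphP[w cl d]]].
  have dSA := dis eA'.
  have A'S q : q \in A' -> q \notin S.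
    by move=> qA; rewrite disjoint_sym in dSA; apply/negbT; apply: (disjointFr dSA).
  have w' q : q \in A' -> in_window lo.+1 h.+1 q.
    move=> qA; have /andP[q1 q2] := w q (subsetP (subsetUr _ _) _ qA).
    rewrite /in_window q2 andbT ltn_neqAle q1 andbT eq_sym.
    by have := A'S q qA; rewrite inE q2 andbT.
  split.
    have := d (Ordinal ln); rewrite leqnn /= ltnS ltnW // => /(_ isT).
    rewrite edge_degreeU // star_center // cS (edge_degree_window w') ?ltnn //.
    by rewrite addn0 => ->.
  apply/window_graphP; split=> // [q p qA /andP[p1 p2] pq|i /andP[li ih]].
    have : p \in S :|: A'.
      apply: (cl q) => //; first by rewrite inE qA orbT.
      by rewrite /in_window p2 ltnW.
    by rewrite !inE gtn_eqF.
  have := d i; rewrite ih ltnW // => /(_ isT).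
  by rewrite edge_degreeU // star_degree ?li // add1n /= => <-; rewrite negbK.
have A'S q : q \in A' -> q \notin S.
  by move=> /w/andP[q1 _]; rewrite inE gtn_eqF.
have dSA : [disjoint S & A'].
  by rewrite disjoint_sym disjoint_subset; apply/subsetP => q /A'S.
split; last 2 first.
- by rewrite inE q0S.
- rewrite setDUl setDv set0U; apply/eqP/setDidPl.
  by rewrite disjoint_sym.
apply/window_graphP; split=> [q|q p|i /andP[li ih]].
- rewrite inE => /orP[/star_window//|/w/andP[q1 q2]].
  by rewrite /in_window q2 ltnW.
- rewrite inE => qSA /andP[p1 p2] /andP[pq1 pq2]; rewrite inE.
  have [pl|np] := eqVneq (nat_of_ord (ed p).1) lo; first by rewrite inE pl eqxx p2.
  have p1' : (lo < (ed p).1)%N by rewrite ltn_neqAle eq_sym np.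
  case/orP: qSA => [|qA]; first by rewrite inE => /andP[/eqP ql _]; lia.
  apply/orP; right; apply: (cl q) => //; last by rewrite /edge_le pq1.
  by rewrite /in_window p1'.
rewrite edge_degreeU //; have [il|nil_] := eqVneq (nat_of_ord i) lo.
  rewrite star_center // cS (edge_degree_window w) ?il ?ltnn // addn0.
  exact/eqP.
have li' : (lo < i)%N by rewrite ltn_neqAle eq_sym nil_.
by rewrite star_degree ?li' // add1n /= d ?negbK ?li'.
Qed.

Lemma window_series_rec e lo h : (lo < h < n)%N ->
  window_series e lo h.+1 = (if e then 0 else window_series e lo h) +
    (if odd (h - lo) == e then 'X^(h - lo) * window_series (~~ e) lo.+1 h.+1 else 0).
Proof.
move=> lhn; have /andP[lh hn] := lhn; have ln := ltn_trans lh hn.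
have [q0 q0E] : exists q, ed q = (Ordinal ln, Ordinal hn) by case: edP => _ _; apply.
have q01 : nat_of_ord (ed q0).1 = lo by rewrite q0E.
have q02 : nat_of_ord (ed q0).2 = h by rewrite q0E.
rewrite /window_series (bigID (fun A => q0 \in A)) /= addrC; congr (_ + _).
  rewrite (eq_bigl (fun A => ~~ e && window_graph e lo h A)) => [|A].
    by case: e => //=; rewrite big_pred0.
  exact: window_isolate.
set S := star lo h.+1.
(* The graphs containing q0 are those obtained by adding the star of lo to a graph
   on the other vertices. *)
rewrite (reindex_onto (fun A' => S :|: A') (fun A => A :\: S)) /=; last first.
  move=> A /andP[/window_graphP[w cl d] q0A].
  have SA : S \subset A.
    apply/subsetP => q; rewrite inE => /andP[/eqP q1 q2]; apply: (cl q0) => //.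
      by rewrite /in_window q1 leqnn q2.
    by rewrite /edge_le q1 q01 leqnn q02 -ltnS.
  by rewrite -{1}(setIidPr SA) setID.
rewrite (eq_bigl (fun A' => (odd (h - lo) == e) &&
    window_graph (~~ e) lo.+1 h.+1 A')) => [|A']; last first.
  by rewrite -(window_dominate _ _ lhn q01 q02) -andbA.
case: ifP => oe; last by rewrite big_pred0.
rewrite mulr_sumr; apply: eq_bigr => A' /window_graphP[w _ _].
have dSA : [disjoint S & A'].
  rewrite disjoint_sym disjoint_subset; apply/subsetP => q /w/andP[q1 _].
  by rewrite !inE gtn_eqF.
rewrite -exprD cardsU disjoint_setI0 // cards0 subn0 card_star; last by lia.
by congr ('X^(_ + _)); lia.
Qed.

End ThresholdGraphs.

(** * The series of shifted graphs with even degrees *)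

Section ShiftedEvenSeries.
Variables (n N : nat) (ed : 'I_N -> 'I_n * 'I_n).
Hypothesis edP : edge_indexing ed.
Implicit Types (A B : {set 'I_N}) (p q : 'I_N) (lo hi : nat).

Lemma window_series_small lo hi : (hi <= lo.+1)%N ->
  window_series ed false lo hi = 1.
Proof.
move=> hl; have w0 q : in_window ed lo hi q = false.
  by apply/negbTE/negP => /andP[q1 q2]; case: edP => _ /(_ q) lt _; lia.
rewrite /window_series (big_pred1 set0) ?cards0 ?expr0 // => A.
apply/idP/eqP => [/window_graphP[w _ _]|->].
  by apply/eqP; rewrite -subset0; apply/subsetP => q /w; rewrite w0.
apply/window_graphP; split=> [q|q p|i _]; rewrite ?inE //.
by rewrite /edge_degree big_set0.
Qed.

(** Applying [window_series_rec] twice: when all degrees are odd the last vertex is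
    not isolated, so a second dominating vertex must follow the first one. The two
    stars have h - lo and h - lo - 1 edges. *)
Lemma window_series_step lo h : (lo < h < n)%N ->
  window_series ed false lo h.+1 = window_series ed false lo h +
    (if ~~ odd (h - lo) then
       'X^(2 * (h - lo) - 1) * window_series ed false lo.+2 h.+1 else 0).
Proof.
move=> lhn; rewrite (window_series_rec edP) // eqbF_neg; congr (_ + _).
case: ifP => // ev; rewrite (window_series_rec edP) /=; last first.
  have [lh|] := eqVneq lo.+1 h; last by lia.
  by move: ev; rewrite -lh subSnn.
have odd_h : odd (h - lo.+1) = true.
  have : (h - lo = (h - lo.+1).+1)%N by lia.
  by move=> e; move: ev; rewrite e /= negbK.
rewrite odd_h add0r mulrA -exprD /=; congr ('X^_ * _); lia.
Qed.

(** Write f l for the series on l vertices. The recursion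
    f (l+3) = f (l+2) + [l even] X^(2l+3) f (l+1) and f (l+2) = f (l+1) for l even
    give the factor 1 + X^(2l+3) at every second step. *)
Lemma window_series_prod l lo : (lo + l <= n)%N ->
  window_series ed false lo (lo + l) =
  \prod_(i < (l.-1)./2) (1 + 'X^(4 * i + 3)).
Proof.
elim/ltn_ind: l lo => -[|[|l]] IH lo ln.
- by rewrite big_ord0 window_series_small //; lia.
- by rewrite big_ord0 window_series_small //; lia.
have e : (lo + l.+2 - lo.+1 = l.+1)%N by lia.
rewrite addnS window_series_step; last by lia.
rewrite IH //; last by lia.
rewrite addnC -addnBA // subnn addn0 /= negbK.
case: ifP => ol; last by rewrite addr0 uphalf_half ol.
have l0 : (0 < l)%N by case: l ol {IH ln e}.
have -> : (l.+1 + lo).+1 = (lo.+2 + l)%N by lia.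
rewrite IH //; last by lia.
rewrite uphalf_half ol add1n [RHS]big_ord_recr /=.
have -> : l./2 = (l.-1)./2.
  by case: l ol l0 {IH ln e} => //= l /negbTE; rewrite uphalf_half => ->.
rewrite [RHS]mulrC mulrDl mul1r; congr (_ + 'X^_ * _).
by have := odd_double_half l; rewrite ol; lia.
Qed.

Lemma closed_shifted A :
  (forall p q, q \in A -> ((ed p).1 <= (ed q).1)%N -> ((ed p).2 <= (ed q).2)%N ->
    p \in A) -> shifted (adj ed A).
Proof.
case: (edP) => _ _ surj cl.
have main (a b c d : 'I_n) : (a < b)%N -> (c < d)%N -> (a <= c)%N -> (b <= d)%N ->
    adj ed A c d -> adj ed A a b.
  move=> ab cd ac bd; have [p pE] := surj a b ab; have [q qE] := surj c d cd.
  have := adj_ed edP A p; have := adj_ed edP A q; rewrite pE qE /= => -> -> qA.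
  by apply: cl qA _ _; rewrite pE qE.
move=> i j k ij ki jk.
have kj : k != j by apply: contraTneq jk => ->; rewrite adj_irr.
move: ki kj; rewrite -!val_eqE /= => ki kj.
case: (ltngtP k i) ki => // ik _; last first.
  case: (ltngtP k j) kj => // jk' _; last by apply: main jk; lia.
  by move: jk; rewrite adj_sym; apply: main; lia.
rewrite adj_sym; move: jk; rewrite adj_sym; apply: main; lia.
Qed.

Lemma shifted_evenE A : shifted_even ed A = window_graph ed false 0 n A.
Proof.
apply/andP/window_graphP => [[/shiftedP sh /forallP ev]|[w cl d]]; split.
- by move=> q _; apply: ltn_ord.
- by move=> q p qA _ /andP[p1 p2]; apply: (shifted_closed edP sh qA).
- by move=> i _; apply/negbTE; rewrite /edge_degree -(degree_adj edP).
- apply/shiftedP/closed_shifted => p q qA p1 p2; apply: (cl q) => //.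
    exact: ltn_ord.
  by rewrite /edge_le p1.
by apply/forallP => i; rewrite (degree_adj edP) -/(edge_degree _ _ _) d ?ltn_ord.
Qed.

Lemma shifted_even_series :
  \sum_(A | shifted_even ed A) 'X^#|A| =
  \prod_(i < (n.-1)./2) (1 + 'X^(4 * i + 3)) :> {poly int}.
Proof.
rewrite -(@window_series_prod n 0) // add0n.
by apply: eq_bigl => A; apply: shifted_evenE.
Qed.

End ShiftedEvenSeries.

(** * The q-binomial expansion *)

Section QBinomial.

(** The q-binomial coefficient of M + k and k with q = X^4, as the series of the
    partitions with at most M parts, all at most k: c is the number of parts equal
    to k. *)
Fixpoint box_series (k M : nat) : {poly int} :=
  if k is k'.+1 then \sum_(c < M.+1) 'X^(4 * k * c) * box_series k' (M - c)
  else 1.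

Lemma box_seriesS k M : box_series k.+1 M =
  \sum_(c < M.+1) 'X^(4 * k.+1 * c) * box_series k (M - c).
Proof. by []. Qed.

Arguments box_series : simpl never.

(** Pascal's rule: either there is a part equal to k + 1 or there is none. *)
Lemma box_series_rec k M :
  box_series k.+1 M.+1 = 'X^(4 * k.+1) * box_series k.+1 M + box_series k M.+1.
Proof.
rewrite !box_seriesS big_ord_recl muln0 expr0 mul1r subn0 addrC; congr (_ + _).
rewrite mulr_sumr; apply: eq_bigr => c _; rewrite mulrA -exprD /= subSS.
by congr ('X^_ * _); rewrite /bump /=; lia.
Qed.

Lemma box_series0 k : box_series k 0 = 1.
Proof. by elim: k => // k IH; rewrite box_seriesS big_ord1 muln0 expr0 mul1r IH. Qed.

(** The degree of the product of the first k of the factors X^(4(s+i)+3). *)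
Definition min_degree (s k : nat) : nat := (k * (4 * s + 3) + 2 * (k * k.-1))%N.

(** The q-binomial theorem for q = X^4. The shift s makes the induction work, which
    splits off the first factor. *)
Lemma q_binomial N s :
  \prod_(i < N) (1 + 'X^(4 * (s + i) + 3) : {poly int}) =
  \sum_(k < N.+1) 'X^(min_degree s k) * box_series k (N - k).
Proof.
elim: N s => [|N IH] s.
  by rewrite big_ord0 big_ord1 /min_degree /= expr0 mul1r.
rewrite big_ord_recl addn0.
rewrite (eq_bigr (fun i : 'I_N => 1 + 'X^(4 * (s.+1 + i) + 3))); last first.
  by move=> i _; rewrite /bump /= addSnnS.
rewrite IH mulrDl mul1r mulr_sumr.
rewrite [X in X + _](big_ord_recl N) [X in _ + X]big_ord_recr /=.
rewrite [RHS]big_ord_recl [X in _ = _ + X]big_ord_recr /=.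
rewrite -addrA [X in _ + X]addrA; congr (_ + (_ + _)).
- rewrite -big_split; apply: eq_bigr => i _ /=.
  rewrite /bump leq0n add1n !subSS; have Ni : (N - i = (N - i.+1).+1)%N.
    by have := ltn_ord i; lia.
  rewrite Ni box_series_rec mulrDr !mulrA -!exprD.
  by congr ('X^_ * _ + 'X^_ * _); rewrite /min_degree; case: (nat_of_ord i) => [|j] /=; nia.
- rewrite /bump leq0n add1n !subnn !box_series0 !mulr1 -exprD; congr 'X^_.
  by rewrite /min_degree; case: N {IH} => [|N] /=; nia.
Qed.

Lemma sum_even_nat n (f : nat -> {poly int}) :
  \sum_(0 <= p < n | ~~ odd p) f p = \sum_(0 <= k < uphalf n) f k.*2.
Proof.
elim: n => [|n IH]; first by rewrite !big_geq.
rewrite big_mkcond big_nat_recr //= -big_mkcond IH.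
rewrite uphalf_half; case: (boolP (odd n)) => /= on.
  by rewrite addr0 add1n.
rewrite add0n big_nat_recr //=; congr (_ + f _).
by rewrite -[LHS]odd_double_half (negPf on).
Qed.

(** Halving the even entries identifies the tuples with the multiplicities of the
    parts of a partition in a box. The bound m < n makes every admissible entry
    an element of 'I_n. *)
Lemma sum_even_ffun n k m : (m < n)%N ->
  \sum_(a : {ffun 'I_k -> 'I_n} |
       [forall j, ~~ odd (a j)] && ((\sum_j a j)%N <= m)%N)
    ('X^(\sum_(j < k) (2 * (j + 1) * a j)%N) : {poly int}) = box_series k m./2.
Proof.
elim: k m => [|k IH] m mn.
  have a0 : forall a b : {ffun 'I_0 -> 'I_n}, a = b by move=> a b; apply/ffunP => -[].
  rewrite (big_pred1 [ffun=> Ordinal mn]) => [|a]; first by rewrite big_ord0 expr0.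
  rewrite [RHS](_ : _ = true); last by apply/eqP/a0.
  by rewrite big_ord0 leq0n andbT; apply/forallP => -[].
pose h (p : 'I_n * {ffun 'I_k -> 'I_n}) : {ffun 'I_k.+1 -> 'I_n} :=
  [ffun j => if unlift ord_max j is Some i then p.2 i else p.1].
have hmax p : h p ord_max = p.1 by rewrite ffunE unlift_none.
have hlift p i : h p (lift ord_max i) = p.2 i by rewrite ffunE liftK.
have wl (i : 'I_k) : widen_ord (leqnSn k) i = lift ord_max i.
  by apply: val_inj; rewrite /= /bump leqNgt ltn_ord.
have hbij : bijective h.
  exists (fun a : {ffun 'I_k.+1 -> 'I_n} =>
    (a ord_max, [ffun i : 'I_k => a (lift ord_max i)])) => [[c b]|a].
    by congr pair; [exact: hmax | apply/ffunP => i; rewrite ffunE hlift].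
  apply/ffunP => j; case: (unliftP ord_max j) => [i|] ->; rewrite ?hlift ?hmax //.
  by rewrite ffunE.
rewrite (reindex h (onW_bij _ hbij)) /=.
have condE c b : [forall j, ~~ odd (h (c, b) j)] && ((\sum_j h (c, b) j)%N <= m)%N =
    (~~ odd c && (c < m.+1)%N) &&
    ([forall j, ~~ odd (b j)] && ((\sum_j b j)%N <= m - c)%N).
  rewrite big_ord_recr /= hmax.
  under eq_bigr do rewrite wl hlift.
  have -> : [forall j, ~~ odd (h (c, b) j)] = ~~ odd c && [forall j, ~~ odd (b j)].
    apply/forallP/andP => [ev|[oc /forallP ev] j].
      split; first by have := ev ord_max; rewrite hmax.
      by apply/forallP => i; have := ev (lift ord_max i); rewrite hlift.
    by case: (unliftP ord_max j) => [i|] ->; rewrite ?hlift ?hmax.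
  rewrite ltnS -!andbA; congr andb; rewrite andbCA; congr andb => /=.
  set s := (\sum_(i < k) _)%N; lia.
rewrite (eq_bigl (fun p : 'I_n * {ffun 'I_k -> 'I_n} => (~~ odd p.1 && (p.1 < m.+1)%N) &&
    ([forall j, ~~ odd (p.2 j)] && ((\sum_j p.2 j)%N <= m - p.1)%N))) => [|[c b]];
  last exact: condE.
rewrite -(pair_big_dep (fun c : 'I_n => ~~ odd c && (c < m.+1)%N)
  (fun (c : 'I_n) (b : {ffun 'I_k -> 'I_n}) =>
    [forall j, ~~ odd (b j)] && ((\sum_j b j)%N <= m - c)%N)
  (fun (c : 'I_n) (b : {ffun 'I_k -> 'I_n}) =>
    'X^(\sum_(j < k.+1) (2 * (j + 1) * h (c, b) j)%N))) /=.
rewrite (eq_bigr (fun c : 'I_n => 'X^(2 * k.+1 * c) * box_series k (m - c)./2)).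
  rewrite -(big_mkord (fun c => ~~ odd c && (c < m.+1)%N)
    (fun c => 'X^(2 * k.+1 * c) * box_series k (m - c)./2)).
  rewrite -(big_nat_widen 0 m.+1 n (fun c => ~~ odd c)) // sum_even_nat /=.
  rewrite box_seriesS big_mkord; apply: eq_bigr => c _.
  by congr ('X^_ * box_series _ _); have := ltn_ord c; lia.
move=> c /andP[_ cm]; rewrite -IH; last by lia.
rewrite mulr_sumr; apply: eq_bigr => b _; rewrite -exprD; congr 'X^_.
rewrite big_ord_recr /= hmax addnC addn1; congr addn.
by apply: eq_bigr => i _; rewrite wl hlift.
Qed.

Lemma sum_even_range n (f : nat -> {poly int}) :
  \sum_(2 <= p < n | ~~ odd p) f p = \sum_(k < (n.-1)./2) f (k.+1).*2.
Proof.
case: n => [|[|n]]; [by rewrite big_geq ?big_ord0 .. |].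
have := sum_even_nat n.+2 f.
rewrite big_ltn_cond // [X in _ + X = _]big_ltn_cond // [RHS]big_ltn //.
by move=> /addrI ->; rewrite big_add1 big_mkord.
Qed.

Lemma hilbert_product n : (0 < n)%N ->
  1 + \sum_(2 <= p < n | ~~ odd p)
        'X^(p * (p + 1) %/ 2) *
        \sum_(a : {ffun 'I_(p %/ 2) -> 'I_n} |
                [forall j, ~~ odd (a j)] && ((\sum_j a j)%N <= n - p - 1)%N)
          'X^(\sum_(j < p %/ 2) (2 * (j + 1) * a j)%N) =
  \prod_(i < (n.-1)./2) (1 + 'X^(4 * i + 3) : {poly int}).
Proof.
move=> n0.
rewrite (eq_bigr (fun i : 'I__ => 1 + 'X^(4 * (0 + i) + 3))) //.
rewrite q_binomial big_ord_recl /= mulr1 /min_degree /= expr0; congr (_ + _).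
rewrite sum_even_range; apply: eq_bigr => k _.
have kn : (k.+1.*2 < n)%N.
  have := ltn_ord k; have := odd_double_half n.-1; lia.
rewrite sum_even_ffun; last by lia.
have -> : (k.+1.*2 %/ 2 = k.+1)%N by rewrite -muln2 mulnK.
congr ('X^_ * box_series _ _); last by rewrite /bump /=; lia.
rewrite /bump leq0n add1n /=.
have -> : (k.+1.*2 * (k.+1.*2 + 1) = (k.+1 * (k.+1.*2 + 1)) * 2)%N.
  by rewrite -muln2 mulnAC.
by rewrite mulnK //; lia.
Qed.

End QBinomial.

(** * The Hilbert series of the O(n)-invariants *)

(* The entries of a tuple of sum at most n - p - 1 are less than n, so it is
   enough to let the tuples a range over functions with values in 'I_n. *)
Theorem proposition7p1 (R : realType) (n : nat) (n_gt0 : (0 < n)%N) :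
  ext_ext2_hilbert (@orthogonal_mx R[i] n) =
  1 + \sum_(2 <= p < n | ~~ odd p)
        'X^(p * (p + 1) %/ 2) *
        \sum_(a : {ffun 'I_(p %/ 2) -> 'I_n} |
                [forall j, ~~ odd (a j)] && ((\sum_j a j)%N <= n - p - 1)%N)
          'X^(\sum_(j < p %/ 2) (2 * (j + 1) * a j)%N).
Proof.
have [ed edP] := edge_enumeration (dim_ext2 R[i] n).
rewrite hilbert_product // -(shifted_even_series edP); apply/polyP => k.
rewrite ext_ext2_hilbertE (dim_ext_ext2_invariants edP) coef_sum.
under eq_bigr do rewrite coefXn eq_sym.
rewrite -sum1_card -natz natr_sum [RHS]big_mkcond [LHS]big_mkcond /=.
by apply: eq_bigr => A _; rewrite inE; case: (shifted_even ed A); case: eqP.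
Qed.
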